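(* Let $\mathscr{C}$ be an extension-closed subcategory of an abelian category $\mathfrak{A}$, and let $X$ be an object in $\mathscr{C}$. (1) The functors $\mathrm{Ext}^1_{\mathscr{C}}(X,-)$ and $\mathrm{Ext}^1_{\mathscr{C}}(-,X)$ are essentially equivalent to the functors $\mathrm{Ext}^1_{\hat{\mathscr{C}}}(X[0],-)$ and $\mathrm{Ext}^1_{\hat{\mathscr{C}}}(-,X[0])$, respectively. (2) The functors $\underline{\mathrm{Hom}}_{\mathscr{C}}(X,-)$ and $\overline{\mathrm{Hom}}_{\mathscr{C}}(-,X)$ are essentially equivalent to the functors $\underline{\mathrm{Hom}}_{\hat{\mathscr{C}}}(X[0],-)$ and $\overline{\mathrm{Hom}}_{\hat{\mathscr{C}}}(-,X[0])$, respectively.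
   Context: An extension-closed subcategory $\mathscr{C}$ of an abelian category $\mathfrak{A}$ is an exact category with $\mathrm{Ext}^1_{\mathscr{C}}(X,Y)=\mathrm{Ext}^1_{\mathfrak{A}}(X,Y)$. $\hat{\mathscr{C}}$ is the full subcategory of the derived category $D(\mathfrak{A})$ of complexes $X^\bullet$ with $H^0(X^\bullet)\in\mathscr{C}$ and $H^i(X^\bullet)=0$ for $i\neq 0$; it is an extension-closed subcategory of the triangulated category $D(\mathfrak{A})$ (closed under middle terms of exact triangles), and one sets $\mathrm{Ext}^1_{\hat{\mathscr{C}}}(M,N)=\mathrm{Hom}_{D(\mathfrak{A})}(M,N[1])$. $X[0]$ is the stalk complex with $X$ in degree $0$, and $\mathbb{D}_{\mathscr{C}}:\mathscr{C}\to\hat{\mathscr{C}}$, $X\mapsto X[0]$, is the restriction of the canonical embedding $\mathfrak{A}\to D(\mathfrak{A})$ (it is an equivalence). For $\mathcal{E}$ being $\mathscr{C}$ or $\hat{\mathscr{C}}$: a morphism $f:X\to Y$ in $\mathcal{E}$ is injectively trivial if the map $\mathrm{Ext}^1_{\mathcal{E}}(M,f):\mathrm{Ext}^1_{\mathcal{E}}(M,X)\to\mathrm{Ext}^1_{\mathcal{E}}(M,Y)$ vanishes for all $M\in\mathcal{E}$, and projectively trivial if $\mathrm{Ext}^1_{\mathcal{E}}(f,M):\mathrm{Ext}^1_{\mathcal{E}}(Y,M)\to\mathrm{Ext}^1_{\mathcal{E}}(X,M)$ vanishes for all $M\in\mathcal{E}$. $\overline{\mathrm{Hom}}_{\mathcal{E}}(X,Y)$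 (resp. $\underline{\mathrm{Hom}}_{\mathcal{E}}(X,Y)$) is the quotient of $\mathrm{Hom}_{\mathcal{E}}(X,Y)$ by the injectively (resp. projectively) trivial morphisms, i.e. the Hom-group in the injectively (resp. projectively) stable category of $\mathcal{E}$. A (covariant or contravariant) functor $F:\mathscr{C}\to\mathrm{Mod}\,\mathbb{Z}$ is essentially equivalent to a functor $\hat F:\hat{\mathscr{C}}\to\mathrm{Mod}\,\mathbb{Z}$ if $F\cong\hat F\circ\mathbb{D}_{\mathscr{C}}$. *)

(* Defs.v *)
From HB Require Import structures.
From mathcomp Require Import all_boot all_order all_algebra boolp.

Set Implicit Arguments.
Unset Strict Implicit.
Unset Printing Implicit Defensive.

Import GRing.Theory.
Local Open Scope ring_scope.
Local Open Scope quotient_scope.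

Record eqvrel (T : Type) := Eqvrel {
  eqv_rel :> T -> T -> Prop;
  eqv_refl : forall x, eqv_rel x x;
  eqv_sym : forall x y, eqv_rel x y -> eqv_rel y x;
  eqv_trans : forall x y z, eqv_rel x y -> eqv_rel y z -> eqv_rel x z }.

Section Quot.
Variables (T : Type) (r : eqvrel T).

Definition beqv : rel {classic T} := fun x y => `[< r x y >].

Lemma beqv_refl : reflexive beqv.
Proof. by move=> x; apply/asboolP/eqv_refl. Qed.

Lemma beqv_sym : symmetric beqv.
Proof. by move=> x y; apply/asboolP/asboolP; apply: eqv_sym. Qed.

Lemma beqv_trans : transitive beqv.
Proof.
by move=> y x z /asboolP xy /asboolP yz; apply/asboolP/(eqv_trans xy yz).
Qed.

Definition beqv_equiv : equiv_rel {classic T} :=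
  EquivRel beqv beqv_refl beqv_sym beqv_trans.

Definition quot : Type := {eq_quot beqv_equiv}.
Definition qcls (x : T) : quot := \pi_{eq_quot beqv_equiv} (x : {classic T}).
Definition qrep (q : quot) : T := repr (q : {eq_quot beqv_equiv}).

Lemma qrepK q : qcls (qrep q) = q.
Proof. exact: (@reprK _ {eq_quot beqv_equiv} q). Qed.

Lemma qclsP x y : qcls x = qcls y <-> r x y.
Proof.
split; first by move=> /eqmodP /asboolP.
by move=> h; apply/eqmodP/asboolP.
Qed.

Lemma qrep_cls x : r (qrep (qcls x)) x.
Proof. by apply/qclsP; rewrite qrepK. Qed.

Lemma qind (P : quot -> Prop) : (forall x, P (qcls x)) -> forall q, P q.
Proof. by move=> h q; rewrite -(qrepK q). Qed.

End Quot.

Section MkZmod.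
Variables (T : Type) (z : T) (o : T -> T) (a : T -> T -> T).
Hypotheses (aA : associative a) (aC : commutative a).
Hypotheses (a0 : left_id z a) (aN : left_inverse z o a).

Definition mkzmod : zmodType :=
  HB.pack {classic T}
    (GRing.isZmodule.Build {classic T}
       (aA : associative (a : {classic T} -> {classic T} -> {classic T}))
       aC a0 aN).
End MkZmod.

Section QuotGroup.
Variables (V : zmodType) (S : V -> Prop).
Hypotheses (S0 : S 0) (SN : forall x, S x -> S (- x)).
Hypothesis SD : forall x y, S x -> S y -> S (x + y).

Let r (x y : V) := S (x - y).

Lemma qg_refl x : r x x. Proof. by rewrite /r subrr. Qed.

Lemma qg_sym x y : r x y -> r y x.
Proof. by rewrite /r => /SN; rewrite opprB. Qed.

Lemma qg_trans x y z : r x y -> r y z -> r x z.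
Proof. by rewrite /r => h k; have := SD h k; rewrite addrA subrK. Qed.

Definition qg_eqv : eqvrel V := Eqvrel qg_refl qg_sym qg_trans.

Definition qg_add (x y : quot qg_eqv) := qcls qg_eqv (qrep x + qrep y).
Definition qg_opp (x : quot qg_eqv) := qcls qg_eqv (- qrep x).

Lemma qg_addE x y : qg_add (qcls _ x) (qcls _ y) = qcls _ (x + y).
Proof.
apply/qclsP; have := SD (qrep_cls qg_eqv x) (qrep_cls qg_eqv y).
by rewrite /= /r opprD addrACA.
Qed.

Lemma qg_oppE x : qg_opp (qcls _ x) = qcls _ (- x).
Proof. by apply/qclsP; have := SN (qrep_cls qg_eqv x); rewrite /= /r opprD. Qed.

Lemma qg_addA : associative qg_add.
Proof.
elim/qind=> x; elim/qind=> y; elim/qind=> z.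
by rewrite !qg_addE addrA.
Qed.

Lemma qg_addC : commutative qg_add.
Proof. by elim/qind=> x; elim/qind=> y; rewrite !qg_addE addrC. Qed.

Lemma qg_add0 : left_id (qcls _ 0) qg_add.
Proof. by elim/qind=> x; rewrite qg_addE add0r. Qed.

Lemma qg_addN : left_inverse (qcls _ 0) qg_opp qg_add.
Proof. by elim/qind=> x; rewrite qg_oppE qg_addE addNr. Qed.

Definition quot_group : zmodType := mkzmod qg_addA qg_addC qg_add0 qg_addN.

End QuotGroup.

Record preadd := Preadd {
  ob :> Type;
  hom : ob -> ob -> zmodType;
  idm : forall X, hom X X;
  cmp : forall X Y Z, hom Y Z -> hom X Y -> hom X Z;
  cmpA : forall X Y Z T (h : hom Z T) (g : hom Y Z) (f : hom X Y),
    cmp h (cmp g f) = cmp (cmp h g) f;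
  cmp1m : forall X Y (f : hom X Y), cmp (idm Y) f = f;
  cmpm1 : forall X Y (f : hom X Y), cmp f (idm X) = f;
  cmpDl : forall X Y Z (g g' : hom Y Z) (f : hom X Y),
    cmp (g + g') f = cmp g f + cmp g' f;
  cmpDr : forall X Y Z (g : hom Y Z) (f f' : hom X Y),
    cmp g (f + f') = cmp g f + cmp g f' }.

Arguments hom {p}.
Arguments idm {p}.
Arguments cmp {p X Y Z}.

Notation "g \oc f" := (cmp g f) (at level 40, left associativity).

Section PreaddTheory.
Variable C : preadd.
Implicit Types X Y Z : C.

Lemma cmp0m X Y Z (f : hom X Y) : (0 : hom Y Z) \oc f = 0.
Proof. by apply: (@addrI _ (0 \oc f)); rewrite -cmpDl !addr0. Qed.

Lemma cmpm0 X Y Z (g : hom Y Z) : g \oc (0 : hom X Y) = 0.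
Proof. by apply: (@addrI _ (g \oc 0)); rewrite -cmpDr !addr0. Qed.

Lemma cmpNm X Y Z (g : hom Y Z) (f : hom X Y) : (- g) \oc f = - (g \oc f).
Proof. by apply: (@addrI _ (g \oc f)); rewrite -cmpDl !subrr cmp0m. Qed.

Lemma cmpmN X Y Z (g : hom Y Z) (f : hom X Y) : g \oc (- f) = - (g \oc f).
Proof. by apply: (@addrI _ (g \oc f)); rewrite -cmpDr !subrr cmpm0. Qed.

Definition is_iso X Y (f : hom X Y) :=
  exists g : hom Y X, g \oc f = idm X /\ f \oc g = idm Y.
Definition isomorphic X Y := exists f : hom X Y, is_iso f.
Definition is_zero X := idm X = 0.

Definition mono X Y (f : hom X Y) :=
  forall T (u v : hom T X), f \oc u = f \oc v -> u = v.
Definition epi X Y (f : hom X Y) :=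
  forall T (u v : hom Y T), u \oc f = v \oc f -> u = v.

Definition is_kernel K X Y (k : hom K X) (f : hom X Y) :=
  f \oc k = 0 /\
  forall T (g : hom T X), f \oc g = 0 -> exists! u : hom T K, k \oc u = g.
Definition is_cokernel X Y Q (q : hom Y Q) (f : hom X Y) :=
  q \oc f = 0 /\
  forall T (g : hom Y T), g \oc f = 0 -> exists! u : hom Q T, u \oc q = g.

Lemma kernel_mono K X Y (k : hom K X) (f : hom X Y) : is_kernel k f -> mono k.
Proof.
move=> [fk h] T u v e; have [|w [_ uw]] := h T (k \oc u).
  by rewrite cmpA fk cmp0m.
by rewrite -(uw u) // -(uw v).
Qed.

Lemma cokernel_epi X Y Q (q : hom Y Q) (f : hom X Y) :
  is_cokernel q f -> epi q.
Proof.
move=> [qf h] T u v e; have [|w [_ uw]] := h T (u \oc q).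
  by rewrite -cmpA qf cmpm0.
by rewrite -(uw u) // -(uw v).
Qed.

Lemma mono0 X Y (f : hom X Y) :
  (forall T (u : hom T X), f \oc u = 0 -> u = 0) -> mono f.
Proof.
move=> h T u v e; apply/eqP; rewrite -subr_eq0; apply/eqP; apply: h.
by rewrite cmpDr cmpmN e subrr.
Qed.

Lemma epi0 X Y (f : hom X Y) :
  (forall T (u : hom Y T), u \oc f = 0 -> u = 0) -> epi f.
Proof.
move=> h T u v e; apply/eqP; rewrite -subr_eq0; apply/eqP; apply: h.
by rewrite cmpDl cmpNm e subrr.
Qed.

Lemma is_iso_cmp X Y Z (g : hom Y Z) (f : hom X Y) :
  is_iso g -> is_iso f -> is_iso (g \oc f).
Proof.
move=> [g' [gl gr]] [f' [fl fr]]; exists (f' \oc g'); split.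
  by rewrite -cmpA [g' \oc _]cmpA gl cmp1m.
by rewrite -cmpA [f \oc _]cmpA fr cmp1m.
Qed.

End PreaddTheory.

Section Opposite.
Variable C : preadd.

Definition opcat : preadd := {|
  ob := C;
  hom X Y := hom Y X;
  idm X := idm X;
  cmp X Y Z g f := f \oc g;
  cmpA X Y Z T h g f := esym (cmpA f g h);
  cmp1m X Y f := cmpm1 f;
  cmpm1 X Y f := cmp1m f;
  cmpDl X Y Z g g' f := cmpDr f g g';
  cmpDr X Y Z g f f' := cmpDl f f' g |}.
End Opposite.

Section FullSub.
Variables (C : preadd) (P : C -> Prop).

Definition fullsub : preadd := {|
  ob := {X : C | P X};
  hom X Y := hom (sval X) (sval Y);
  idm X := idm (sval X);
  cmp X Y Z g f := g \oc f;
  cmpA X Y Z T h g f := cmpA h g f;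
  cmp1m X Y f := cmp1m f;
  cmpm1 X Y f := cmpm1 f;
  cmpDl X Y Z g g' f := cmpDl g g' f;
  cmpDr X Y Z g f f' := cmpDr g f f' |}.
End FullSub.

Record addcat := Addcat {
  addcat_preadd :> preadd;
  zob : addcat_preadd;
  zobP : is_zero zob;
  bip : addcat_preadd -> addcat_preadd -> addcat_preadd;
  in1 : forall X Y, hom X (bip X Y);
  in2 : forall X Y, hom Y (bip X Y);
  pr1 : forall X Y, hom (bip X Y) X;
  pr2 : forall X Y, hom (bip X Y) Y;
  pr1in1 : forall X Y, pr1 X Y \oc in1 X Y = idm X;
  pr2in2 : forall X Y, pr2 X Y \oc in2 X Y = idm Y;
  pr1in2 : forall X Y, pr1 X Y \oc in2 X Y = 0;
  pr2in1 : forall X Y, pr2 X Y \oc in1 X Y = 0;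
  in_pr : forall X Y, in1 X Y \oc pr1 X Y + in2 X Y \oc pr2 X Y = idm (bip X Y) }.

Arguments in1 {a X Y}.
Arguments in2 {a X Y}.
Arguments pr1 {a X Y}.
Arguments pr2 {a X Y}.
Arguments zob {a}.

Section AddTheory.
Variable A : addcat.
Implicit Types X Y Z : A.

Lemma pr1in1K X Y Z (f : hom Z X) : pr1 \oc ((in1 : hom X (bip X Y)) \oc f) = f.
Proof. by rewrite cmpA pr1in1 cmp1m. Qed.
Lemma pr2in2K X Y Z (f : hom Z Y) : pr2 \oc ((in2 : hom Y (bip X Y)) \oc f) = f.
Proof. by rewrite cmpA pr2in2 cmp1m. Qed.
Lemma pr1in2K X Y Z (f : hom Z Y) : pr1 \oc ((in2 : hom Y (bip X Y)) \oc f) = 0.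
Proof. by rewrite cmpA pr1in2 cmp0m. Qed.
Lemma pr2in1K X Y Z (f : hom Z X) : pr2 \oc ((in1 : hom X (bip X Y)) \oc f) = 0.
Proof. by rewrite cmpA pr2in1 cmp0m. Qed.

Definition bipE := (pr1in1K, pr2in2K, pr1in2K, pr2in1K, pr1in1, pr2in2, pr1in2,
  pr2in1, cmp0m, cmpm0, add0r, addr0, cmp1m, cmpm1).

Lemma bip_extr X Y T (u v : hom T (bip X Y)) :
  pr1 \oc u = pr1 \oc v -> pr2 \oc u = pr2 \oc v -> u = v.
Proof.
move=> e1 e2; rewrite -[u]cmp1m -[v]cmp1m -in_pr !cmpDl -!cmpA.
by rewrite e1 e2.
Qed.

Lemma bip_extl X Y T (u v : hom (bip X Y) T) :
  u \oc in1 = v \oc in1 -> u \oc in2 = v \oc in2 -> u = v.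
Proof.
move=> e1 e2; rewrite -[u]cmpm1 -[v]cmpm1 -in_pr !cmpDr !cmpA.
by rewrite e1 e2.
Qed.

Definition prod_mor T X Y (f : hom T X) (g : hom T Y) : hom T (bip X Y) :=
  in1 \oc f + in2 \oc g.
Definition coprod_mor X Y T (f : hom X T) (g : hom Y T) : hom (bip X Y) T :=
  f \oc pr1 + g \oc pr2.
Definition bip_mor X Y X' Y' (f : hom X X') (g : hom Y Y') :
    hom (bip X Y) (bip X' Y') :=
  prod_mor (f \oc pr1) (g \oc pr2).
Definition diag X : hom X (bip X X) := prod_mor (idm X) (idm X).
Definition codiag X : hom (bip X X) X := coprod_mor (idm X) (idm X).

Lemma pr1_prod T X Y (f : hom T X) (g : hom T Y) : pr1 \oc prod_mor f g = f.
Proof. by rewrite /prod_mor cmpDr !bipE. Qed.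
Lemma pr2_prod T X Y (f : hom T X) (g : hom T Y) : pr2 \oc prod_mor f g = g.
Proof. by rewrite /prod_mor cmpDr !bipE. Qed.
Lemma coprod_in1 X Y T (f : hom X T) (g : hom Y T) : coprod_mor f g \oc in1 = f.
Proof. by rewrite /coprod_mor cmpDl -!cmpA !bipE. Qed.
Lemma coprod_in2 X Y T (f : hom X T) (g : hom Y T) : coprod_mor f g \oc in2 = g.
Proof. by rewrite /coprod_mor cmpDl -!cmpA !bipE. Qed.
Lemma coprod_prod X Y T S (f : hom X T) (g : hom Y T) (f' : hom S X)
    (g' : hom S Y) :
  coprod_mor f g \oc prod_mor f' g' = f \oc f' + g \oc g'.
Proof. by rewrite /coprod_mor cmpDl -!cmpA pr1_prod pr2_prod. Qed.
Lemma pr1_bip X Y X' Y' (f : hom X X') (g : hom Y Y') :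
  pr1 \oc bip_mor f g = f \oc pr1.
Proof. exact: pr1_prod. Qed.
Lemma pr2_bip X Y X' Y' (f : hom X X') (g : hom Y Y') :
  pr2 \oc bip_mor f g = g \oc pr2.
Proof. exact: pr2_prod. Qed.
Lemma bip_in1 X Y X' Y' (f : hom X X') (g : hom Y Y') :
  bip_mor f g \oc in1 = in1 \oc f.
Proof. by rewrite /bip_mor /prod_mor cmpDl -!cmpA !bipE. Qed.
Lemma bip_in2 X Y X' Y' (f : hom X X') (g : hom Y Y') :
  bip_mor f g \oc in2 = in2 \oc g.
Proof. by rewrite /bip_mor /prod_mor cmpDl -!cmpA !bipE. Qed.
Lemma bip_prod X Y X' Y' T (f : hom X X') (g : hom Y Y') (a : hom T X)
    (b : hom T Y) :
  bip_mor f g \oc prod_mor a b = prod_mor (f \oc a) (g \oc b).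
Proof.
by apply: bip_extr;
  rewrite cmpA ?pr1_bip ?pr2_bip -cmpA ?pr1_prod ?pr2_prod.
Qed.

Lemma bip_cmp X Y X' Y' X'' Y'' (f : hom X X') (g : hom Y Y')
    (f' : hom X' X'') (g' : hom Y' Y'') :
  bip_mor (f' \oc f) (g' \oc g) = bip_mor f' g' \oc bip_mor f g.
Proof. by rewrite {2}/bip_mor bip_prod /bip_mor -!cmpA. Qed.

Lemma bip_1 X Y : bip_mor (idm X) (idm Y) = idm (bip X Y).
Proof. by rewrite /bip_mor !cmp1m -in_pr. Qed.

End AddTheory.

Record cfun (C D : preadd) := Cfun {
  cf0 :> C -> D;
  cf1 : forall X Y, hom X Y -> hom (cf0 X) (cf0 Y);
  cf1_id : forall X, cf1 (idm X) = idm (cf0 X);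
  cf1_cmp : forall X Y Z (g : hom Y Z) (f : hom X Y),
    cf1 (g \oc f) = cf1 g \oc cf1 f }.
Arguments cf1 {C D} c {X Y}.

Definition op_cfun (C D : preadd) (F : cfun C D) : cfun (opcat C) (opcat D) :=
  @Cfun (opcat C) (opcat D) F (fun X Y (f : @hom C Y X) => cf1 F f)
    (cf1_id F) (fun X Y Z (g : @hom C Z Y) (f : @hom C Y X) => cf1_cmp F f g).

Record abfun (C : preadd) := Abfun {
  af0 :> C -> zmodType;
  af1 : forall X Y, hom X Y -> af0 X -> af0 Y;
  af1_add : forall X Y (f : hom X Y) x y, af1 f (x + y) = af1 f x + af1 f y;
  af1_id : forall X x, af1 (idm X) x = x;
  af1_cmp : forall X Y Z (g : hom Y Z) (f : hom X Y) x,
    af1 (g \oc f) x = af1 g (af1 f x) }.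
Arguments af1 {C} a {X Y}.

Definition ab_comp (C D : preadd) (F : abfun D) (G : cfun C D) : abfun C.
Proof.
apply: (@Abfun C (fun X => F (G X)) (fun X Y f => af1 F (cf1 G f))).
- by move=> X Y f x y; rewrite af1_add.
- by move=> X x; rewrite cf1_id af1_id.
- by move=> X Y Z g f x; rewrite cf1_cmp af1_cmp.
Defined.

Definition nat_isomorphic (C : preadd) (F G : abfun C) :=
  exists eta : forall X, F X -> G X,
    [/\ forall X, {morph (eta X) : x y / x + y},
        forall X, bijective (eta X)
      & forall X Y (f : hom X Y) x, eta Y (af1 F f x) = af1 G f (eta X x)].

Definition ess_equiv (C D : preadd) (I : cfun C D) (F : abfun C)
  (F' : abfun D) := nat_isomorphic F (ab_comp F' I).

(** A functor from an additive category to sets that preserves finite products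
    has values in abelian groups, with addition [x + y = codiag_* (x, y)]. *)

Section InducedGroup.
Variables (A : addcat) (F : A -> Type).
Variable act : forall X Y : A, hom X Y -> F X -> F Y.
Hypothesis act1 : forall X x, act (idm X) x = x.
Hypothesis actM : forall X Y Z (g : hom Y Z) (f : hom X Y) x,
  act (g \oc f) x = act g (act f x).
Variable pair : forall X Y, F X -> F Y -> F (bip X Y).
Hypothesis pair1 : forall X Y (x : F X) (y : F Y), act pr1 (pair x y) = x.
Hypothesis pair2 : forall X Y (x : F X) (y : F Y), act pr2 (pair x y) = y.
Hypothesis pair_eta : forall X Y (w : F (bip X Y)),
  pair (act pr1 w) (act pr2 w) = w.
Variable zero : forall X, F X.
Hypothesis act0 : forall X Y (x : F X), act (0 : hom X Y) x = zero Y.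

Definition ig_add X (x y : F X) : F X := act (@codiag A X) (pair x y).
Definition ig_opp X (x : F X) : F X := act (- idm X) x.

Lemma ig_actD X Y (a b : hom X Y) x : act (a + b) x = ig_add (act a x) (act b x).
Proof.
rewrite /ig_add; have -> : pair (act a x) (act b x) = act (prod_mor a b) x.
  by rewrite -[RHS]pair_eta -!actM pr1_prod pr2_prod.
by rewrite -actM coprod_prod !cmp1m.
Qed.

Lemma ig_common X Y (x : F X) (y : F Y) :
  exists T (w : F T) (a : hom T X) (b : hom T Y), x = act a w /\ y = act b w.
Proof.
by exists (bip X Y), (pair x y), pr1, pr2; rewrite pair1 pair2.
Qed.

Lemma ig_addA X : associative (@ig_add X).
Proof.
move=> x y z; have [T [w [a [b [-> ->]]]]] := ig_common x y.
have [T' [w' [a' [b' [-> ->]]]]] := ig_common w z.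
by rewrite -!actM -!ig_actD addrA.
Qed.

Lemma ig_addC X : commutative (@ig_add X).
Proof.
move=> x y; have [T [w [a [b [-> ->]]]]] := ig_common x y.
by rewrite -!ig_actD addrC.
Qed.

Lemma ig_add0 X : left_id (zero X) (@ig_add X).
Proof. by move=> x; rewrite -(act0 _ x) -{2}[x]act1 -ig_actD add0r act1. Qed.

Lemma ig_addN X : left_inverse (zero X) (@ig_opp X) (@ig_add X).
Proof.
by move=> x; rewrite -(act0 _ x) /ig_opp -{2}[x]act1 -ig_actD addNr.
Qed.

Definition ig_zmod X : zmodType :=
  mkzmod (@ig_addA X) (@ig_addC X) (@ig_add0 X) (@ig_addN X).

Lemma ig_act_add X Y (c : hom X Y) x y :
  act c (ig_add x y) = ig_add (act c x) (act c y).
Proof.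
have [T [w [a [b [-> ->]]]]] := ig_common x y.
by rewrite -ig_actD -!actM cmpDr ig_actD.
Qed.

End InducedGroup.

(** The localization [C[W^-1]] by generators and relations: morphisms are formal
    composites of morphisms of [C] and inverses of elements of [W], modulo the
    least congruence making [lQ] a functor and [lI w] inverse to [lQ s]. Its
    Hom-sets carry the unique addition for which [lQ] preserves biproducts. *)

Section Loc.
Variables (C : preadd) (W : forall X Y : C, hom X Y -> Prop).

Inductive lexp : C -> C -> Type :=
| LQ X Y of hom X Y : lexp X Y
| LI X Y (s : hom X Y) of W s : lexp Y X
| LC X Y Z of lexp Y Z & lexp X Y : lexp X Z.

Inductive leqv : forall X Y : C, lexp X Y -> lexp X Y -> Prop :=
| leqv_refl X Y (e : lexp X Y) : leqv e e
| leqv_sym X Y (e e' : lexp X Y) : leqv e e' -> leqv e' e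
| leqv_trans X Y (e e' e'' : lexp X Y) :
    leqv e e' -> leqv e' e'' -> leqv e e''
| leqv_cmp X Y Z (g g' : lexp Y Z) (f f' : lexp X Y) :
    leqv g g' -> leqv f f' -> leqv (LC g f) (LC g' f')
| leqv_cmpA X Y Z T (h : lexp Z T) (g : lexp Y Z) (f : lexp X Y) :
    leqv (LC h (LC g f)) (LC (LC h g) f)
| leqv_1m X Y (f : lexp X Y) : leqv (LC (LQ (idm Y)) f) f
| leqv_m1 X Y (f : lexp X Y) : leqv (LC f (LQ (idm X))) f
| leqv_Q X Y Z (g : hom Y Z) (f : hom X Y) :
    leqv (LQ (g \oc f)) (LC (LQ g) (LQ f))
| leqv_Is X Y (s : hom X Y) (w : W s) : leqv (LC (LI w) (LQ s)) (LQ (idm X))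
| leqv_sI X Y (s : hom X Y) (w : W s) : leqv (LC (LQ s) (LI w)) (LQ (idm Y)).

Definition leqv_eqv X Y : eqvrel (lexp X Y) :=
  Eqvrel (@leqv_refl X Y) (@leqv_sym X Y) (@leqv_trans X Y).

Definition lhom X Y : Type := quot (leqv_eqv X Y).
Definition lQ X Y (f : hom X Y) : lhom X Y := qcls (leqv_eqv X Y) (LQ f).
Definition lI X Y (s : hom X Y) (w : W s) : lhom Y X :=
  qcls (leqv_eqv Y X) (LI w).
Definition lcmp X Y Z (g : lhom Y Z) (f : lhom X Y) : lhom X Z :=
  qcls (leqv_eqv X Z) (LC (qrep g) (qrep f)).

Lemma lcmpE X Y Z (g : lexp Y Z) (f : lexp X Y) :
  lcmp (qcls (leqv_eqv Y Z) g) (qcls (leqv_eqv X Y) f) =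
  qcls (leqv_eqv X Z) (LC g f).
Proof.
by apply/qclsP; apply: leqv_cmp;
  [apply: (qrep_cls (leqv_eqv _ _) g)|apply: (qrep_cls (leqv_eqv _ _) f)].
Qed.

Lemma lcmpA X Y Z T (h : lhom Z T) (g : lhom Y Z) (f : lhom X Y) :
  lcmp h (lcmp g f) = lcmp (lcmp h g) f.
Proof.
elim/qind: h => h; elim/qind: g => g; elim/qind: f => f.
by rewrite !lcmpE; apply/qclsP/leqv_cmpA.
Qed.

Lemma lcmp1m X Y (f : lhom X Y) : lcmp (lQ (idm Y)) f = f.
Proof. by elim/qind: f => f; rewrite lcmpE; apply/qclsP/leqv_1m. Qed.

Lemma lcmpm1 X Y (f : lhom X Y) : lcmp f (lQ (idm X)) = f.
Proof. by elim/qind: f => f; rewrite lcmpE; apply/qclsP/leqv_m1. Qed.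

Lemma lQ_cmp X Y Z (g : hom Y Z) (f : hom X Y) :
  lQ (g \oc f) = lcmp (lQ g) (lQ f).
Proof. by rewrite lcmpE; apply/qclsP/leqv_Q. Qed.

Lemma lIs X Y (s : hom X Y) (w : W s) : lcmp (lI w) (lQ s) = lQ (idm X).
Proof. by rewrite lcmpE; apply/qclsP/leqv_Is. Qed.

Lemma lsI X Y (s : hom X Y) (w : W s) : lcmp (lQ s) (lI w) = lQ (idm Y).
Proof. by rewrite lcmpE; apply/qclsP/leqv_sI. Qed.

Lemma lhom_ind (P : forall X Y, lhom X Y -> Prop) :
  (forall X Y (f : hom X Y), P X Y (lQ f)) ->
  (forall X Y (s : hom X Y) (w : W s), P Y X (lI w)) ->
  (forall X Y Z (g : lhom Y Z) (f : lhom X Y),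
     P Y Z g -> P X Y f -> P X Z (lcmp g f)) ->
  forall X Y (f : lhom X Y), P X Y f.
Proof.
move=> hQ hI hC X Y; elim/qind=> e; elim: e => {X Y} //.
by move=> X Y Z g Pg f Pf; rewrite -lcmpE; apply: hC.
Qed.

End Loc.

Section LocMap.
Variables (C C' : preadd) (W : forall X Y : C, hom X Y -> Prop).
Variable W' : forall X Y : C', hom X Y -> Prop.
Variables (G : cfun C C').
Hypothesis GW : forall X Y (s : hom X Y), W s -> W' (cf1 G s).

Fixpoint lexp_map X Y (e : lexp W X Y) : lexp W' (G X) (G Y) :=
  match e in lexp _ X Y return lexp W' (G X) (G Y) with
  | LQ _ _ f => LQ W' (cf1 G f)
  | LI _ _ _ w => LI (GW w)
  | LC _ _ _ g f => LC (lexp_map g) (lexp_map f)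
  end.

Lemma lexp_map_eqv X Y (e e' : lexp W X Y) :
  leqv e e' -> leqv (lexp_map e) (lexp_map e').
Proof.
elim=> {X Y e e'} /=.
- by move=> *; apply: leqv_refl.
- by move=> *; apply: leqv_sym.
- by move=> X Y e e' e'' _ h _; apply: leqv_trans.
- by move=> *; apply: leqv_cmp.
- by move=> *; apply: leqv_cmpA.
- by move=> *; rewrite cf1_id; apply: leqv_1m.
- by move=> *; rewrite cf1_id; apply: leqv_m1.
- by move=> *; rewrite cf1_cmp; apply: leqv_Q.
- by move=> *; rewrite cf1_id; apply: leqv_Is.
- by move=> *; rewrite cf1_id; apply: leqv_sI.
Qed.

Definition lmap X Y (f : lhom W X Y) : lhom W' (G X) (G Y) :=
  qcls (leqv_eqv W' (G X) (G Y)) (lexp_map (qrep f)).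

Lemma lmapE X Y (e : lexp W X Y) :
  lmap (qcls (leqv_eqv W X Y) e) = qcls (leqv_eqv W' _ _) (lexp_map e).
Proof. by apply/qclsP/lexp_map_eqv/(qrep_cls (leqv_eqv _ _ _)). Qed.

Lemma lmapQ X Y (f : hom X Y) : lmap (lQ W f) = lQ W' (cf1 G f).
Proof. exact: lmapE. Qed.

Lemma lmapI X Y (s : hom X Y) (w : W s) : lmap (lI w) = lI (GW w).
Proof. exact: lmapE. Qed.

Lemma lmap_cmp X Y Z (g : lhom W Y Z) (f : lhom W X Y) :
  lmap (lcmp g f) = lcmp (lmap g) (lmap f).
Proof.
elim/qind: g => g; elim/qind: f => f; rewrite [X in lmap X]lcmpE.
by rewrite [LHS]lmapE (lmapE g) (lmapE f) [RHS]lcmpE.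
Qed.

End LocMap.

Section LocNat.
Variables (C C' : preadd) (W : forall X Y : C, hom X Y -> Prop).
Variable W' : forall X Y : C', hom X Y -> Prop.
Variables (G G' : cfun C C').
Hypothesis GW : forall X Y (s : hom X Y), W s -> W' (cf1 G s).
Hypothesis GW' : forall X Y (s : hom X Y), W s -> W' (cf1 G' s).
Variable eta : forall X, hom (G X) (G' X).
Hypothesis eta_nat : forall X Y (f : hom X Y),
  eta Y \oc cf1 G f = cf1 G' f \oc eta X.

Lemma lmap_nat X Y (f : lhom W X Y) :
  lcmp (lQ W' (eta Y)) (lmap GW f) = lcmp (lmap GW' f) (lQ W' (eta X)).
Proof.
elim/lhom_ind: f => {X Y} [X Y f|X Y s w|X Y Z g f hg hf].
- by rewrite !lmapQ -!lQ_cmp eta_nat.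
- rewrite !lmapI -[LHS]lcmp1m -(lIs (GW' w)) -lcmpA.
  rewrite [lcmp (lQ _ (cf1 G' s)) _]lcmpA -lQ_cmp -eta_nat lQ_cmp.
  by rewrite -lcmpA lsI lcmpm1.
- by rewrite !lmap_cmp lcmpA hg -lcmpA hf lcmpA.
Qed.
End LocNat.

Section LocAdd.
Variables (C : addcat) (W : forall X Y : C, hom X Y -> Prop).
Hypothesis W1 : forall X : C, W (idm X).
Hypothesis WD : forall (X Y X' Y' : C) (f : hom X X') (g : hom Y Y'),
  W f -> W g -> W (bip_mor f g).

Local Notation Q := (@lQ _ W _ _).
Local Notation "g ** f" := (lcmp g f) (at level 40, left associativity).

Definition idf : cfun C C :=
  @Cfun C C id (fun _ _ => id) (fun=> erefl) (fun _ _ _ _ _ => erefl).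
Definition bipr (Z : C) : cfun C C.
Proof.
apply: (@Cfun C C (fun X => bip X Z) (fun X Y f => bip_mor f (idm Z))).
- by move=> X; rewrite bip_1.
- by move=> X Y T g f; rewrite -bip_cmp cmp1m.
Defined.
Definition bipl (Z : C) : cfun C C.
Proof.
apply: (@Cfun C C (fun X => bip Z X) (fun X Y f => bip_mor (idm Z) f)).
- by move=> X; rewrite bip_1.
- by move=> X Y T g f; rewrite -bip_cmp cmp1m.
Defined.
Definition bipd : cfun C C.
Proof.
apply: (@Cfun C C (fun X => bip X X) (fun X Y f => bip_mor f f)).
- by move=> X; rewrite bip_1.
- by move=> X Y T g f; rewrite -bip_cmp.
Defined.

Lemma idfW X Y (s : hom X Y) : W s -> W (cf1 idf s). Proof. by []. Qed.
Lemma biprW Z X Y (s : hom X Y) : W s -> W (cf1 (bipr Z) s).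
Proof. by move=> w; apply: WD. Qed.
Lemma biplW Z X Y (s : hom X Y) : W s -> W (cf1 (bipl Z) s).
Proof. by move=> w; apply: WD. Qed.
Lemma bipdW X Y (s : hom X Y) : W s -> W (cf1 bipd s).
Proof. by move=> w; apply: WD. Qed.

Lemma lmap_idf X Y (f : lhom W X Y) : lmap idfW f = f.
Proof.
elim/lhom_ind: f => {X Y} [X Y f|X Y s w|X Y Z g f hg hf].
- by rewrite lmapQ.
- by rewrite lmapI; congr lI; apply: Prop_irrelevance.
- by rewrite lmap_cmp hg hf.
Qed.

Definition lbr Z X Y (f : lhom W X Y) : lhom W (bip X Z) (bip Y Z) :=
  lmap (biprW Z) f.
Definition lbl Z X Y (f : lhom W X Y) : lhom W (bip Z X) (bip Z Y) :=
  lmap (biplW Z) f.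

Lemma lpr1_br Z X Y (f : lhom W X Y) : Q pr1 ** lbr Z f = f ** Q pr1.
Proof.
have h (U V : C) (g : hom U V) : pr1 \oc cf1 (bipr Z) g = cf1 idf g \oc pr1.
  by rewrite pr1_bip.
have := lmap_nat (G := bipr Z) (G' := idf) (eta := fun X => pr1) (biprW Z) idfW h f.
by rewrite lmap_idf.
Qed.

Lemma lpr2_bl Z X Y (f : lhom W X Y) : Q pr2 ** lbl Z f = f ** Q pr2.
Proof.
have h (U V : C) (g : hom U V) : pr2 \oc cf1 (bipl Z) g = cf1 idf g \oc pr2.
  by rewrite pr2_bip.
have := lmap_nat (G := bipl Z) (G' := idf) (eta := fun X => pr2) (biplW Z) idfW h f.
by rewrite lmap_idf.
Qed.

Lemma lpr2_br Z X Y (f : lhom W X Y) : Q pr2 ** lbr Z f = Q pr2.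
Proof.
rewrite /lbr; elim/lhom_ind: f => {X Y} [X Y f|X Y s w|X Y T g f hg hf].
- by rewrite lmapQ -lQ_cmp pr2_bip cmp1m.
- rewrite lmapI; have e : @pr2 C X Z = pr2 \oc cf1 (bipr Z) s.
    by rewrite pr2_bip cmp1m.
  by rewrite [in LHS]e lQ_cmp -lcmpA lsI lcmpm1.
- by rewrite lmap_cmp lcmpA hg.
Qed.

Lemma lpr1_bl Z X Y (f : lhom W X Y) : Q pr1 ** lbl Z f = Q pr1.
Proof.
rewrite /lbl; elim/lhom_ind: f => {X Y} [X Y f|X Y s w|X Y T g f hg hf].
- by rewrite lmapQ -lQ_cmp pr1_bip cmp1m.
- rewrite lmapI; have e : @pr1 C Z X = pr1 \oc cf1 (bipl Z) s.
    by rewrite pr1_bip cmp1m.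
  by rewrite [in LHS]e lQ_cmp -lcmpA lsI lcmpm1.
- by rewrite lmap_cmp lcmpA hg.
Qed.

Lemma lb_interchange X Y X' Y' (f : lhom W X X') (g : lhom W Y Y') :
  lbr Y' f ** lbl X g = lbl X' g ** lbr Y f.
Proof.
rewrite {1 2}/lbr; elim/lhom_ind: f => {X X'} [X X' f|X X' s w|X T X' h f hh hf].
- rewrite !lmapQ.
  have e (U V : C) (k : hom U V) :
      bip_mor f (idm V) \oc cf1 (bipl X) k = cf1 (bipl X') k \oc bip_mor f (idm U).
    by rewrite -!bip_cmp !cmp1m !cmpm1.
  exact: (lmap_nat (G := bipl X) (G' := bipl X') (eta := fun V => bip_mor f (idm V)) (biplW X) (biplW X') e g).
- have e (U V : C) (k : hom U V) :
      bip_mor s (idm V) \oc cf1 (bipl X) k = cf1 (bipl X') k \oc bip_mor s (idm U).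
    by rewrite -!bip_cmp !cmp1m !cmpm1.
  have := lmap_nat (G := bipl X) (G' := bipl X') (eta := fun V => bip_mor s (idm V)) (biplW X) (biplW X') e g.
  rewrite -/(lbl X g) -/(lbl X' g) !lmapI => E.
  rewrite -[LHS]lcmpm1 -(lsI (biprW Y w)) !lcmpA; congr (_ ** _).
  rewrite -!lcmpA; have /= <- := E.
  by rewrite lcmpA lIs lcmp1m.
- by rewrite !lmap_cmp -lcmpA hf lcmpA hh -lcmpA.
Qed.

Lemma ldiag_nat X Y (f : lhom W X Y) :
  Q (@diag C Y) ** f = lbr Y f ** lbl X f ** Q (@diag C X).
Proof.
have e (U V : C) (k : hom U V) :
    @diag C V \oc cf1 idf k = cf1 bipd k \oc @diag C U.
  rewrite /= bip_prod; apply: bip_extr.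
    by rewrite cmpA !pr1_prod cmp1m cmpm1.
  by rewrite cmpA !pr2_prod cmp1m cmpm1.
have := lmap_nat (G := idf) (G' := bipd) (eta := fun V => diag V) idfW bipdW e f.
rewrite lmap_idf => ->; congr (_ ** _).
elim/lhom_ind: f => {X Y e} [X Y f|X Y s w|X Y Z g f hg hf].
- by rewrite /lbr /lbl !lmapQ -lQ_cmp -bip_cmp cmp1m cmpm1.
- have -> : lbr X (lI w) ** lbl Y (lI w) = lbl X (lI w) ** lbr Y (lI w).
    exact: lb_interchange.
  rewrite lmapI /lbl /lbr !lmapI.
  rewrite -[LHS]lcmp1m -(lIs (biplW X w)) -lcmpA; congr (_ ** _).
  rewrite -[LHS]lcmp1m -(lIs (biprW Y w)) -lcmpA; rewrite -[RHS]lcmpm1.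
  congr (_ ** _); rewrite lcmpA -lQ_cmp -bip_cmp cmp1m cmpm1.
  exact: (lsI (bipdW w)).
- rewrite lmap_cmp hg hf /lbr /lbl !lmap_cmp -/(lbr _ _) -/(lbl _ _).
  rewrite -!lcmpA; congr (_ ** _); rewrite !lcmpA; congr (_ ** _).
  by rewrite [RHS]lb_interchange.
Qed.

Section Hom.
Variable T : C.

Definition lact X Y (a : hom X Y) (x : lhom W T X) := Q a ** x.
Definition lpair X Y (x : lhom W T X) (y : lhom W T Y) : lhom W T (bip X Y) :=
  lbr Y x ** lbl T y ** Q (@diag C T).
Definition lzero X : lhom W T X := Q 0.

Lemma lact1 X (x : lhom W T X) : lact (idm X) x = x.
Proof. exact: lcmp1m. Qed.
Lemma lactM X Y Z (g : hom Y Z) (f : hom X Y) x :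
  lact (g \oc f) x = lact g (lact f x).
Proof. by rewrite /lact lQ_cmp lcmpA. Qed.

Lemma lpair1 X Y (x : lhom W T X) (y : lhom W T Y) :
  lact pr1 (lpair x y) = x.
Proof.
rewrite /lact /lpair !lcmpA lpr1_br -[x ** _ ** _]lcmpA lpr1_bl -lcmpA.
by rewrite -lQ_cmp pr1_prod lcmpm1.
Qed.
Lemma lpair2 X Y (x : lhom W T X) (y : lhom W T Y) :
  lact pr2 (lpair x y) = y.
Proof.
rewrite /lact /lpair !lcmpA lpr2_br lpr2_bl -lcmpA.
by rewrite -lQ_cmp pr2_prod lcmpm1.
Qed.

Lemma lpair_eta X Y (w : lhom W T (bip X Y)) :
  lpair (lact pr1 w) (lact pr2 w) = w.
Proof.
have -> : lpair (lact pr1 w) (lact pr2 w) =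
    lbr Y (Q pr1) ** lbl _ (Q pr2) ** (lbr _ w ** lbl T w ** Q (diag T)).
  have sw := lb_interchange w (Q (@pr2 C X Y)).
  rewrite /lpair {1}/lbr {1}/lbl !lmap_cmp -/(lbr _ _) -/(lbl _ _) !lcmpA.
  by congr (_ ** _ ** _); rewrite -!lcmpA; congr (_ ** _).
rewrite -ldiag_nat lcmpA /lbr /lbl !lmapQ -!lQ_cmp.
have -> : cf1 (bipr Y) (@pr1 C X Y) \oc cf1 (bipl (bip X Y)) (@pr2 C X Y)
    \oc diag (bip X Y) = idm (bip X Y).
  rewrite /= -bip_cmp cmp1m cmpm1 bip_prod !cmpm1.
  by rewrite /prod_mor in_pr.
exact: lcmp1m.
Qed.

Lemma lQ0_l X Y (x : lhom W X Y) : x ** Q (0 : hom T X) = Q 0.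
Proof.
elim/lhom_ind: x => {X Y} [X Y f|X Y s w|X Y Z g f hg hf].
- by rewrite -lQ_cmp cmpm0.
- by rewrite -(cmpm0 T s) lQ_cmp lcmpA lIs lcmp1m.
- by rewrite -lcmpA hf hg.
Qed.

End Hom.

Lemma lQ0_r T X Y (x : lhom W T X) : Q (0 : hom X Y) ** x = Q 0.
Proof.
elim/lhom_ind: x => {T X} [T X f|T X s w|T X Z g f hg hf].
- by rewrite -lQ_cmp cmp0m.
- by rewrite -(cmp0m Y s) lQ_cmp -lcmpA lsI lcmpm1.
- by rewrite lcmpA hg hf.
Qed.

Definition lhomz T X : zmodType :=
  ig_zmod (@lact1 T) (@lactM T) (@lpair1 T) (@lpair2 T) (@lpair_eta T)
    (fun X Y => @lQ0_r T X Y) X.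

Lemma lQD T X Y (a b : hom X Y) (x : lhom W T X) :
  Q (a + b) ** x = (Q a ** x : lhomz T Y) + (Q b ** x : lhomz T Y).
Proof. exact: (ig_actD (@lactM T) (@lpair_eta T)). Qed.

Lemma lQcmpDr T X Y (c : hom X Y) (x y : lhomz T X) :
  Q c ** (x + y) = (Q c ** x : lhomz T Y) + (Q c ** y : lhomz T Y).
Proof.
exact: (ig_act_add (@lactM T) (@lpair1 T) (@lpair2 T) (@lpair_eta T)).
Qed.

Lemma lcmpDr X Y Z (g : lhomz Y Z) (f f' : lhomz X Y) :
  lcmp g (f + f') = (lcmp g f : lhomz X Z) + lcmp g f'.
Proof.
elim/lhom_ind: g f f' => {Y Z} [Y Z c|Y Z s w|Y T Z g h hg hh] f f'.
- exact: lQcmpDr.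
- set u : lhomz X Y := lI w ** f; set v : lhomz X Y := lI w ** f'.
  have fE : f = Q s ** u by rewrite /u lcmpA lsI lcmp1m.
  have fE' : f' = Q s ** v by rewrite /v lcmpA lsI lcmp1m.
  by rewrite {1}fE {1}fE' -lQcmpDr lcmpA lIs lcmp1m.
- by rewrite -!lcmpA hh hg.
Qed.

Lemma lcmpDl X Y Z (g g' : lhomz Y Z) (f : lhomz X Y) :
  lcmp (g + g') f = (lcmp g f : lhomz X Z) + lcmp g' f.
Proof.
have [T [w [a [b [-> ->]]]]] := ig_common (@lpair1 Y) (@lpair2 Y) g g'.
by rewrite /lact -lQD -lcmpA lQD -!lcmpA.
Qed.

Definition loc : preadd := {|
  ob := C;
  hom X Y := lhomz X Y;
  idm X := Q (idm X);
  cmp X Y Z g f := lcmp (g : lhom W Y Z) (f : lhom W X Y) : lhomz X Z;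
  cmpA X Y Z T h g f := lcmpA h g f;
  cmp1m X Y f := lcmp1m f;
  cmpm1 X Y f := lcmpm1 f;
  cmpDl := lcmpDl;
  cmpDr := lcmpDr |}.

End LocAdd.

Record abelian := Abelian {
  abelian_addcat :> addcat;
  kerob : forall X Y : abelian_addcat, hom X Y -> abelian_addcat;
  kerm : forall (X Y : abelian_addcat) (f : hom X Y), hom (kerob f) X;
  kermP : forall (X Y : abelian_addcat) (f : hom X Y), is_kernel (kerm f) f;
  cokob : forall X Y : abelian_addcat, hom X Y -> abelian_addcat;
  cokm : forall (X Y : abelian_addcat) (f : hom X Y), hom Y (cokob f);
  cokmP : forall (X Y : abelian_addcat) (f : hom X Y), is_cokernel (cokm f) f;
  mono_normal : forall (X Y : abelian_addcat) (f : hom X Y),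
    mono f -> is_kernel f (cokm f);
  epi_normal : forall (X Y : abelian_addcat) (f : hom X Y),
    epi f -> is_cokernel f (kerm f) }.

Section AbelianTheory.
Variable A : abelian.
Implicit Types X Y Z : A.

Lemma kernel_lift K X Y (k : hom K X) (f : hom X Y) T (g : hom T X) :
  is_kernel k f -> f \oc g = 0 -> exists u, k \oc u = g.
Proof. by move=> [_ h] /h [u [e _]]; exists u. Qed.

Lemma cokernel_desc Q X Y (q : hom Y Q) (f : hom X Y) T (g : hom Y T) :
  is_cokernel q f -> g \oc f = 0 -> exists u, u \oc q = g.
Proof. by move=> [_ h] /h [u [e _]]; exists u. Qed.

Lemma mk_kernel K X Y (k : hom K X) (f : hom X Y) :
  f \oc k = 0 -> mono k ->
  (forall T (g : hom T X), f \oc g = 0 -> exists u, k \oc u = g) ->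
  is_kernel k f.
Proof.
move=> fk mk h; split=> // T g /h [u e]; exists u; split=> // v e'.
by apply: mk; rewrite e.
Qed.

Lemma mk_cokernel Q X Y (q : hom Y Q) (f : hom X Y) :
  q \oc f = 0 -> epi q ->
  (forall T (g : hom Y T), g \oc f = 0 -> exists u, u \oc q = g) ->
  is_cokernel q f.
Proof.
move=> qf eq h; split=> // T g /h [u e]; exists u; split=> // v e'.
by apply: eq; rewrite e.
Qed.

Lemma epi_cokernel K X Y (k : hom K X) (f : hom X Y) :
  is_kernel k f -> epi f -> is_cokernel f k.
Proof.
move=> kk ef; apply: mk_cokernel => //; first exact: kk.1.
move=> T g gk; apply: (cokernel_desc (epi_normal ef)).
have [u <-] := kernel_lift kk (kermP f).1.
by rewrite cmpA gk cmp0m.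
Qed.

Lemma mono_kernel X Y Q (q : hom Y Q) (f : hom X Y) :
  is_cokernel q f -> mono f -> is_kernel f q.
Proof.
move=> qq mf; apply: mk_kernel => //; first exact: qq.1.
move=> T g qg; apply: (kernel_lift (mono_normal mf)).
have [u <-] := cokernel_desc qq (cokmP f).1.
by rewrite -cmpA qg cmpm0.
Qed.

Lemma mono_epi_iso X Y (f : hom X Y) : mono f -> epi f -> is_iso f.
Proof.
move=> mf ef; have c0 : cokm f = 0.
  by apply: ef; rewrite (cokmP f).1 cmp0m.
have [|g e] := kernel_lift (T := Y) (g := idm Y) (mono_normal mf).
  by rewrite c0 cmp0m.
by exists g; split=> //; apply: mf; rewrite cmpA e cmp1m cmpm1.
Qed.

Definition ses Y E X (i : hom Y E) (p : hom E X) :=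
  is_kernel i p /\ is_cokernel p i.

Definition extension_closed (P : A -> Prop) :=
  forall Y E X (i : hom Y E) (p : hom E X), ses i p -> P Y -> P X -> P E.

(** An element [E : ext X Y] is a short exact sequence [0 -> Y -> E -> X -> 0]. *)
Record ext X Y := Ext {
  emid : A;
  einj : hom Y emid;
  eprj : hom emid X;
  eses : ses einj eprj }.

Definition emor X Y X' Y' (a : hom Y Y') (b : hom X X')
    (E : ext X Y) (F : ext X' Y') :=
  exists h : hom (emid E) (emid F),
    h \oc einj E = einj F \oc a /\ eprj F \oc h = b \oc eprj E.

Lemma emor_id X Y (E : ext X Y) : emor (idm Y) (idm X) E E.
Proof. by exists (idm (emid E)); rewrite !cmp1m !cmpm1. Qed.

Lemma emor_cmp X Y X' Y' X'' Y'' (a : hom Y Y') (b : hom X X')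
    (a' : hom Y' Y'') (b' : hom X' X'') (E : ext X Y) (F : ext X' Y')
    (G : ext X'' Y'') :
  emor a' b' F G -> emor a b E F -> emor (a' \oc a) (b' \oc b) E G.
Proof.
move=> [h' [h1' h2']] [h [h1 h2]]; exists (h' \oc h); split.
  by rewrite -cmpA h1 cmpA h1' cmpA.
by rewrite cmpA h2' -cmpA h2 cmpA.
Qed.

Lemma emor_sym X Y (E F : ext X Y) :
  emor (idm Y) (idm X) E F -> emor (idm Y) (idm X) F E.
Proof.
have [ki cp] := eses E; have [kj cq] := eses F.
move=> [h []]; rewrite cmpm1 cmp1m => h1 h2; have [g [gh hg]] : is_iso h.
  apply: mono_epi_iso.
    apply: mono0 => T u hu; have [|v ev] := kernel_lift (g := u) ki.
      by rewrite -h2 -cmpA hu cmpm0.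
    have v0 : v = 0.
      by apply: (kernel_mono kj); rewrite cmpm0 -h1 -cmpA ev.
    by rewrite -ev v0 cmpm0.
  apply: epi0 => T u uh; have [|v ev] := cokernel_desc (g := u) cq.
    by rewrite -h1 cmpA uh cmp0m.
  have v0 : v = 0.
    by apply: (cokernel_epi cp); rewrite cmp0m -h2 cmpA ev.
  by rewrite -ev v0 cmp0m.
exists g; rewrite /= cmpm1 cmp1m -h1 -h2; split.
  by rewrite cmpA gh cmp1m.
by rewrite -cmpA hg cmpm1.
Qed.

Definition ext_eqv X Y : eqvrel (ext X Y).
Proof.
apply: (@Eqvrel _ (emor (idm Y) (idm X))).
- exact: emor_id.
- exact: emor_sym.
- by move=> E F G EF FG; have := emor_cmp FG EF; rewrite !cmp1m.
Defined.

Section Pull.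
Variables (X Y X' : A) (b : hom X' X) (E : ext X Y).

Definition pull_eq : hom (bip (emid E) X') X := coprod_mor (eprj E) (- b).
Definition pull_prj : hom (kerob pull_eq) X' := pr2 \oc kerm pull_eq.

Lemma pull_comm : eprj E \oc (pr1 \oc kerm pull_eq) = b \oc pull_prj.
Proof.
rewrite /pull_prj; move: (kerob pull_eq) (kerm pull_eq) (kermP pull_eq).1 => K k.
rewrite /pull_eq /coprod_mor cmpDl !cmpNm -!cmpA => /eqP.
by rewrite subr_eq0 => /eqP.
Qed.

Lemma pull_lift T (u : hom T (emid E)) (v : hom T X') :
  eprj E \oc u = b \oc v ->
  exists w, pr1 \oc (kerm pull_eq \oc w) = u /\ pull_prj \oc w = v.
Proof.
move=> e; have [|w ew] := kernel_lift (g := prod_mor u v) (kermP pull_eq).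
  by rewrite coprod_prod cmpNm e subrr.
by exists w; rewrite /pull_prj -cmpA ew pr1_prod pr2_prod.
Qed.

Lemma pull_ext T (u v : hom T (kerob pull_eq)) :
  pr1 \oc (kerm pull_eq \oc u) = pr1 \oc (kerm pull_eq \oc v) ->
  pull_prj \oc u = pull_prj \oc v -> u = v.
Proof.
move=> e1 e2; apply: (kernel_mono (kermP pull_eq)).
by apply: bip_extr => //; rewrite !cmpA.
Qed.

Lemma pull_prj_epi : epi pull_prj.
Proof.
have [ki cp] := eses E.
have epe : epi pull_eq.
  apply: epi0 => T u e; apply: (cokernel_epi cp).
  by rewrite cmp0m -(coprod_in1 (eprj E) (- b)) -/pull_eq cmpA e cmp0m.
apply: epi0 => T t e.
have [|u ue] := cokernel_desc (g := t \oc pr2) (epi_normal epe).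
  by rewrite -cmpA -/pull_prj.
have u0 : u = 0.
  apply: (cokernel_epi cp).
  rewrite cmp0m -(coprod_in1 (eprj E) (- b)) -/pull_eq cmpA ue -cmpA.
  by rewrite pr2in1 cmpm0.
by rewrite -[t]cmpm1 -(pr2in2 (emid E) X') cmpA -ue u0 !cmp0m.
Qed.

Definition pull_inj_subproof :
  exists w, pr1 \oc (kerm pull_eq \oc w) = einj E /\ pull_prj \oc w = 0.
Proof. by apply: pull_lift; rewrite cmpm0 (eses E).1.1. Qed.

Definition pull_inj : hom Y (kerob pull_eq) := sval (cid pull_inj_subproof).

Lemma pull_injP :
  pr1 \oc (kerm pull_eq \oc pull_inj) = einj E /\ pull_prj \oc pull_inj = 0.
Proof. exact: svalP (cid pull_inj_subproof). Qed.

Lemma pull_ses : ses pull_inj pull_prj.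
Proof.
have [i1 i2] := pull_injP; have [ki cp] := eses E.
have kk : is_kernel pull_inj pull_prj.
  apply: mk_kernel => //.
    apply: mono0 => T u e; apply: (kernel_mono ki).
    by rewrite cmpm0 -i1 -!cmpA e !cmpm0.
  move=> T g e; have [|u eu] := kernel_lift (g := pr1 \oc (kerm pull_eq \oc g)) ki.
    by rewrite [pr1 \oc _]cmpA cmpA pull_comm -cmpA e cmpm0.
  exists u; apply: pull_ext; last by rewrite cmpA i2 cmp0m e.
  by rewrite -eu -i1 !cmpA.
by split=> //; apply: epi_cokernel kk pull_prj_epi.
Qed.

Definition pull : ext X' Y := Ext pull_ses.

Lemma emor_pull : emor (idm Y) b pull E.
Proof.
exists (pr1 \oc kerm pull_eq); split; last exact: pull_comm.
by rewrite cmpm1 -cmpA pull_injP.1.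
Qed.

Lemma emor_to_pull X'' Y'' (a : hom Y'' Y) (c : hom X'' X') (F : ext X'' Y'') :
  emor a (b \oc c) F E -> emor a c F pull.
Proof.
move=> [h [h1 h2]]; have [|w [w1 w2]] := @pull_lift _ h (c \oc eprj F).
  by rewrite h2 cmpA.
have [i1 i2] := pull_injP.
exists w; split=> //=; apply: pull_ext.
  by rewrite cmpA cmpA -[_ \oc w]cmpA w1 h1 -i1 !cmpA.
by rewrite !cmpA w2 i2 cmp0m -cmpA (eses F).1.1 cmpm0.
Qed.

End Pull.

Section Push.
Variables (X Y Y' : A) (a : hom Y Y') (E : ext X Y).

Definition push_eq : hom Y (bip (emid E) Y') := prod_mor (einj E) (- a).
Definition push_inj : hom Y' (cokob push_eq) := cokm push_eq \oc in2.

Lemma push_comm : (cokm push_eq \oc in1) \oc einj E = push_inj \oc a.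
Proof.
rewrite /push_inj; move: (cokob push_eq) (cokm push_eq) (cokmP push_eq).1 => K k.
rewrite /push_eq /prod_mor cmpDr !cmpmN !cmpA => /eqP.
by rewrite subr_eq0 => /eqP.
Qed.

Lemma push_desc T (u : hom (emid E) T) (v : hom Y' T) :
  u \oc einj E = v \oc a ->
  exists w, (w \oc cokm push_eq) \oc in1 = u /\ w \oc push_inj = v.
Proof.
move=> e; have [|w ew] := cokernel_desc (g := coprod_mor u v) (cokmP push_eq).
  by rewrite coprod_prod cmpmN e subrr.
by exists w; rewrite /push_inj cmpA ew coprod_in1 coprod_in2.
Qed.

Lemma push_ext T (u v : hom (cokob push_eq) T) :
  (u \oc cokm push_eq) \oc in1 = (v \oc cokm push_eq) \oc in1 ->
  u \oc push_inj = v \oc push_inj -> u = v.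
Proof.
move=> e1 e2; apply: (cokernel_epi (cokmP push_eq)).
by apply: bip_extl => //; rewrite -!cmpA.
Qed.

Lemma push_inj_mono : mono push_inj.
Proof.
have [ki cp] := eses E.
have mpe : mono push_eq.
  apply: mono0 => T u e; apply: (kernel_mono ki).
  by rewrite cmpm0 -(pr1_prod (einj E) (- a)) -/push_eq -cmpA e cmpm0.
apply: mono0 => T t e.
have [|u ue] := kernel_lift (g := in2 \oc t) (mono_normal mpe).
  by rewrite cmpA -/push_inj.
have u0 : u = 0.
  apply: (kernel_mono ki).
  rewrite cmpm0 -(pr1_prod (einj E) (- a)) -/push_eq -cmpA ue cmpA.
  by rewrite pr1in2 cmp0m.
by rewrite -[t]cmp1m -(pr2in2 (emid E) Y') -cmpA -ue u0 !cmpm0.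
Qed.

Definition push_prj_subproof :
  exists w, (w \oc cokm push_eq) \oc in1 = eprj E /\ w \oc push_inj = 0.
Proof. by apply: push_desc; rewrite cmp0m (eses E).1.1. Qed.

Definition push_prj : hom (cokob push_eq) X := sval (cid push_prj_subproof).

Lemma push_prjP :
  (push_prj \oc cokm push_eq) \oc in1 = eprj E /\ push_prj \oc push_inj = 0.
Proof. exact: svalP (cid push_prj_subproof). Qed.

Lemma push_ses : ses push_inj push_prj.
Proof.
have [p1 p2] := push_prjP; have [ki cp] := eses E.
have cc : is_cokernel push_prj push_inj.
  apply: mk_cokernel => //.
    apply: epi0 => T u e; apply: (cokernel_epi cp).
    by rewrite cmp0m -p1 !cmpA e !cmp0m.
  move=> T g e; have [|u eu] := cokernel_desc (g := g \oc cokm push_eq \oc in1) cp.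
    by rewrite -!cmpA [cokm _ \oc _]cmpA push_comm cmpA e cmp0m.
  exists u; apply: push_ext; last by rewrite -cmpA p2 cmpm0 e.
  by rewrite -eu -p1 -!cmpA.
by split=> //; apply: mono_kernel cc push_inj_mono.
Qed.

Definition push : ext X Y' := Ext push_ses.

Lemma emor_push : emor a (idm X) E push.
Proof.
exists (cokm push_eq \oc in1); split; first exact: push_comm.
by rewrite cmp1m cmpA push_prjP.1.
Qed.

Lemma emor_of_push X'' Y'' (c : hom Y' Y'') (b : hom X X'') (F : ext X'' Y'') :
  emor (c \oc a) b E F -> emor c b push F.
Proof.
move=> [h [h1 h2]]; have [|w [w1 w2]] := @push_desc _ h (einj F \oc c).
  by rewrite h1 cmpA.
have [p1 p2] := push_prjP.
exists w; split=> //=; apply: push_ext.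
  by rewrite -!cmpA [w \oc _]cmpA w1 h2 -p1 -!cmpA.
by rewrite -!cmpA w2 p2 cmpm0 cmpA (eses F).1.1 cmp0m.
Qed.

End Push.

Lemma dsum_ses X Y X' Y' (E : ext X Y) (E' : ext X' Y') :
  ses (bip_mor (einj E) (einj E')) (bip_mor (eprj E) (eprj E')).
Proof.
case: E E' => [E i p [ki cp]] [E' i' p' [ki' cp']] /=; split.
- apply: mk_kernel.
  + by rewrite -bip_cmp ki.1 ki'.1 /bip_mor /prod_mor !bipE.
  + apply: mono0 => T u e; apply: bip_extr; rewrite cmpm0.
      by apply: (kernel_mono ki); rewrite cmpA -(pr1_bip i i') -cmpA e !cmpm0.
    by apply: (kernel_mono ki'); rewrite cmpA -(pr2_bip i i') -cmpA e !cmpm0.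
  + move=> T g e; have [|u eu] := kernel_lift (g := pr1 \oc g) ki.
      by rewrite cmpA -(pr1_bip p p') -cmpA e cmpm0.
    have [|v ev] := kernel_lift (g := pr2 \oc g) ki'.
      by rewrite cmpA -(pr2_bip p p') -cmpA e cmpm0.
    by exists (prod_mor u v); rewrite bip_prod eu ev; apply: bip_extr;
      rewrite ?pr1_prod ?pr2_prod.
- apply: mk_cokernel.
  + by rewrite -bip_cmp ki.1 ki'.1 /bip_mor /prod_mor !bipE.
  + apply: epi0 => T u e; apply: bip_extl; rewrite cmp0m.
      by apply: (cokernel_epi cp); rewrite -cmpA -(bip_in1 p p') cmpA e !cmp0m.
    by apply: (cokernel_epi cp'); rewrite -cmpA -(bip_in2 p p') cmpA e !cmp0m.
  + move=> T g e; have [|u eu] := cokernel_desc (g := g \oc in1) cp.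
      by rewrite -cmpA -(bip_in1 i i') cmpA e cmp0m.
    have [|v ev] := cokernel_desc (g := g \oc in2) cp'.
      by rewrite -cmpA -(bip_in2 i i') cmpA e cmp0m.
    exists (coprod_mor u v); apply: bip_extl; rewrite -cmpA.
      by rewrite bip_in1 cmpA coprod_in1.
    by rewrite bip_in2 cmpA coprod_in2.
Qed.

Definition dsum X Y X' Y' (E : ext X Y) (E' : ext X' Y') :
  ext (bip X X') (bip Y Y') := Ext (dsum_ses E E').

Lemma emor_dsum X Y X' Y' Z T Z' T' (E : ext X Y) (E' : ext X' Y')
    (F : ext Z T) (F' : ext Z' T') a b a' b' :
  emor a b E F -> emor a' b' E' F' ->
  emor (bip_mor a a') (bip_mor b b') (dsum E E') (dsum F F').
Proof.
move=> [h [h1 h2]] [h' [h1' h2']]; exists (bip_mor h h') => /=.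
by rewrite -!bip_cmp h1 h2 h1' h2'.
Qed.

Lemma split_ses X Y : ses (in1 : hom Y (bip Y X)) (pr2 : hom (bip Y X) X).
Proof.
split.
- apply: mk_kernel; first exact: pr2in1.
    by move=> T u v e; rewrite -(pr1in1K X u) e pr1in1K.
  move=> T g e; exists (pr1 \oc g); apply: bip_extr; first by rewrite pr1in1K.
  by rewrite pr2in1K e.
- apply: mk_cokernel; first exact: pr2in1.
    move=> T u v e; rewrite -[u]cmpm1 -[v]cmpm1 -(pr2in2 Y X).
    by rewrite cmpA e -cmpA.
  move=> T g e; exists (g \oc in2); apply: bip_extl; rewrite -!cmpA.
    by rewrite pr2in1 !cmpm0.
  by rewrite pr2in2 cmpm1.
Qed.

Definition split_ext X Y : ext X Y := Ext (split_ses X Y).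

(** [ext1 X Y] below is the group of Yoneda classes of extensions; its addition
    is the Baer sum, see [baer_sumE]. *)

Definition ext_cl X Y := quot (ext_eqv X Y).
Definition ecl X Y (E : ext X Y) : ext_cl X Y := qcls (ext_eqv X Y) E.

Definition epush X Y Y' (a : hom Y Y') (x : ext_cl X Y) : ext_cl X Y' :=
  ecl (push a (qrep x)).
Definition epull X X' Y (b : hom X' X) (x : ext_cl X Y) : ext_cl X' Y :=
  ecl (pull b (qrep x)).

Lemma ecl_rep X Y (E : ext X Y) : emor (idm Y) (idm X) (qrep (ecl E)) E.
Proof. exact: (qrep_cls (ext_eqv X Y) E). Qed.

Lemma ecl_eq X Y (E F : ext X Y) : emor (idm Y) (idm X) E F -> ecl E = ecl F.
Proof. by move=> h; apply/qclsP. Qed.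

Lemma epushE X Y Y' (a : hom Y Y') (E : ext X Y) (F : ext X Y') :
  emor a (idm X) E F -> epush a (ecl E) = ecl F.
Proof.
move=> h; apply: ecl_eq; apply: emor_of_push; rewrite cmp1m.
by have := emor_cmp h (ecl_rep E); rewrite cmpm1 cmp1m.
Qed.

Lemma epullE X X' Y (b : hom X' X) (E : ext X Y) (F : ext X' Y) :
  emor (idm Y) b F E -> epull b (ecl E) = ecl F.
Proof.
move=> h; apply/esym/ecl_eq; apply: emor_to_pull; rewrite cmpm1.
by have := emor_cmp (emor_sym (ecl_rep E)) h; rewrite !cmp1m.
Qed.

Lemma epush_pullE X X' Y Y' (a : hom Y Y') (b : hom X X') (E : ext X Y)
    (F : ext X' Y') :
  emor a b E F -> epush a (ecl E) = epull b (ecl F).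
Proof.
move=> h; rewrite (epushE (emor_push a E)) (epullE (emor_pull b F)).
apply/ecl_eq/emor_to_pull; rewrite cmpm1.
by apply: emor_of_push; rewrite cmp1m.
Qed.

Lemma epush1 X Y (x : ext_cl X Y) : epush (idm Y) x = x.
Proof. by elim/qind: x => E; apply/epushE/emor_id. Qed.

Lemma epull1 X Y (x : ext_cl X Y) : epull (idm X) x = x.
Proof. by elim/qind: x => E; apply/epullE/emor_id. Qed.

Lemma epushM X Y Y' Y'' (a' : hom Y' Y'') (a : hom Y Y') (x : ext_cl X Y) :
  epush (a' \oc a) x = epush a' (epush a x).
Proof.
elim/qind: x => E; rewrite -/(ecl E) (epushE (emor_push a E)).
rewrite (epushE (emor_push a' _)); apply: epushE.
by have := emor_cmp (emor_push a' (push a E)) (emor_push a E); rewrite cmp1m.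
Qed.

Lemma epullM X X' X'' Y (b : hom X' X) (b' : hom X'' X') (x : ext_cl X Y) :
  epull (b \oc b') x = epull b' (epull b x).
Proof.
elim/qind: x => E; rewrite -/(ecl E) (epullE (emor_pull b E)).
rewrite (epullE (emor_pull b' _)); apply: epullE.
by have := emor_cmp (emor_pull b E) (emor_pull b' (pull b E)); rewrite cmp1m.
Qed.

Lemma epush_pull X X' Y Y' (a : hom Y Y') (b : hom X' X) (x : ext_cl X Y) :
  epush a (epull b x) = epull b (epush a x).
Proof.
elim/qind: x => E; rewrite -/(ecl E) (epullE (emor_pull b E)).
rewrite (epushE (emor_push a E)); apply: epush_pullE.
by have := emor_cmp (emor_push a E) (emor_pull b E); rewrite cmp1m cmpm1.
Qed.

Definition epair X Y Z (x : ext_cl X Y) (y : ext_cl X Z) : ext_cl X (bip Y Z) :=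
  epull (@diag A X) (ecl (dsum (qrep x) (qrep y))).

Lemma epairE X Y Z (E : ext X Y) (F : ext X Z) :
  epair (ecl E) (ecl F) = ecl (pull (@diag A X) (dsum E F)).
Proof.
rewrite /epair -(epullE (emor_pull _ (dsum E F))); congr epull.
apply: ecl_eq; have := emor_dsum (ecl_rep E) (ecl_rep F).
by rewrite !bip_1.
Qed.

Lemma emor_pr1 X Y X' Y' (E : ext X Y) (F : ext X' Y') :
  emor pr1 pr1 (dsum E F) E.
Proof. by exists pr1; rewrite /= !pr1_bip. Qed.

Lemma emor_pr2 X Y X' Y' (E : ext X Y) (F : ext X' Y') :
  emor pr2 pr2 (dsum E F) F.
Proof. by exists pr2; rewrite /= !pr2_bip. Qed.

Lemma epair1 X Y Z (x : ext_cl X Y) (y : ext_cl X Z) : epush pr1 (epair x y) = x.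
Proof.
elim/qind: x => E; elim/qind: y => F; rewrite -/(ecl E) -/(ecl F) epairE.
apply: epushE; have := emor_cmp (emor_pr1 E F) (emor_pull (@diag A X) _).
by rewrite cmpm1 pr1_prod.
Qed.

Lemma epair2 X Y Z (x : ext_cl X Y) (y : ext_cl X Z) : epush pr2 (epair x y) = y.
Proof.
elim/qind: x => E; elim/qind: y => F; rewrite -/(ecl E) -/(ecl F) epairE.
apply: epushE; have := emor_cmp (emor_pr2 E F) (emor_pull (@diag A X) _).
by rewrite cmpm1 pr2_prod.
Qed.

Lemma epair_eta X Y Z (w : ext_cl X (bip Y Z)) :
  epair (epush pr1 w) (epush pr2 w) = w.
Proof.
elim/qind: w => G; rewrite -/(ecl G).
rewrite (epushE (emor_push pr1 G)) (epushE (emor_push pr2 G)) epairE.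
apply/esym/ecl_eq/emor_to_pull; rewrite cmpm1.
have [h [h1 h2]] := emor_push pr1 G; have [k [k1 k2]] := emor_push pr2 G.
exists (prod_mor h k); split; rewrite /= ?cmpm1; apply: bip_extr.
- by rewrite cmpA pr1_prod h1 pr1_bip.
- by rewrite cmpA pr2_prod k1 pr2_bip.
- by rewrite bip_prod pr1_prod h2 cmpA pr1_prod.
- by rewrite bip_prod pr2_prod k2 cmpA pr2_prod.
Qed.

Lemma epush0 X Y Y' (x : ext_cl X Y) :
  epush (0 : hom Y Y') x = ecl (split_ext X Y').
Proof.
elim/qind: x => E; apply: epushE; exists (in2 \oc eprj E) => /=.
by rewrite cmpm0 -cmpA (eses E).1.1 cmpm0 pr2in2K cmp1m.
Qed.

Definition ext1 X Y : zmodType :=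
  ig_zmod (@epush1 X) (@epushM X) (@epair1 X) (@epair2 X) (@epair_eta X)
    (@epush0 X) Y.

Lemma baer_sumE X Y (E F : ext X Y) :
  (ecl E : ext1 X Y) + ecl F =
  ecl (push (@codiag A Y) (pull (@diag A X) (dsum E F))).
Proof.
rewrite -[LHS]/(epush (@codiag A Y) (epair (ecl E) (ecl F))) epairE.
exact/epushE/emor_push.
Qed.

Lemma epush_add X Y Y' (a : hom Y Y') (x y : ext1 X Y) :
  epush a (x + y) = (epush a x : ext1 X Y') + epush a y.
Proof.
exact: (ig_act_add (@epushM X) (@epair1 X) (@epair2 X) (@epair_eta X)).
Qed.

Lemma epushD X Y Y' (a a' : hom Y Y') (x : ext1 X Y) :
  epush (a + a') x = (epush a x : ext1 X Y') + epush a' x.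
Proof. exact: (ig_actD (@epushM X) (@epair_eta X)). Qed.

Lemma epull_add X X' Y (b : hom X' X) (x y : ext1 X Y) :
  epull b (x + y) = (epull b x : ext1 X' Y) + epull b y.
Proof.
have [T [w [a [a' [-> ->]]]]] := ig_common (@epair1 X) (@epair2 X) x y.
have e := epushD a a' w; rewrite -[X in epull b X]e -epush_pull epushD.
by rewrite -!epush_pull.
Qed.

Lemma epullD X X' Y (b b' : hom X' X) (x : ext1 X Y) :
  epull (b + b') x = (epull b x : ext1 X' Y) + epull b' x.
Proof.
rewrite -[RHS]/(epush (@codiag A Y) (epair (epull b x) (epull b' x))).
elim/qind: x => E; rewrite -/(ecl E).
rewrite (epullE (emor_pull b E)) (epullE (emor_pull b' E)) epairE.
apply/esym/epush_pullE.
have [h [h1 h2]] := emor_pull b E; have [k [k1 k2]] := emor_pull b' E.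
have hk : emor (@codiag A Y) (coprod_mor b b') (dsum (pull b E) (pull b' E)) E.
  exists (coprod_mor h k); split=> /=; apply: bip_extl; rewrite -!cmpA.
  - by rewrite bip_in1 coprod_in1 cmpA coprod_in1 h1.
  - by rewrite bip_in2 coprod_in2 cmpA coprod_in2 k1.
  - by rewrite bip_in1 coprod_in1 cmpA coprod_in1 h2.
  - by rewrite bip_in2 coprod_in2 cmpA coprod_in2 k2.
have := emor_cmp hk (emor_pull (@diag A X') _).
by rewrite cmpm1 coprod_prod !cmpm1.
Qed.

Record short := Short {
  s1 : A; s2 : A; s3 : A;
  sa : hom s1 s2; sb : hom s2 s3;
  sba : sb \oc sa = 0 }.

Definition smor (S T : short) (f : hom (s2 S) (s2 T)) :=
  (exists f1, sa T \oc f1 = f \oc sa S) /\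
  (exists f3, f3 \oc sb S = sb T \oc f).

Definition bound_subproof (S : short) :
  exists u, kerm (sb S) \oc u = sa S :=
  kernel_lift (kermP (sb S)) (sba S).

Definition bound (S : short) : hom (s1 S) (kerob (sb S)) :=
  sval (cid (bound_subproof S)).

Lemma boundE S : kerm (sb S) \oc bound S = sa S.
Proof. exact: svalP (cid (bound_subproof S)). Qed.

Definition homology (S : short) : A := cokob (bound S).

Definition hmap_spec (S T : short) (f : hom (s2 S) (s2 T))
    (h : hom (homology S) (homology T)) :=
  exists2 k : hom (kerob (sb S)) (kerob (sb T)),
    kerm (sb T) \oc k = f \oc kerm (sb S)
    & h \oc cokm (bound S) = cokm (bound T) \oc k.

Lemma hmap_ex S T (f : hom (s2 S) (s2 T)) : smor f -> exists h, hmap_spec f h.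
Proof.
move=> [[f1 e1] [f3 e3]].
have [|k ek] := kernel_lift (g := f \oc kerm (sb S)) (kermP (sb T)).
  by rewrite cmpA -e3 -cmpA (kermP (sb S)).1 cmpm0.
have [|h eh] := cokernel_desc (g := cokm (bound T) \oc k) (cokmP (bound S)).
  have -> : cokm (bound T) \oc k \oc bound S = cokm (bound T) \oc (bound T \oc f1).
    rewrite -cmpA; congr (_ \oc _); apply: (kernel_mono (kermP (sb T))).
    by rewrite !cmpA ek boundE e1 -cmpA boundE.
  by rewrite cmpA (cokmP (bound T)).1 cmp0m.
by exists h, k.
Qed.

Lemma hmap_unique S T (f : hom (s2 S) (s2 T)) h h' :
  hmap_spec f h -> hmap_spec f h' -> h = h'.
Proof.
move=> [k e1 e2] [k' e1' e2']; apply: (cokernel_epi (cokmP (bound S))).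
rewrite e2 e2'; congr (_ \oc _); apply: (kernel_mono (kermP (sb T))).
by rewrite e1.
Qed.

Definition hmap S T (f : hom (s2 S) (s2 T)) (sf : smor f) :
  hom (homology S) (homology T) := sval (cid (hmap_ex sf)).

Lemma hmapP S T (f : hom (s2 S) (s2 T)) (sf : smor f) : hmap_spec f (hmap sf).
Proof. exact: svalP (cid (hmap_ex sf)). Qed.

Lemma hmap_spec_cmp S T U (g : hom (s2 T) (s2 U)) (f : hom (s2 S) (s2 T)) h h' :
  hmap_spec g h' -> hmap_spec f h -> hmap_spec (g \oc f) (h' \oc h).
Proof.
move=> [k' e1' e2'] [k e1 e2]; exists (k' \oc k).
  by rewrite cmpA e1' -cmpA e1 cmpA.
by rewrite -cmpA e2 [LHS]cmpA e2' cmpA.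
Qed.

Lemma hmap_spec_id S : hmap_spec (idm (s2 S)) (idm (homology S)).
Proof. by exists (idm _); rewrite !cmp1m cmpm1. Qed.

Lemma hmap_spec_add S T (f f' : hom (s2 S) (s2 T)) h h' :
  hmap_spec f h -> hmap_spec f' h' -> hmap_spec (f + f') (h + h').
Proof.
move=> [k e1 e2] [k' e1' e2']; exists (k + k').
  by rewrite cmpDr cmpDl e1 e1'.
by rewrite cmpDr cmpDl e2 e2'.
Qed.

Lemma hmap_spec0 S T : hmap_spec (0 : hom (s2 S) (s2 T)) 0.
Proof. by exists 0; rewrite !cmp0m cmpm0. Qed.

Lemma hmap_iso S T (f : hom (s2 S) (s2 T)) (sf : smor f)
    (g : hom (s2 T) (s2 S)) :
  smor g -> g \oc f = idm _ -> f \oc g = idm _ -> is_iso (hmap sf).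
Proof.
move=> sg gf fg; exists (hmap sg); split; apply: hmap_unique (hmap_spec_id _).
  by rewrite -gf; apply: hmap_spec_cmp; apply: hmapP.
by rewrite -fg; apply: hmap_spec_cmp; apply: hmapP.
Qed.

End AbelianTheory.

(** The differential is given as a family [cd m n : X m -> X n] vanishing unless
    [n = m + 1], which avoids casts along equalities of indices. *)

Section Complexes.
Variable A : addcat.

Record cpx := Cpx {
  cob :> int -> A;
  cd : forall m n, hom (cob m) (cob n);
  cd_shape : forall m n, n != m + 1 -> cd m n = 0;
  cd_cd : forall l m n, cd m n \oc cd l m = 0 }.
Arguments cd {c}.

Record cmap (X Y : cpx) := Cmap {
  cm :> forall n, hom (X n) (Y n);
  cm_comm : forall m n, cm n \oc cd m n = cd m n \oc cm m }.

Lemma cmap_eq X Y (f g : cmap X Y) : (forall n, f n = g n) -> f = g.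
Proof.
case: f g => [f cf] [g cg] /= e.
have E : f = g by apply: functional_extensionality_dep.
by case: _ / E cg => cg; congr Cmap; apply: Prop_irrelevance.
Qed.

Definition cm_zero X Y : cmap X Y.
Proof. by apply: (@Cmap X Y (fun=> 0)) => m n; rewrite cmp0m cmpm0. Defined.
Definition cm_opp X Y (f : cmap X Y) : cmap X Y.
Proof.
apply: (@Cmap X Y (fun n => - f n)) => m n.
by rewrite cmpNm cmpmN cm_comm.
Defined.
Definition cm_add X Y (f g : cmap X Y) : cmap X Y.
Proof.
apply: (@Cmap X Y (fun n => f n + g n)) => m n.
by rewrite cmpDl cmpDr !cm_comm.
Defined.
Definition cm_id X : cmap X X.
Proof. by apply: (@Cmap X X (fun n => idm (X n))) => m n; rewrite cmp1m cmpm1. Defined.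
Definition cm_cmp X Y Z (g : cmap Y Z) (f : cmap X Y) : cmap X Z.
Proof.
apply: (@Cmap X Z (fun n => g n \oc f n)) => m n.
by rewrite -cmpA cm_comm cmpA cm_comm cmpA.
Defined.

Lemma cm_addA X Y : associative (@cm_add X Y).
Proof. by move=> f g h; apply: cmap_eq => n /=; rewrite addrA. Qed.
Lemma cm_addC X Y : commutative (@cm_add X Y).
Proof. by move=> f g; apply: cmap_eq => n /=; rewrite addrC. Qed.
Lemma cm_add0 X Y : left_id (cm_zero X Y) (@cm_add X Y).
Proof. by move=> f; apply: cmap_eq => n /=; rewrite add0r. Qed.
Lemma cm_addN X Y : left_inverse (cm_zero X Y) (@cm_opp X Y) (@cm_add X Y).
Proof. by move=> f; apply: cmap_eq => n /=; rewrite addNr. Qed.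

Definition cmapz X Y : zmodType :=
  mkzmod (@cm_addA X Y) (@cm_addC X Y) (@cm_add0 X Y) (@cm_addN X Y).

Definition cpx_preadd : preadd.
Proof.
apply: (@Preadd cpx cmapz cm_id cm_cmp).
- by move=> *; apply: cmap_eq => n /=; rewrite cmpA.
- by move=> *; apply: cmap_eq => n /=; rewrite cmp1m.
- by move=> *; apply: cmap_eq => n /=; rewrite cmpm1.
- by move=> *; apply: cmap_eq => n /=; rewrite cmpDl.
- by move=> *; apply: cmap_eq => n /=; rewrite cmpDr.
Defined.

Definition cpx_zero : cpx := @Cpx (fun=> zob) (fun _ _ => 0)
  (fun _ _ _ => erefl) (fun _ _ _ => cmpm0 _ _).

Definition cpx_bip (X Y : cpx) : cpx.
Proof.
apply: (@Cpx (fun n => bip (X n) (Y n))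
  (fun m n => bip_mor (cd m n) (cd m n))).
- by move=> m n mn; rewrite !cd_shape // /bip_mor /prod_mor !bipE.
- by move=> l m n; rewrite -bip_cmp !cd_cd /bip_mor /prod_mor !bipE.
Defined.

Definition cpx_in1 (X Y : cpx) : cmap X (cpx_bip X Y).
Proof. by apply: (@Cmap X (cpx_bip X Y) (fun n => in1)) => m n /=; rewrite bip_in1. Defined.
Definition cpx_in2 (X Y : cpx) : cmap Y (cpx_bip X Y).
Proof. by apply: (@Cmap Y (cpx_bip X Y) (fun n => in2)) => m n /=; rewrite bip_in2. Defined.
Definition cpx_pr1 (X Y : cpx) : cmap (cpx_bip X Y) X.
Proof. by apply: (@Cmap (cpx_bip X Y) X (fun n => pr1)) => m n /=; rewrite pr1_bip. Defined.
Definition cpx_pr2 (X Y : cpx) : cmap (cpx_bip X Y) Y.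
Proof. by apply: (@Cmap (cpx_bip X Y) Y (fun n => pr2)) => m n /=; rewrite pr2_bip. Defined.

Definition cpx_addcat : addcat.
Proof.
apply: (@Addcat cpx_preadd cpx_zero _ cpx_bip cpx_in1 cpx_in2 cpx_pr1 cpx_pr2).
- by apply: cmap_eq => n /=; apply: zobP.
- by move=> *; apply: cmap_eq => n /=; rewrite pr1in1.
- by move=> *; apply: cmap_eq => n /=; rewrite pr2in2.
- by move=> *; apply: cmap_eq => n /=; rewrite pr1in2.
- by move=> *; apply: cmap_eq => n /=; rewrite pr2in1.
- by move=> *; apply: cmap_eq => n /=; rewrite in_pr.
Defined.

Definition shift_ob (X : cpx) : cpx.
Proof.
apply: (@Cpx (fun n => X (n + 1)) (fun m n => - cd (m + 1) (n + 1))).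
- by move=> m n mn; rewrite cd_shape ?oppr0 // (inj_eq (addIr 1)).
- by move=> l m n; rewrite cmpNm cmpmN cd_cd !oppr0.
Defined.

Definition shift_mor X Y (f : cmap X Y) : cmap (shift_ob X) (shift_ob Y).
Proof.
apply: (@Cmap (shift_ob X) (shift_ob Y) (fun n => f (n + 1))) => m n /=.
by rewrite cmpmN cmpNm cm_comm.
Defined.

Definition shift : cfun cpx_preadd cpx_preadd.
Proof.
apply: (@Cfun cpx_preadd cpx_preadd shift_ob shift_mor).
- by move=> X; apply: cmap_eq.
- by move=> X Y Z g f; apply: cmap_eq.
Defined.

Definition stalk_ob (X : A) : cpx :=
  @Cpx (fun n => if n == 0 then X else zob) (fun _ _ => 0)
  (fun _ _ _ => erefl) (fun _ _ _ => cmpm0 _ _).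

Definition stalk_fun (X Y : A) (f : hom X Y) n :
    hom (stalk_ob X n) (stalk_ob Y n) :=
  if n == 0 as b return hom (if b then X else zob) (if b then Y else zob)
  then f else 0.

Definition stalk_mor (X Y : A) (f : hom X Y) : cmap (stalk_ob X) (stalk_ob Y).
Proof.
apply: (@Cmap (stalk_ob X) (stalk_ob Y) (stalk_fun f)) => m n.
by rewrite cmp0m cmpm0.
Defined.

Definition stalk : cfun A cpx_preadd.
Proof.
apply: (@Cfun A cpx_preadd stalk_ob stalk_mor).
- move=> X; apply: cmap_eq => n /=; rewrite /stalk_fun.
  by case: (n == 0) => //; rewrite zobP.
- move=> X Y Z g f; apply: cmap_eq => n /=; rewrite /stalk_fun.
  by case: (n == 0) => //; rewrite cmpm0.
Defined.

End Complexes.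

Arguments cd {A c}.

Section Derived.
Variable A : abelian.
Local Notation Ch := (cpx_addcat A).

Definition cshort (X : cpx A) (l m n : int) : short A := Short (cd_cd X l m n).

Lemma cmap_smor (X Y : cpx A) (f : cmap X Y) l m n :
  @smor _ (cshort X l m n) (cshort Y l m n) (f m).
Proof. by split; [exists (f l)|exists (f n)]; rewrite /= cm_comm. Qed.

Definition cohom (n : int) (X : cpx A) : A :=
  homology (cshort X (n - 1) n (n + 1)).
Definition cohom_map (n : int) (X Y : cpx A) (f : cmap X Y) :
  hom (cohom n X) (cohom n Y) := hmap (cmap_smor f (n - 1) n (n + 1)).

Lemma cohom_mapP n (X Y : cpx A) (f : cmap X Y) :
  @hmap_spec A (cshort X (n - 1) n (n + 1)) (cshort Y (n - 1) n (n + 1)) (f n)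
    (cohom_map n f).
Proof. exact: hmapP. Qed.

Lemma cohom_map_id n (X : Ch) : cohom_map n (idm X) = idm (cohom n X).
Proof.
have h := cohom_mapP n (cm_id X).
exact: hmap_unique h (hmap_spec_id _).
Qed.

Lemma cohom_map_cmp n (X Y Z : Ch) (g : hom Y Z) (f : hom X Y) :
  cohom_map n (g \oc f) = cohom_map n g \oc cohom_map n f.
Proof.
have h := cohom_mapP n (cm_cmp g f).
exact: hmap_unique h (hmap_spec_cmp (cohom_mapP n g) (cohom_mapP n f)).
Qed.

Lemma cohom_map_add n (X Y : Ch) (f g : hom X Y) :
  cohom_map n (f + g) = cohom_map n f + cohom_map n g.
Proof.
have h := cohom_mapP n (cm_add f g).
exact: hmap_unique h (hmap_spec_add (cohom_mapP n f) (cohom_mapP n g)).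
Qed.

Definition qis (X Y : Ch) (f : hom X Y) := forall n, is_iso (cohom_map n f).

Lemma qis_id (X : Ch) : qis (idm X).
Proof.
by move=> n; rewrite cohom_map_id; exists (idm _); rewrite !cmp1m.
Qed.

Lemma qis_bip (X Y X' Y' : Ch) (f : hom X X') (g : hom Y Y') :
  qis f -> qis g -> qis (bip_mor f g).
Proof.
move=> qf qg n.
have [f' [f'f ff']] := qf n; have [g' [g'g gg']] := qg n.
pose H (U V : Ch) (h : hom U V) := cohom_map n h.
have HM U V T (h : hom V T) (k : hom U V) : H _ _ (h \oc k) = H _ _ h \oc H _ _ k.
  exact: cohom_map_cmp.
have HD U V (h k : hom U V) : H _ _ (h + k) = H _ _ h + H _ _ k.
  exact: cohom_map_add.
have H1 U : H _ _ (idm U) = idm _ by exact: cohom_map_id.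
rewrite -/(H _ _ f) in f'f ff'; rewrite -/(H _ _ g) in g'g gg'.
rewrite -/(H _ _ (bip_mor f g)).
exists (H _ _ in1 \oc (f' \oc H _ _ pr1) + H _ _ in2 \oc (g' \oc H _ _ pr2)).
split.
  rewrite cmpDl -!cmpA -!HM pr1_bip pr2_bip !HM [f' \oc _]cmpA [g' \oc _]cmpA.
  by rewrite f'f g'g !cmp1m -!HM -HD in_pr H1.
rewrite cmpDr !cmpA -!HM bip_in1 bip_in2 !HM.
rewrite -[_ \oc f']cmpA -[_ \oc g']cmpA ff' gg' !cmpm1.
by rewrite -!HM -HD in_pr H1.
Qed.

Lemma qis_shift (X Y : Ch) (f : hom X Y) : qis f -> qis (cf1 (shift A) f).
Proof.
move=> qf n.
have [p ep] : {p : int | p = n + 1} by exists (n + 1).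
have := qf p; rewrite /cohom_map /cohom.
have -> : p - 1 = n - 1 + 1 by rewrite ep addrAC.
rewrite {}ep => isof.
pose S (Z : cpx A) := cshort Z (n - 1 + 1) (n + 1) (n + 1 + 1).
pose T (Z : cpx A) := cshort (shift_ob Z) (n - 1) n (n + 1).
have ST Z : @smor _ (S Z) (T Z) (idm _).
  split; first by exists (- idm _); rewrite /= cmpNm cmpmN opprK cmp1m cmpm1.
  by exists (- idm _); rewrite /= cmpNm cmp1m cmpm1.
have TS Z : @smor _ (T Z) (S Z) (idm _).
  split; first by exists (- idm _); rewrite /= cmpmN cmp1m cmpm1.
  by exists (- idm _); rewrite /= cmpNm cmpmN opprK cmp1m cmpm1.
pose hf := hmap (cmap_smor (f : cmap X Y) (n - 1 + 1) (n + 1) (n + 1 + 1)).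
have e := hmap_spec_cmp (hmap_spec_cmp (hmapP (ST Y))
  (hmapP (cmap_smor (f : cmap X Y) (n - 1 + 1) (n + 1) (n + 1 + 1))))
  (hmapP (TS X)).
rewrite cmp1m cmpm1 in e.
rewrite [X in is_iso X](_ : _ = hmap (ST Y) \oc hf \oc hmap (TS X)); last first.
  exact: (hmap_unique (cohom_mapP n (shift_mor f)) e).
apply: is_iso_cmp; first apply: is_iso_cmp isof.
  by apply: (hmap_iso _ (TS Y)); rewrite cmp1m.
by apply: (hmap_iso _ (ST X)); rewrite cmp1m.
Qed.

Definition derived : preadd := loc qis_id qis_bip.

Definition dshift : cfun derived derived.
Proof.
apply: (@Cfun derived derived (shift A) (fun X Y (f : lhom qis X Y) =>
  lmap qis_shift f)).
- by move=> X; rewrite lmapQ cf1_id.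
- by move=> X Y Z g f; rewrite /= lmap_cmp.
Defined.

Lemma dshift_add (X Y : derived) (f g : hom X Y) :
  cf1 dshift (f + g) = cf1 dshift f + cf1 dshift g.
Proof.
have [T [w [a [b [-> ->]]]]] :=
  ig_common (@lpair1 _ _ qis_id qis_bip X) (@lpair2 _ _ qis_id qis_bip X) f g.
rewrite /lact -[X in cf1 dshift X](lQD qis_id qis_bip a b w) /= !lmap_cmp !lmapQ.
rewrite -[RHS](lQD qis_id qis_bip _ _ (lmap qis_shift w)).
by congr (lcmp (lQ _ _) _); apply: cmap_eq.
Qed.

Definition canon : cfun A derived.
Proof.
apply: (@Cfun A derived (stalk A) (fun X Y f => lQ qis (cf1 (stalk A) f))).
- by move=> X; rewrite cf1_id.
- by move=> X Y Z g f; rewrite cf1_cmp lQ_cmp.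
Defined.

End Derived.

Record extcat := Extcat {
  extcat_preadd :> preadd;
  Ext1 : extcat_preadd -> extcat_preadd -> zmodType;
  Extr : forall M X Y (f : hom X Y), Ext1 M X -> Ext1 M Y;
  Extl : forall M X Y (f : hom X Y), Ext1 Y M -> Ext1 X M;
  Extr_add : forall M X Y (f : hom X Y) (x y : Ext1 M X),
    Extr f (x + y) = Extr f x + Extr f y;
  Extl_add : forall M X Y (f : hom X Y) (x y : Ext1 Y M),
    Extl f (x + y) = Extl f x + Extl f y;
  Extr_id : forall M X (x : Ext1 M X), Extr (idm X) x = x;
  Extl_id : forall M X (x : Ext1 X M), Extl (idm X) x = x;
  Extr_cmp : forall M X Y Z (g : hom Y Z) (f : hom X Y) (x : Ext1 M X),
    Extr (g \oc f) x = Extr g (Extr f x);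
  Extl_cmp : forall M X Y Z (g : hom Y Z) (f : hom X Y) (x : Ext1 Z M),
    Extl (g \oc f) x = Extl f (Extl g x);
  ExtrD : forall M X Y (f g : hom X Y) (x : Ext1 M X),
    Extr (f + g) x = Extr f x + Extr g x;
  ExtlD : forall M X Y (f g : hom X Y) (x : Ext1 Y M),
    Extl (f + g) x = Extl f x + Extl g x;
  Extlr : forall X X' Y Y' (f : hom X' X) (g : hom Y Y') (x : Ext1 X Y),
    Extl f (Extr g x) = Extr g (Extl f x) }.
Arguments Ext1 {e}.
Arguments Extr {e} M {X Y}.
Arguments Extl {e} M {X Y}.

Section Stable.
Variable E : extcat.
Implicit Types X Y Z M : E.

Definition Ext1_cov X : abfun E :=
  Abfun (@Extr_add E X) (@Extr_id E X) (@Extr_cmp E X).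

Definition Ext1_contra X : abfun (opcat E).
Proof.
apply: (@Abfun (opcat E) (fun Y => Ext1 Y X)
  (fun Y Z (f : @hom E Z Y) => Extl X f)).
- by move=> *; apply: Extl_add.
- by move=> *; apply: Extl_id.
- by move=> *; apply: Extl_cmp.
Defined.

Definition inj_trivial X Y (f : hom X Y) := forall M x, Extr M f x = 0.
Definition proj_trivial X Y (f : hom X Y) := forall M x, Extl M f x = 0.

Lemma Extr_0 M X Y (f : hom X Y) : Extr M f 0 = 0.
Proof. by apply: (@addrI _ (Extr M f 0)); rewrite -Extr_add !addr0. Qed.
Lemma Extl_0 M X Y (f : hom X Y) : Extl M f 0 = 0.
Proof. by apply: (@addrI _ (Extl M f 0)); rewrite -Extl_add !addr0. Qed.

Lemma inj_trivial0 X Y : inj_trivial (0 : hom X Y).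
Proof. by move=> M x; apply: (@addrI _ (Extr M 0 x)); rewrite -ExtrD !addr0. Qed.
Lemma proj_trivial0 X Y : proj_trivial (0 : hom X Y).
Proof. by move=> M x; apply: (@addrI _ (Extl M 0 x)); rewrite -ExtlD !addr0. Qed.

Lemma inj_trivialN X Y (f : hom X Y) : inj_trivial f -> inj_trivial (- f).
Proof.
move=> h M x; have := @inj_trivial0 X Y M x.
by rewrite -(subrr f) ExtrD h add0r.
Qed.
Lemma proj_trivialN X Y (f : hom X Y) : proj_trivial f -> proj_trivial (- f).
Proof.
move=> h M x; have := @proj_trivial0 X Y M x.
by rewrite -(subrr f) ExtlD h add0r.
Qed.

Lemma inj_trivialD X Y (f g : hom X Y) :
  inj_trivial f -> inj_trivial g -> inj_trivial (f + g).
Proof. by move=> hf hg M x; rewrite ExtrD hf hg addr0. Qed.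
Lemma proj_trivialD X Y (f g : hom X Y) :
  proj_trivial f -> proj_trivial g -> proj_trivial (f + g).
Proof. by move=> hf hg M x; rewrite ExtlD hf hg addr0. Qed.

Definition ostab X Y : zmodType :=
  quot_group (@inj_trivial0 X Y) (@inj_trivialN X Y) (@inj_trivialD X Y).
Definition ustab X Y : zmodType :=
  quot_group (@proj_trivial0 X Y) (@proj_trivialN X Y) (@proj_trivialD X Y).

Definition ocls X Y (f : hom X Y) : ostab X Y :=
  qcls (qg_eqv (@inj_trivial0 X Y) (@inj_trivialN X Y) (@inj_trivialD X Y)) f.
Definition ucls X Y (f : hom X Y) : ustab X Y :=
  qcls (qg_eqv (@proj_trivial0 X Y) (@proj_trivialN X Y) (@proj_trivialD X Y)) f.

Lemma oclsP X Y (f g : hom X Y) : ocls f = ocls g <-> inj_trivial (f - g).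
Proof. exact: qclsP. Qed.
Lemma uclsP X Y (f g : hom X Y) : ucls f = ucls g <-> proj_trivial (f - g).
Proof. exact: qclsP. Qed.
Lemma oclsD X Y (f g : hom X Y) : ocls (f + g) = ocls f + ocls g.
Proof. exact/esym/qg_addE. Qed.
Lemma uclsD X Y (f g : hom X Y) : ucls (f + g) = ucls f + ucls g.
Proof. exact/esym/qg_addE. Qed.

Definition ucmp X Y Z (g : hom Y Z) (x : ustab X Y) : ustab X Z :=
  ucls (g \oc qrep x).
Definition ocmp X Y Z (f : hom X Y) (x : ostab Y Z) : ostab X Z :=
  ocls (qrep x \oc f).

Lemma ucmpE X Y Z (g : hom Y Z) (f : hom X Y) :
  ucmp g (ucls f) = ucls (g \oc f).
Proof.
apply/uclsP; rewrite -cmpmN -cmpDr => M x; rewrite Extl_cmp.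
exact: (qrep_cls (qg_eqv (@proj_trivial0 X Y) (@proj_trivialN X Y)
  (@proj_trivialD X Y)) f M).
Qed.
Lemma ocmpE X Y Z (f : hom X Y) (g : hom Y Z) :
  ocmp f (ocls g) = ocls (g \oc f).
Proof.
apply/oclsP; rewrite -cmpNm -cmpDl => M x; rewrite Extr_cmp.
exact: (qrep_cls (qg_eqv (@inj_trivial0 Y Z) (@inj_trivialN Y Z)
  (@inj_trivialD Y Z)) g M).
Qed.

Definition uHom_cov X : abfun E.
Proof.
apply: (@Abfun E (ustab X) (fun Y Z g => ucmp g)).
- move=> Y Z g; elim/qind=> f; elim/qind=> f'; rewrite -/(ucls f) -/(ucls f').
  by rewrite -uclsD !ucmpE cmpDr uclsD.
- by move=> Y; elim/qind=> f; rewrite -/(ucls f) ucmpE cmp1m.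
- by move=> Y Z T g g'; elim/qind=> f; rewrite -/(ucls f) !ucmpE cmpA.
Defined.

Definition oHom_contra X : abfun (opcat E).
Proof.
apply: (@Abfun (opcat E) (fun Y => ostab Y X)
  (fun Y Z (f : @hom E Z Y) => ocmp f)).
- move=> Y Z g; elim/qind=> f; elim/qind=> f'; rewrite -/(ocls f) -/(ocls f').
  by rewrite -oclsD !ocmpE cmpDl oclsD.
- by move=> Y; elim/qind=> f; rewrite -/(ocls f) ocmpE cmpm1.
- by move=> Y Z T g g'; elim/qind=> f; rewrite -/(ocls f) !ocmpE cmpA.
Defined.

End Stable.

Section Subcategories.
Variables (A : abelian) (P : A -> Prop).

(** The full subcategory on [P]; when [P] is extension-closed the middle terms
    of extensions of objects of [P] lie in [P], so that the extension groups of
    the exact category are those of [A]. *)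
Definition Csub : extcat.
Proof.
apply: (@Extcat (fullsub P) (fun X Y => ext1 (sval X) (sval Y))
  (fun M X Y f => @epush A _ _ _ f) (fun M X Y f => @epull A _ _ _ f)).
- by move=> *; apply: epush_add.
- by move=> *; apply: epull_add.
- by move=> *; apply: epush1.
- by move=> *; apply: epull1.
- by move=> *; apply: epushM.
- by move=> *; apply: epullM.
- by move=> *; apply: epushD.
- by move=> *; apply: epullD.
- by move=> *; apply/esym/epush_pull.
Defined.

(** Cohomology objects are only defined up to isomorphism, and [P] is not
    assumed invariant under isomorphism. *)
Definition in_Chat (X : derived A) :=
  (exists2 H, P H & isomorphic H (cohom 0 X)) /\
  (forall n, n != 0 -> is_zero (cohom n X)).

Definition Chat : extcat.
Proof.
apply: (@Extcat (fullsub in_Chat) (fun X Y => hom (sval X) (dshift A (sval Y)))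
  (fun M X Y f x => cf1 (dshift A) f \oc x) (fun M X Y f x => x \oc f)).
- by move=> *; apply: cmpDr.
- by move=> *; apply: cmpDl.
- by move=> *; rewrite cf1_id cmp1m.
- by move=> *; apply: cmpm1.
- by move=> *; rewrite cf1_cmp cmpA.
- by move=> *; apply: cmpA.
- by move=> *; rewrite dshift_add cmpDl.
- by move=> *; apply: cmpDr.
- by move=> *; apply/esym/cmpA.
Defined.

Lemma stalk_in_Chat (X : A) : P X -> in_Chat (stalk A X).
Proof.
move=> PX; split.
- exists X => //; rewrite /cohom; set S := cshort _ _ _ _.
  have [h eh] := kernel_lift (g := idm X) (kermP (sb S)) (cmp0m _ _).
  have kh : h \oc kerm (sb S) = idm _.
    apply: (kernel_mono (kermP (sb S))).
    by rewrite cmpA eh cmp1m cmpm1.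
  have b0 : bound S = 0.
    by apply: (kernel_mono (kermP (sb S))); rewrite boundE cmpm0.
  have [|g eg] := cokernel_desc (g := idm _) (cokmP (bound S)).
    by rewrite cmp1m b0.
  have ge : cokm (bound S) \oc g = idm _.
    apply: (cokernel_epi (cokmP (bound S))).
    by rewrite -cmpA eg cmpm1 cmp1m.
  exists (cokm (bound S) \oc h), (kerm (sb S) \oc g); split.
    by rewrite -cmpA [g \oc _]cmpA eg cmp1m eh.
  by rewrite -cmpA [h \oc _]cmpA kh cmp1m ge.
- move=> n n0; apply: (hmap_unique (hmap_spec_id _)).
  have -> : idm (s2 (cshort (stalk A X) (n - 1) n (n + 1))) = 0.
    by rewrite /= (negbTE n0) zobP.
  exact: hmap_spec0.
Qed.

Definition stalkC (X : Csub) : Chat :=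
  exist in_Chat (stalk A (sval X)) (stalk_in_Chat (svalP X)).

Definition DC : cfun Csub Chat :=
  @Cfun Csub Chat stalkC (fun X Y f => @cf1 _ _ (canon A) (sval X) (sval Y) f)
    (fun X => cf1_id (canon A) (sval X))
    (fun X Y Z g f => @cf1_cmp _ _ (canon A) _ _ _ g f).

End Subcategories.

(* Main.v *)
From HB Require Import structures.
From mathcomp Require Import all_boot all_order all_algebra boolp zify.
Require Import Defs.

(** For a complex [Z], a morphism [X[0] -> Z] of the derived category is only
    visible after truncating [Z] to the two-term complex
    [trT Z : coker d^-2 -> ker d^0], where it becomes a butterfly: an extension
    [U -> E -> X] with a map [E -> V] restricting to the differential [U -> V].
    Butterflies can be pushed out along chain maps and, uniquely up to
    isomorphism, pulled back along quasi-isomorphisms, so every formal zigzag of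
    chain maps and inverted quasi-isomorphisms acts on them, compatibly with the
    relations of the localization; no calculus of fractions is needed. For
    [Z = Y[1]] butterflies are extensions of [X] by [Y], and for [Z = Y[0]] they
    are morphisms [X -> Y], whence the description of [Ext^1] and the fullness of
    [X |-> X[0]]. As truncation makes every object with cohomology concentrated
    in degree 0 isomorphic to a stalk complex, projectively and injectively
    trivial morphisms correspond as well. *)

Set Implicit Arguments.
Unset Strict Implicit.
Unset Printing Implicit Defensive.

Import Order.TTheory GRing.Theory.
Local Open Scope ring_scope.

(** * Epimorphic covers and homology *)

Section Local.
Variable A : abelian.
Implicit Types X Y Z T : A.

Lemma epi_cmp X Y Z (g : hom Y Z) (f : hom X Y) : epi g -> epi f -> epi (g \oc f).
Proof. by move=> eg ef T u v; rewrite !cmpA => /ef /eg. Qed.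

Lemma epi_id X : epi (idm X).
Proof. by move=> T u v; rewrite !cmpm1. Qed.

Lemma epi_cancel X Y Z (g : hom Y Z) (f : hom X Y) : epi (g \oc f) -> epi g.
Proof. by move=> egf T u v e; apply: egf; rewrite !cmpA e. Qed.

(** The cover is the pullback of [p] along [x], since epimorphisms are stable under pullback.
    Viewing [p] as the end of a short exact sequence makes the [pull] construction available. *)
Lemma epi_lift X Y T (p : hom X Y) (x : hom T Y) : epi p ->
  exists T' (e : hom T' T) (z : hom T' X), epi e /\ p \oc z = x \oc e.
Proof.
move=> ep; pose E := Ext (conj (kermP p) (epi_normal ep)).
exists _, (pull_prj x E), (pr1 \oc kerm (pull_eq x E)).
by split; [apply: pull_prj_epi | apply: (pull_comm x E)].
Qed.

(** [x] factors through [f] after passing to an epimorphic cover of its domain: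
    the element-free form of "[x] takes values in the image of [f]". *)
Definition locimg X Y T (f : hom X Y) (x : hom T Y) :=
  exists T' (e : hom T' T) (z : hom T' X), epi e /\ f \oc z = x \oc e.

Lemma locimg_epi X Y (f : hom X Y) : locimg f (idm Y) -> epi f.
Proof.
by move=> [T [e [z [ee]]]]; rewrite cmp1m => fz;
  apply: (@epi_cancel _ _ _ f z); rewrite fz.
Qed.

(** Through the kernel of its cokernel, [f] factors as an epimorphism [q] followed by a mono. A map
    killed by the cokernel lifts to this image, and then along [q] on a cover. *)
Lemma cok_locimg X Y T (f : hom X Y) (x : hom T Y) :
  cokm f \oc x = 0 <-> locimg f x.
Proof.
split=> [cx|[T' [e [z [ee ze]]]]]; last first.
  by apply: ee; rewrite -cmpA -ze cmpA (cokmP f).1 !cmp0m.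
have mm := kernel_mono (kermP (cokm f)).
have [y ey] := kernel_lift (kermP (cokm f)) cx.
have [q eq] := kernel_lift (kermP (cokm f)) (cokmP f).1.
(* If [t] kills [q], then [f] factors through the mono [m \oc kerm t], which is the kernel of its
   cokernel. That cokernel kills [f], so it factors through [cokm f] and kills [m]. Hence [m]
   factors through [m \oc kerm t], [kerm t] has a section, and [t] vanishes. *)
have eqq : epi q.
  apply: epi0 => R t tq; have mk := kernel_mono (kermP t).
  have [q' eq'] := kernel_lift (kermP t) tq.
  set m := kerm (cokm f) in mm ey eq *.
  have mmk : mono (m \oc kerm t).
    by move=> S u v; rewrite -!cmpA => /mm /mk.
  have [|w ew] := cokernel_desc (g := cokm (m \oc kerm t)) (cokmP f).
    have fE : f = m \oc kerm t \oc q' by rewrite -cmpA eq' eq.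
    transitivity (cokm (m \oc kerm t) \oc (m \oc kerm t \oc q')).
      by congr (_ \oc _).
    by rewrite cmpA (cokmP _).1 cmp0m.
  have [|l el] := kernel_lift (g := m) (mono_normal mmk).
    by rewrite -ew -cmpA (kermP (cokm f)).1 cmpm0.
  have kl : kerm t \oc l = idm _ by apply: mm; rewrite cmpA el cmpm1.
  by rewrite -[t]cmpm1 -kl cmpA (kermP t).1 cmp0m.
have [T' [e [z [ee ze]]]] := epi_lift y eqq.
by exists T', e, z; split=> //; rewrite -eq -cmpA ze cmpA ey.
Qed.

(** Lifting through a mono can be tested on a cover: [z] kills the kernel of [e] because [k] is
    mono, and [e] is the cokernel of its kernel. *)
Lemma mono_local_lift K X T T' (k : hom K X) (x : hom T X) (e : hom T' T)
    (z : hom T' K) :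
  mono k -> epi e -> k \oc z = x \oc e -> exists y, k \oc y = x.
Proof.
move=> mk ee kz; have [|y ye] := cokernel_desc (g := z) (epi_normal ee).
  by apply: mk; rewrite cmpA kz -cmpA (kermP e).1 !cmpm0.
by exists y; apply: ee; rewrite -cmpA ye.
Qed.

End Local.

Section Homology.
Variable A : abelian.
Implicit Types S T : short A.

(** Applying the inverse of [h] shows that the class of the cycle [x] vanishes on a cover, and
    [cok_locimg] reads this as [x] being locally a boundary. *)
Lemma hmap_iso_inj S T (f : hom (s2 S) (s2 T)) h : hmap_spec f h -> is_iso h ->
  forall R (x : hom R (s2 S)), sb S \oc x = 0 ->
    locimg (sa T) (f \oc x) -> locimg (sa S) x.
Proof.
move=> [k e1 e2] [h' [h'h _]] R x sx [R' [e [y [ee ye]]]].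
have [x' ex] := kernel_lift (kermP (sb S)) sx.
have [R'' [e' [z [ee' ze]]]] : locimg (bound S) x'.
  apply/cok_locimg/ee; rewrite cmp0m -cmpA -[LHS]cmp1m -h'h -cmpA [h \oc _]cmpA e2.
  have -> : cokm (bound T) \oc k \oc (x' \oc e) = cokm (bound T) \oc (bound T \oc y).
    rewrite -cmpA; congr (_ \oc _); apply: (kernel_mono (kermP (sb T))).
    by rewrite [in RHS]cmpA boundE ye cmpA e1 -ex !cmpA.
  by rewrite [cokm _ \oc _]cmpA (cokmP _).1 cmp0m cmpm0.
by exists R'', e', z; split=> //; rewrite -boundE -cmpA ze cmpA ex.
Qed.

(** Here [x] is a local representative of the preimage under [h] of the class of [y]. Then [y] and
    [f \oc x] have the same class, so they differ locally by a boundary. *)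
Lemma hmap_iso_surj S T (f : hom (s2 S) (s2 T)) h : hmap_spec f h -> is_iso h ->
  forall R (y : hom R (s2 T)), sb T \oc y = 0 ->
    exists R' (e : hom R' R) (x : hom R' (s2 S)) (z : hom R' (s1 T)),
      [/\ epi e, sb S \oc x = 0 & y \oc e = f \oc x + sa T \oc z].
Proof.
move=> [k e1 e2] [h' [_ hh']] R y sy.
have [y' ey] := kernel_lift (kermP (sb T)) sy.
have [R' [e [x [ee xe]]]] :=
  epi_lift (h' \oc cokm (bound T) \oc y') (cokernel_epi (cokmP (bound S))).
have [R'' [e' [z [ee' ze]]]] : locimg (bound T) (y' \oc e - k \oc x).
  apply/cok_locimg; rewrite cmpDr cmpmN [cokm _ \oc (k \oc _)]cmpA -e2 -cmpA xe.
  by rewrite !cmpA hh' cmp1m subrr.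
exists R'', (e \oc e'), (kerm (sb S) \oc x \oc e'), z; split.
- exact: epi_cmp.
- by rewrite !cmpA (kermP _).1 !cmp0m.
- rewrite -boundE -[X in _ + X]cmpA ze cmpDl cmpDr cmpNm cmpmN !cmpA ey e1.
  by rewrite addrC subrK.
Qed.

Lemma hmap_isoP S T (f : hom (s2 S) (s2 T)) h : hmap_spec f h ->
  (forall R (x : hom R (s2 S)), sb S \oc x = 0 ->
    locimg (sa T) (f \oc x) -> locimg (sa S) x) ->
  (forall R (y : hom R (s2 T)), sb T \oc y = 0 ->
    exists R' (e : hom R' R) (x : hom R' (s2 S)) (z : hom R' (s1 T)),
      [/\ epi e, sb S \oc x = 0 & y \oc e = f \oc x + sa T \oc z]) ->
  is_iso h.
Proof.
move=> [k e1 e2] inj surj; apply: mono_epi_iso.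
  apply: mono0 => R x hx.
  have [R' [e [x' [ee xe]]]] := epi_lift x (cokernel_epi (cokmP (bound S))).
  apply: ee; rewrite -xe cmp0m; apply/cok_locimg.
  have [R1 [e1' [z1 [ee1 ze1]]]] : locimg (bound T) (k \oc x').
    by apply/cok_locimg; rewrite cmpA -e2 -cmpA xe cmpA hx cmp0m.
  have [||R2 [e2' [z2 [ee2 ze2]]]] := inj _ (kerm (sb S) \oc x').
  - by rewrite cmpA (kermP _).1 cmp0m.
  - by exists R1, e1', z1; split=> //; rewrite -boundE -cmpA ze1 !cmpA e1.
  exists R2, e2', z2; split=> //; apply: (kernel_mono (kermP (sb S))).
  by rewrite cmpA boundE ze2 !cmpA.
(* It suffices to hit the universal cycle [kerm (sb T)]. *)
have [R' [e [x [z [ee sx ye]]]]] := surj _ (kerm (sb T)) (kermP _).1.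
have [x' ex] := kernel_lift (kermP (sb S)) sx.
have {}ye : e = k \oc x' + bound T \oc z.
  apply: (kernel_mono (kermP (sb T))).
  by rewrite ye cmpDr !cmpA boundE e1 -ex !cmpA.
apply: (@epi_cancel _ _ _ _ _ (cokm (bound S) \oc x')).
have -> : h \oc (cokm (bound S) \oc x') = cokm (bound T) \oc e.
  by rewrite ye cmpDr !cmpA (cokmP (bound T)).1 cmp0m addr0 e2.
by apply: epi_cmp => //; apply: cokernel_epi (cokmP _).
Qed.

End Homology.

(** * Butterflies *)

Section Butterfly.
Variables (A : abelian) (X : A).

(** A butterfly from [X] to the two-term complex [a : U -> V]; up to [bmor] over
    identities these are the morphisms [X[0] -> (U -> V)] of the derived
    category, [V] being in degree 0. *)
Record bfly (U V : A) (a : hom U V) := Bfly {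
  bext : ext X U;
  bmap : hom (emid bext) V;
  bmapE : bmap \oc einj bext = a }.

Lemma bmapK (U V : A) (a : hom U V) (B : bfly a) T (x : hom T U) :
  bmap B \oc (einj (bext B) \oc x) = a \oc x.
Proof. by rewrite cmpA bmapE. Qed.

Definition bmor (U V U' V' : A) (a : hom U V) (a' : hom U' V') (u : hom U U')
    (v : hom V V') (B : bfly a) (B' : bfly a') :=
  exists h : hom (emid (bext B)) (emid (bext B')),
    [/\ h \oc einj (bext B) = einj (bext B') \oc u,
        eprj (bext B') \oc h = eprj (bext B)
      & bmap B' \oc h = v \oc bmap B].

Lemma bmor_id (U V : A) (a : hom U V) (B : bfly a) : bmor (idm U) (idm V) B B.
Proof. by exists (idm _); rewrite !cmpm1 !cmp1m. Qed.

Lemma bmor_cmp (U V U' V' U'' V'' : A) (a : hom U V) (a' : hom U' V')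
    (a'' : hom U'' V'') (u : hom U U') (v : hom V V') (u' : hom U' U'')
    (v' : hom V' V'') (B : bfly a) (B' : bfly a') (B'' : bfly a'') :
  bmor u' v' B' B'' -> bmor u v B B' -> bmor (u' \oc u) (v' \oc v) B B''.
Proof.
move=> [h' [i' p' s']] [h [i p s]]; exists (h' \oc h); split.
- by rewrite -cmpA i cmpA i' cmpA.
- by rewrite cmpA p' p.
- by rewrite cmpA s' -cmpA s cmpA.
Qed.

(** The two-term form of "the chain map [(u, v)] from [a] to [a'] induces
    isomorphisms on kernels and cokernels". *)
Definition aqis (U V U' V' : A) (a : hom U V) (a' : hom U' V') (u : hom U U')
    (v : hom V V') :=
  [/\ forall (T : A) (x : hom T U), a \oc x = 0 -> u \oc x = 0 -> x = 0,
      forall (T : A) (y : hom T U'), a' \oc y = 0 ->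
        exists (T' : A) (e : hom T' T) (x : hom T' U),
          [/\ epi e, a \oc x = 0 & u \oc x = y \oc e],
      forall (T : A) (x : hom T V), locimg a' (v \oc x) -> locimg a x
    & forall (T : A) (y : hom T V'),
        exists (T' : A) (e : hom T' T) (x : hom T' V) (z : hom T' U'),
          epi e /\ y \oc e = v \oc x + a' \oc z].

Lemma aqis_id (U V : A) (a : hom U V) : aqis a a (idm U) (idm V).
Proof.
split.
- by move=> T x _; rewrite cmp1m.
- move=> T y ay; exists T, (idm T), y; split; rewrite ?cmpm1 ?cmp1m //.
  exact: epi_id.
- by move=> T x; rewrite cmp1m.
- move=> T y; exists T, (idm T), y, 0; rewrite cmpm0 addr0 cmpm1 cmp1m.
  by split=> //; apply: epi_id.
Qed.

Section Qis.
Variables (U V U' V' : A) (a : hom U V) (a' : hom U' V').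
Variables (u : hom U U') (v : hom V V').
Hypothesis uv : v \oc a = a' \oc u.
Hypothesis q : aqis a a' u v.

(** With [aqis_lift_uniq], this says that [U] is the fibre product of [U'] and [V] over [V'], up to
    covers. Injectivity on cokernels makes [x] locally [a \oc w]; the defect [y - u \oc w] lies in
    the kernel of [a'] and is absorbed by surjectivity on kernels. *)
Lemma aqis_lift (T : A) (y : hom T U') (x : hom T V) : a' \oc y = v \oc x ->
  exists (T' : A) (e : hom T' T) (w : hom T' U),
    [/\ epi e, u \oc w = y \oc e & a \oc w = x \oc e].
Proof.
have [_ s1 i0 _] := q.
move=> e; have [T1 [e1 [w [ee1 we1]]]] : locimg a x.
  by apply: i0; exists T, (idm T), y; rewrite cmpm1; split=> //; apply: epi_id.
have [|T2 [e2 [w2 [ee2 aw2 uw2]]]] := s1 _ (y \oc e1 - u \oc w).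
  by rewrite cmpDr cmpmN !cmpA -uv e -cmpA -we1 cmpA subrr.
exists T2, (e1 \oc e2), (w \oc e2 + w2); split.
- exact: epi_cmp.
- by rewrite cmpDr uw2 cmpDl cmpNm !cmpA addrC subrK.
- by rewrite cmpDr aw2 addr0 !cmpA we1.
Qed.

Lemma aqis_lift_uniq (T : A) (w : hom T U) : u \oc w = 0 -> a \oc w = 0 -> w = 0.
Proof. by have [i1 _ _ _] := q => uw aw; apply: i1. Qed.

Section Square.
Variables (B : bfly a) (B' : bfly a') (h : hom (emid (bext B)) (emid (bext B'))).
Hypothesis hi : h \oc einj (bext B) = einj (bext B') \oc u.
Hypothesis hp : eprj (bext B') \oc h = eprj (bext B).
Hypothesis hs : bmap B' \oc h = v \oc bmap B.

Lemma bfly_sq_ext0 (T : A) (z : hom T (emid (bext B))) :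
  h \oc z = 0 -> bmap B \oc z = 0 -> z = 0.
Proof.
move=> hz sz; have [k c] := eses (bext B); have [k' c'] := eses (bext B').
have [|w ew] := kernel_lift (g := z) k; first by rewrite -hp -cmpA hz cmpm0.
rewrite -ew (aqis_lift_uniq (w := w)) ?cmpm0 //.
  by apply: (kernel_mono k'); rewrite cmpm0 cmpA -hi -cmpA ew.
by rewrite -(bmapE B) -cmpA ew.
Qed.

(** With [bfly_sq_ext0], the middle object of [B] is the fibre product of that of [B'] and [V] over
    [V']. Locally, a preimage [z1] of the projection of [x] to [X] is corrected by an element of [U]
    found with [aqis_lift]. *)
Lemma bfly_sq_lift (T : A) (x : hom T (emid (bext B'))) (y : hom T V) :
  bmap B' \oc x = v \oc y -> exists z, h \oc z = x /\ bmap B \oc z = y.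
Proof.
move=> e; have [k c] := eses (bext B); have [k' c'] := eses (bext B').
have [T1 [e1 [z1 [ee1 pz1]]]] := epi_lift (eprj (bext B') \oc x) (cokernel_epi c).
have [|w' ew'] := kernel_lift (g := x \oc e1 - h \oc z1) k'.
  by rewrite cmpDr cmpmN !cmpA hp -pz1 subrr.
have [|T2 [e2 [w [ee2 uw aw]]]] := @aqis_lift _ w' (y \oc e1 - bmap B \oc z1).
  rewrite -(bmapE B') -cmpA ew' !cmpDr !cmpmN !cmpA e hs.
  by rewrite -!cmpA.
pose z := z1 \oc e2 + einj (bext B) \oc w.
have hz : h \oc z = x \oc (e1 \oc e2).
  by rewrite /z cmpDr [X in _ + X]cmpA hi -[X in _ + X]cmpA uw cmpA
    [X in _ + X]cmpA ew' cmpDl cmpNm -!cmpA addrC subrK.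
have sz : bmap B \oc z = y \oc (e1 \oc e2).
  by rewrite /z cmpDr [X in _ + X]cmpA bmapE aw cmpDl cmpNm -!cmpA addrC subrK.
have ee : epi (e1 \oc e2) by apply: epi_cmp.
(* Uniqueness of solutions, [bfly_sq_ext0], lets the local solution descend along the cover. *)
have [|z' ez'] := cokernel_desc (g := z) (epi_normal ee).
  apply: bfly_sq_ext0; rewrite cmpA ?hz ?sz -cmpA (kermP _).1 cmpm0 //.
by exists z'; split; apply: ee; rewrite -cmpA ez'.
Qed.

End Square.

(** Both middle objects are the same fibre product, which yields the comparison map. *)
Lemma bmor_inj (B1 B2 : bfly a) (B' : bfly a') :
  bmor u v B1 B' -> bmor u v B2 B' -> bmor (idm U) (idm V) B1 B2.
Proof.
move=> [h1 [i1 p1 s1]] [h2 [i2 p2 s2]].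
have [z [hz sz]] := bfly_sq_lift i2 p2 s2 s1.
exists z; split; last by rewrite sz cmp1m.
  apply/eqP; rewrite -subr_eq0; apply/eqP; apply: (bfly_sq_ext0 i2 p2).
    by rewrite cmpm1 cmpDr cmpmN cmpA hz i1 i2 subrr.
  by rewrite cmpm1 cmpDr cmpmN cmpA sz !bmapE subrr.
by rewrite -p2 -cmpA hz p1.
Qed.

(** The middle object is the fibre product of [bmap B'] and [v], realised as the kernel of [f]. The
    kernel of its projection to [X] is [U] by [aqis_lift]. *)
Lemma bmor_pull (B' : bfly a') : exists B : bfly a, bmor u v B B'.
Proof.
have [k' c'] := eses (bext B').
pose f := coprod_mor (bmap B') (- v).
have kf := kermP f.
have fE : bmap B' \oc (pr1 \oc kerm f) = v \oc (pr2 \oc kerm f).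
  apply/eqP; rewrite -subr_eq0 -cmpNm !cmpA -cmpDl; apply/eqP.
  exact: kf.1.
have fl (T : A) (x : hom T (emid (bext B'))) (y : hom T V) : bmap B' \oc x = v \oc y ->
    exists z, pr1 \oc (kerm f \oc z) = x /\ pr2 \oc (kerm f \oc z) = y.
  move=> e; have [|z ez] := kernel_lift (g := prod_mor x y) kf.
    by rewrite coprod_prod cmpNm e subrr.
  by exists z; rewrite ez pr1_prod pr2_prod.
have [|i [i1 i2]] := fl _ (einj (bext B') \oc u) a; first by rewrite cmpA bmapE.
pose p := eprj (bext B') \oc (pr1 \oc kerm f).
have mi : mono i.
  apply: mono0 => T x ix; apply: aqis_lift_uniq.
    apply: (kernel_mono k'); rewrite cmpm0 cmpA -i1 -!cmpA ix.
    by rewrite !cmpm0.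
  by rewrite -i2 -!cmpA ix !cmpm0.
have kk : is_kernel i p.
  apply: mk_kernel => //.
    by rewrite /p -!cmpA i1 cmpA k'.1 cmp0m.
  move=> T g pg; have [|w' ew'] := kernel_lift (g := pr1 \oc kerm f \oc g) k'.
    by rewrite cmpA.
  have [|T1 [e1 [w [ee1 uw aw]]]] := @aqis_lift _ w' (pr2 \oc kerm f \oc g).
    by rewrite -(bmapK B') ew' !cmpA -[_ \oc pr1 \oc _]cmpA fE !cmpA.
  apply: (mono_local_lift (z := w) mi ee1).
  apply: (kernel_mono kf); apply: bip_extr.
    by rewrite !cmpA -[_ \oc i]cmpA i1 -ew' -!cmpA uw.
  by rewrite !cmpA -[_ \oc i]cmpA i2 aw.
(* Surjectivity on cokernels: a local lift [x] of the identity of [X] is moved by an element of [U']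
   until its image in [V'] comes from [V]. *)
have ep : epi p.
  apply: locimg_epi.
  have [T1 [e1 [x [ee1 px]]]] := epi_lift (idm X) (cokernel_epi c').
  have [_ _ _ s0] := q; have [T2 [e2 [y [z [ee2 ye]]]]] := s0 _ (bmap B' \oc x).
  have [|w [w1 w2]] := fl _ (x \oc e2 - einj (bext B') \oc z) y.
    by rewrite cmpDr cmpmN !cmpA bmapE ye addrK.
  exists T2, (e1 \oc e2), w; split; first exact: epi_cmp.
  by rewrite /p -!cmpA w1 cmpDr cmpmN !cmpA k'.1 cmp0m subr0 px !cmp1m.
pose E := Ext (conj kk (epi_cokernel kk ep)).
have sE : pr2 \oc kerm f \oc einj E = a by rewrite -cmpA.
exists (@Bfly _ _ _ E _ sE), (pr1 \oc kerm f); split=> //=.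
by rewrite -cmpA.
Qed.

End Qis.

(** Cancellation for the identity, seen as a quasi-isomorphism: both [B'] and [B] map to [B']. *)
Lemma bmor_sym (U V : A) (a : hom U V) (B B' : bfly a) :
  bmor (idm U) (idm V) B B' -> bmor (idm U) (idm V) B' B.
Proof.
by apply: (bmor_inj _ (aqis_id a)) (bmor_id B'); rewrite cmp1m cmpm1.
Qed.

Section Push.
Variables (U V U' V' : A) (a : hom U V) (a' : hom U' V').
Variables (u : hom U U') (v : hom V V').
Hypothesis uv : v \oc a = a' \oc u.

(** On the pushout of the extension along [u], the maps [v \oc bmap B] and [a'] glue to the new
    [bmap]; the universal property is that of the pushout. *)
Lemma bpush_ex (B : bfly a) : exists2 P : bfly a', bmor u v B P &
  forall (U'' V'' : A) (a'' : hom U'' V'') (u' : hom U' U'') (v' : hom V' V'')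
    (B'' : bfly a''), v' \oc a' = a'' \oc u' ->
    bmor (u' \oc u) (v' \oc v) B B'' -> bmor u' v' P B''.
Proof.
have [|s [s1 s2]] := @push_desc _ _ _ _ u (bext B) _ (v \oc bmap B) a'.
  by rewrite -cmpA bmapE uv.
have [p1 p2] := push_prjP u (bext B).
pose P := @Bfly _ _ _ (push u (bext B)) _ s2.
exists P.
  exists (cokm (push_eq u (bext B)) \oc in1); split; first exact: push_comm.
    by rewrite cmpA.
  by rewrite cmpA.
move=> U'' V'' a'' u' v' B'' uv' [h [hi hp hs]].
have [|w [w1 w2]] := @push_desc _ _ _ _ u (bext B) _ h (einj (bext B'') \oc u').
  by rewrite hi cmpA.
exists w; split=> //=; apply: push_ext; rewrite -!cmpA.
- by rewrite [w \oc _]cmpA w1 hp -p1 cmpA.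
- by rewrite w2 cmpA (eses (bext B'')).1.1 cmp0m p2.
- by rewrite [w \oc _]cmpA w1 hs [s \oc _]cmpA s1 cmpA.
- by rewrite w2 cmpA bmapE s2.
Qed.

Lemma bmor_push (B : bfly a) : exists B' : bfly a', bmor u v B B'.
Proof. by have [P] := bpush_ex B; exists P. Qed.

(** Any [B'] receiving a morphism from [B] over [(u, v)] is isomorphic to the pushout, so it
    inherits the universal property. *)
Lemma bmor_of_push (U'' V'' : A) (a'' : hom U'' V'') (u' : hom U' U'')
    (v' : hom V' V'') (B : bfly a) (B' : bfly a') (B'' : bfly a'') :
  v' \oc a' = a'' \oc u' ->
  bmor u v B B' -> bmor (u' \oc u) (v' \oc v) B B'' -> bmor u' v' B' B''.
Proof.
move=> uv' BB' BB''; have [P BP h] := bpush_ex B.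
have PB' : bmor (idm U') (idm V') P B'.
  by apply: h; rewrite ?cmp1m ?cmpm1.
by have := bmor_cmp (h _ _ _ _ _ _ uv' BB'') (bmor_sym PB'); rewrite !cmpm1.
Qed.

Lemma bmor_uniq (B : bfly a) (B' B'' : bfly a') :
  bmor u v B B' -> bmor u v B B'' -> bmor (idm U') (idm V') B' B''.
Proof.
by move=> BB' BB''; apply: bmor_of_push BB' _; rewrite cmp1m ?cmpm1 // cmp1m.
Qed.

End Push.

End Butterfly.

(** * Two-term complexes and truncations *)

Section Isos.
Variable C : preadd.

Lemma iso_cancel_l (X Y Z : C) (g : hom Y Z) (f : hom X Y) :
  is_iso g -> is_iso (g \oc f) -> is_iso f.
Proof.
move=> [g' [g'g gg']] isogf; have -> : f = g' \oc (g \oc f).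
  by rewrite cmpA g'g cmp1m.
by apply: is_iso_cmp => //; exists g.
Qed.

Lemma iso_cancel_r (X Y Z : C) (g : hom Y Z) (f : hom X Y) :
  is_iso f -> is_iso (g \oc f) -> is_iso g.
Proof.
move=> [f' [f'f ff']] isogf; have -> : g = g \oc f \oc f'.
  by rewrite -cmpA ff' cmpm1.
by apply: is_iso_cmp => //; exists f.
Qed.

Lemma is_zero_l (X Y : C) (f : hom X Y) : is_zero X -> f = 0.
Proof. by move=> X0; rewrite -[f]cmpm1 X0 cmpm0. Qed.

Lemma is_zero_r (X Y : C) (f : hom X Y) : is_zero Y -> f = 0.
Proof. by move=> Y0; rewrite -[f]cmp1m Y0 cmp0m. Qed.

Lemma is_zero_iso (X Y : C) (f : hom X Y) : is_zero X -> is_zero Y -> is_iso f.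
Proof. by move=> X0 Y0; exists 0; rewrite cmpm0 cmp0m X0 Y0. Qed.

Lemma is_zero_mono (X Y : C) (f : hom X Y) : is_zero X -> mono f.
Proof. by move=> X0 T u v _; rewrite [u]is_zero_r // [v]is_zero_r. Qed.

Lemma is_zero_epi (X Y : C) (f : hom X Y) : is_zero Y -> epi f.
Proof. by move=> X0 T u v _; rewrite [u]is_zero_l // [v]is_zero_l. Qed.

End Isos.

Section Induced.
Variable A : abelian.

Lemma mono_kernel_zero (X Y : A) (f : hom X Y) : mono f -> is_zero (kerob f).
Proof.
move=> mf; apply: (kernel_mono (kermP f)); rewrite cmpm1 cmpm0.
by apply: mf; rewrite (kermP f).1 cmpm0.
Qed.

Lemma epi_coker_zero (X Y : A) (f : hom X Y) : epi f -> is_zero (cokob f).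
Proof.
move=> ef; apply: (cokernel_epi (cokmP f)); rewrite cmp1m cmp0m.
by apply: ef; rewrite (cokmP f).1 cmp0m.
Qed.

Section Ker.
Variables (X Y X' Y' : A) (f : hom X Y) (f' : hom X' Y').
Variables (x : hom X X') (y : hom Y Y').
Hypothesis e : f' \oc x = y \oc f.

Lemma kmap_subproof : exists k, kerm f' \oc k = x \oc kerm f.
Proof.
by apply: kernel_lift (kermP f') _; rewrite cmpA e -cmpA (kermP f).1 cmpm0.
Qed.
Definition kmap : hom (kerob f) (kerob f') := sval (cid kmap_subproof).
Lemma kmapE : kerm f' \oc kmap = x \oc kerm f.
Proof. exact: svalP (cid kmap_subproof). Qed.

Lemma ckmap_subproof : exists k, k \oc cokm f = cokm f' \oc y.
Proof.
by apply: cokernel_desc (cokmP f) _; rewrite -cmpA -e cmpA (cokmP f').1 cmp0m.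
Qed.
Definition ckmap : hom (cokob f) (cokob f') := sval (cid ckmap_subproof).
Lemma ckmapE : ckmap \oc cokm f = cokm f' \oc y.
Proof. exact: svalP (cid ckmap_subproof). Qed.

End Ker.

Lemma cokm_zero_iso (X Y : A) (f : hom X Y) : is_zero X -> is_iso (cokm f).
Proof.
move=> X0; apply: mono_epi_iso (cokernel_epi (cokmP _)).
apply: mono0 => T u /cok_locimg [T' [e [z [ee ze]]]].
by apply: ee; rewrite cmp0m -ze [z]is_zero_r ?cmpm0.
Qed.

Lemma ses_iso_l (X Y Y' E : A) (i : hom Y E) (p : hom E X) (q : hom Y' Y) :
  ses i p -> is_iso q -> ses (i \oc q) p.
Proof.
move=> [k c] [g [gq qg]]; split.
  apply: mk_kernel; first by rewrite cmpA k.1 cmp0m.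
    apply: mono0 => T u; rewrite -cmpA => /esym iu.
    rewrite -[u]cmp1m -gq -cmpA [q \oc u](_ : _ = 0) ?cmpm0 //.
    by apply: (kernel_mono k); rewrite cmpm0.
  move=> T h /(kernel_lift k) [u <-]; exists (g \oc u).
  by rewrite -cmpA [q \oc _]cmpA qg cmp1m.
apply: mk_cokernel (cokernel_epi c) _; first by rewrite cmpA k.1 cmp0m.
move=> T h hi; apply: cokernel_desc c _.
by rewrite -[LHS]cmpm1 -qg -[RHS](cmp0m _ g) -hi -!cmpA.
Qed.

End Induced.

Section Two.
Variable A : addcat.

(** The complex [U -> V] with [V] in degree 0 ([Negz 0] is [-1]). *)
Definition two_ob (U V : A) (n : int) : A :=
  match n with Posz 0 => V | Negz 0 => U | _ => zob end.

Definition two_d (U V : A) (a : hom U V) (m n : int) :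
    hom (two_ob U V m) (two_ob U V n) :=
  match m as m0, n as n0 return hom (two_ob U V m0) (two_ob U V n0) with
  | Negz 0, Posz 0 => a
  | _, _ => 0
  end.

Definition two (U V : A) (a : hom U V) : cpx A.
Proof.
apply: (@Cpx _ (two_ob U V) (two_d a)).
- by case=> [[|m]|[|m]] [[|n]|[|n]].
- by case=> [[|l]|[|l]] [[|m]|[|m]] [[|n]|[|n]] /=; rewrite ?cmp0m ?cmpm0.
Defined.

Definition two_fun (U V U' V' : A) (u : hom U U') (v : hom V V') (n : int) :
    hom (two_ob U V n) (two_ob U' V' n) :=
  match n as n0 return hom (two_ob U V n0) (two_ob U' V' n0) with
  | Posz 0 => v | Negz 0 => u | _ => 0
  end.

Definition two_mor (U V U' V' : A) (a : hom U V) (a' : hom U' V')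
  (u : hom U U') (v : hom V V') (e : v \oc a = a' \oc u) :
  cmap (two a) (two a').
Proof.
apply: (@Cmap A (two a) (two a') (two_fun u v)).
by case=> [[|m]|[|m]] [[|n]|[|n]] /=; rewrite ?cmp0m ?cmpm0.
Defined.

End Two.

(** * Criteria for isomorphisms on cohomology *)

Section Criteria.
Variable A : abelian.
Local Notation Ch := (cpx_addcat A).

Lemma cohom_zero n (X : cpx A) : is_zero (X n) -> is_zero (cohom n X).
Proof.
move=> X0; apply: (hmap_unique (hmap_spec_id _)).
have -> : idm (s2 (cshort X (n - 1) n (n + 1))) = 0 by exact: X0.
exact: hmap_spec0.
Qed.

Section Map.
Variables (X Y : cpx A) (f : cmap X Y) (n : int).

Lemma cohom_iso_inj : is_iso (cohom_map n f) ->
  forall T (x : hom T (X n)), cd n (n + 1) \oc x = 0 ->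
    locimg (cd (n - 1) n) (f n \oc x) -> locimg (cd (n - 1) n) x.
Proof. exact: hmap_iso_inj (cohom_mapP n f). Qed.

Lemma cohom_iso_surj : is_iso (cohom_map n f) ->
  forall T (y : hom T (Y n)), cd n (n + 1) \oc y = 0 ->
    exists (T' : A) (e : hom T' T) (x : hom T' (X n)) (z : hom T' (Y (n - 1))),
      [/\ epi e, cd n (n + 1) \oc x = 0 & y \oc e = f n \oc x + cd (n - 1) n \oc z].
Proof. exact: hmap_iso_surj (cohom_mapP n f). Qed.

Lemma cohom_isoP :
  (forall T (x : hom T (X n)), cd n (n + 1) \oc x = 0 ->
    locimg (cd (n - 1) n) (f n \oc x) -> locimg (cd (n - 1) n) x) ->
  (forall T (y : hom T (Y n)), cd n (n + 1) \oc y = 0 ->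
    exists (T' : A) (e : hom T' T) (x : hom T' (X n)) (z : hom T' (Y (n - 1))),
      [/\ epi e, cd n (n + 1) \oc x = 0 & y \oc e = f n \oc x + cd (n - 1) n \oc z]) ->
  is_iso (cohom_map n f).
Proof. exact: hmap_isoP (cohom_mapP n f). Qed.

(** Suited to inclusions: a primitive of [f n \oc x] lifts locally along [f (n - 1)], and monicity
    in degrees [n] and [n + 1] reflects boundaries and cycles. *)
Lemma cohom_iso_mono : epi (f (n - 1)) -> mono (f n) -> mono (f (n + 1)) ->
  (forall T (y : hom T (Y n)), cd n (n + 1) \oc y = 0 ->
    exists x, f n \oc x = y) -> is_iso (cohom_map n f).
Proof.
move=> e1 m2 m3 lift; apply: cohom_isoP => T x.
  move=> _ [T' [e [y [ee ye]]]].
  have [T2 [e2 [z [ee2 ze]]]] := epi_lift y e1.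
  exists T2, (e \oc e2), z; split; first exact: epi_cmp.
  by apply: m2; rewrite !cmpA cm_comm -cmpA ze cmpA ye.
move=> dx; have [z ez] := lift _ _ dx; exists T, (idm T), z, 0; split.
- exact: epi_id.
- by apply: m3; rewrite cmpm0 cmpA cm_comm -cmpA ez.
- by rewrite cmpm0 addr0 cmpm1.
Qed.

(** Suited to quotients: if the image of [x] is a boundary, then [x] differs locally from a boundary
    by something [f n] kills, which is itself locally a boundary. *)
Lemma cohom_iso_epi : epi (f (n - 1)) -> epi (f n) -> mono (f (n + 1)) ->
  (forall T (x : hom T (X n)), f n \oc x = 0 -> locimg (cd (n - 1) n) x) ->
  is_iso (cohom_map n f).
Proof.
move=> e1 e2 m3 ker; apply: cohom_isoP => T x.
  move=> _ [T' [e [y [ee ye]]]].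
  have [T2 [e' [z [ee' ze]]]] := epi_lift y e1.
  have [|T3 [e'' [w [ee'' we]]]] := ker _ (x \oc (e \oc e') - cd _ _ \oc z).
    by rewrite cmpDr cmpmN !cmpA cm_comm -[_ \oc z]cmpA ze cmpA ye subrr.
  exists T3, (e \oc e' \oc e''), (w + z \oc e''); split.
    by do 2![apply: epi_cmp => //].
  by rewrite cmpDr we cmpDl cmpNm !cmpA subrK.
move=> dx; have [T' [e [z [ee ze]]]] := epi_lift x e2.
exists T', e, z, 0; split=> //; last by rewrite cmpm0 addr0.
by apply: m3; rewrite cmpm0 cmpA cm_comm -cmpA ze cmpA dx cmp0m.
Qed.

End Map.

(** The differentials into degree -1 and out of degree 0 vanish, so cohomology there is the kernel
    and the cokernel; the four clauses are injectivity and surjectivity in these two degrees. *)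
Lemma qis_two (U V U' V' : A) (a : hom U V) (a' : hom U' V') (u : hom U U')
    (v : hom V V') (e : v \oc a = a' \oc u) :
  qis (two_mor e : @hom Ch (two a) (two a')) -> aqis a a' u v.
Proof.
move=> q; have i1 := cohom_iso_inj (q (Negz 0)).
have s1 := cohom_iso_surj (q (Negz 0)).
have i0 := cohom_iso_inj (q (Posz 0)).
have s0 := cohom_iso_surj (q (Posz 0)).
split.
- move=> T x ax ux; have [||T' [e' [z [ee' ze]]]] := i1 T x.
  + exact: ax.
  + by exists T, (idm T), 0; split; [apply: epi_id | rewrite cmpm0 /= ux cmp0m].
  by apply: ee'; rewrite -ze /= !cmp0m.
- move=> T y ay; have [|T' [e' [x [z [ee' ax ye]]]]] := s1 T y; first exact: ay.
  exists T', e', x; split=> //; rewrite ye.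
  by rewrite [X in _ + X](_ : _ = 0) ?addr0 //= cmp0m.
- move=> T x lx; apply: (i0 T x) lx; exact: cmp0m.
- move=> T y; have [|T' [e' [x [z [ee' _ ye]]]]] := s0 T y; first exact: cmp0m.
  by exists T', e', x, z.
Qed.

End Criteria.

(** * Truncation functors and their comparison maps *)

Section Trunc.
Variable A : abelian.
Local Notation Ch := (cpx_addcat A).
Local Notation d0 Z := (@cd A Z (Posz 0) (Posz 1)).
Local Notation d2 Z := (@cd A Z (Negz 1) (Negz 0)).

Lemma zlift_subproof (Z : cpx A) m : exists k, kerm (d0 Z) \oc k = cd m 0.
Proof. exact: kernel_lift (kermP _) (cd_cd _ _ _ _). Qed.
(** Taken for every [m] because differentials are families over all pairs of indices; it vanishes
    unless [m] is -1. *)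
Definition zlift (Z : cpx A) m : hom (Z m) (kerob (d0 Z)) :=
  sval (cid (zlift_subproof Z m)).
Lemma zliftE (Z : cpx A) m : kerm (d0 Z) \oc zlift Z m = cd m 0.
Proof. exact: svalP (cid (zlift_subproof Z m)). Qed.

(** [trS] is the truncation in degrees [<= 0], and [trT] its quotient in
    degrees [-1] and [0]. *)
Definition trS_ob (Z : cpx A) (n : int) : A :=
  match n with Negz k => Z (Negz k) | Posz 0 => kerob (d0 Z) | _ => zob end.

Definition trS_d (Z : cpx A) (m n : int) : hom (trS_ob Z m) (trS_ob Z n) :=
  match m as m0, n as n0 return hom (trS_ob Z m0) (trS_ob Z n0) with
  | Negz k, Negz l => cd (Negz k) (Negz l)
  | Negz k, Posz 0 => zlift Z (Negz k)
  | _, _ => 0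
  end.

Definition trS_cpx (Z : cpx A) : cpx A.
Proof.
apply: (@Cpx _ (trS_ob Z) (trS_d Z)).
- case=> [[|m]|m] [[|n]|n] //= mn; last exact: cd_shape.
  by apply: (kernel_mono (kermP (d0 Z))); rewrite zliftE cmpm0 cd_shape.
- case=> [[|l]|l] [[|m]|m] [[|n]|n] /=; rewrite ?cmp0m ?cmpm0 ?cd_cd //.
  by apply: (kernel_mono (kermP (d0 Z))); rewrite cmpA zliftE cmpm0 cd_cd.
Defined.

Definition trS_fun (Z Z' : cpx A) (f : cmap Z Z') (n : int) :
    hom (trS_ob Z n) (trS_ob Z' n) :=
  match n as n0 return hom (trS_ob Z n0) (trS_ob Z' n0) with
  | Negz k => f (Negz k)
  | Posz 0 => kmap (esym (cm_comm f 0 1))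
  | _ => 0
  end.

Definition trS_mor (Z Z' : cpx A) (f : cmap Z Z') : cmap (trS_cpx Z) (trS_cpx Z').
Proof.
apply: (@Cmap _ (trS_cpx Z) (trS_cpx Z') (trS_fun f)).
case=> [[|m]|m] [[|n]|n] /=; rewrite ?cmp0m ?cmpm0 ?cm_comm //.
apply: (kernel_mono (kermP (d0 Z'))).
by rewrite !cmpA kmapE -cmpA !zliftE cm_comm.
Defined.

Definition trS : cfun Ch Ch.
Proof.
apply: (@Cfun Ch Ch trS_cpx trS_mor).
- move=> Z; apply: cmap_eq => -[[|n]|n] //=; last by rewrite zobP.
  by apply: (kernel_mono (kermP (d0 Z))); rewrite kmapE cmp1m cmpm1.
- move=> X Y Z g f; apply: cmap_eq => -[[|n]|n] //=; last by rewrite cmp0m.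
  apply: (kernel_mono (kermP (d0 Z))).
  by rewrite kmapE cmpA kmapE -!cmpA kmapE.
Defined.

Lemma trT_subproof (Z : cpx A) : exists w, w \oc cokm (d2 Z) = zlift Z (Negz 0).
Proof.
apply: cokernel_desc (cokmP _) _; apply: (kernel_mono (kermP (d0 Z))).
by rewrite cmpA zliftE cd_cd cmpm0.
Qed.
Definition trT_d (Z : cpx A) : hom (cokob (d2 Z)) (kerob (d0 Z)) :=
  sval (cid (trT_subproof Z)).
Lemma trT_dE (Z : cpx A) : trT_d Z \oc cokm (d2 Z) = zlift Z (Negz 0).
Proof. exact: svalP (cid (trT_subproof Z)). Qed.

Definition trU (Z Z' : cpx A) (f : cmap Z Z') : hom (cokob (d2 Z)) (cokob (d2 Z')) :=
  ckmap (esym (cm_comm f (Negz 1) (Negz 0))).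
Definition trV (Z Z' : cpx A) (f : cmap Z Z') : hom (kerob (d0 Z)) (kerob (d0 Z')) :=
  kmap (esym (cm_comm f 0 1)).

Lemma trUE (Z Z' : cpx A) (f : cmap Z Z') :
  trU f \oc cokm (d2 Z) = cokm (d2 Z') \oc f (Negz 0).
Proof. exact: ckmapE. Qed.
Lemma trVE (Z Z' : cpx A) (f : cmap Z Z') :
  kerm (d0 Z') \oc trV f = f (Posz 0) \oc kerm (d0 Z).
Proof. exact: kmapE. Qed.

Lemma trUV (Z Z' : cpx A) (f : cmap Z Z') : trV f \oc trT_d Z = trT_d Z' \oc trU f.
Proof.
apply: (cokernel_epi (cokmP (d2 Z))); apply: (kernel_mono (kermP (d0 Z'))).
rewrite -!cmpA trUE trT_dE [trT_d Z' \oc _]cmpA trT_dE !cmpA trVE.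
by rewrite -cmpA !zliftE cm_comm.
Qed.

Lemma trU_id (Z : Ch) : trU (idm Z) = idm _.
Proof. by apply: (cokernel_epi (cokmP (d2 Z))); rewrite trUE cmp1m cmpm1. Qed.
Lemma trV_id (Z : Ch) : trV (idm Z) = idm _.
Proof. by apply: (kernel_mono (kermP (d0 Z))); rewrite trVE cmp1m cmpm1. Qed.
Lemma trU_cmp (X Y Z : Ch) (g : hom Y Z) (f : hom X Y) :
  trU (g \oc f) = trU g \oc trU f.
Proof.
apply: (cokernel_epi (cokmP (d2 X))).
by rewrite trUE -cmpA trUE [in RHS]cmpA trUE -cmpA.
Qed.
Lemma trV_cmp (X Y Z : Ch) (g : hom Y Z) (f : hom X Y) :
  trV (g \oc f) = trV g \oc trV f.
Proof.
apply: (kernel_mono (kermP (d0 Z))).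
by rewrite trVE cmpA trVE -[in RHS]cmpA trVE cmpA.
Qed.

Definition trT : cfun Ch Ch.
Proof.
apply: (@Cfun Ch Ch (fun Z => two (trT_d Z))
  (fun X Y (f : cmap X Y) => two_mor (trUV f))).
- by move=> Z; apply: cmap_eq => -[[|n]|[|n]] //=;
    rewrite ?trU_id ?trV_id ?zobP.
- by move=> X Y Z g f; apply: cmap_eq => -[[|n]|[|n]] //=;
    rewrite ?trU_cmp ?trV_cmp ?cmp0m.
Defined.

Definition incS_fun (Z : cpx A) (n : int) : hom (trS_ob Z n) (Z n) :=
  match n as n0 return hom (trS_ob Z n0) (Z n0) with
  | Negz k => idm _ | Posz 0 => kerm (d0 Z) | _ => 0
  end.

Definition incS (Z : cpx A) : cmap (trS_cpx Z) Z.
Proof.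
apply: (@Cmap _ (trS_cpx Z) Z (incS_fun Z)).
case=> [[|m]|m] [[|n]|n] /=; rewrite ?cmp0m ?cmpm0 ?cmp1m ?cmpm1 ?zliftE //.
- by rewrite (@cd_shape A Z 0 0) ?cmp0m.
- case: n => [|n]; first by rewrite (kermP (d0 Z)).1.
  by rewrite (@cd_shape A Z 0 n.+2) ?cmp0m.
- by rewrite (@cd_shape A Z 0 (Negz n)) ?cmp0m.
- by rewrite cd_shape //; lia.
Defined.

Definition prT_fun (Z : cpx A) (n : int) : hom (trS_ob Z n) (two_ob _ _ n) :=
  match n as n0 return
    hom (trS_ob Z n0) (two_ob (cokob (d2 Z)) (kerob (d0 Z)) n0) with
  | Negz 0 => cokm (d2 Z) | Posz 0 => idm _ | _ => 0
  end.

Definition prT (Z : cpx A) : cmap (trS_cpx Z) (two (trT_d Z)).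
Proof.
apply: (@Cmap _ (trS_cpx Z) (two (trT_d Z)) (prT_fun Z)).
case=> [[|m]|[|m]] [[|n]|[|n]] /=; rewrite ?cmp0m ?cmpm0 ?cmp1m ?cmpm1 ?trT_dE //.
- by rewrite (@cd_shape A Z (Negz 0) (Negz 0)) ?cmpm0.
- by apply: (kernel_mono (kermP (d0 Z))); rewrite zliftE cmpm0 cd_shape //; lia.
- case: m => [|m]; first exact: (cokmP (d2 Z)).1.
  by rewrite (@cd_shape A Z (Negz m.+2) (Negz 0)) ?cmpm0.
Defined.

Lemma incS_nat (Z Z' : Ch) (f : hom Z Z') :
  (incS Z' : @hom Ch (trS Z') Z') \oc cf1 trS f =
  f \oc (incS Z : @hom Ch (trS Z) Z).
Proof.
apply: cmap_eq => -[[|n]|n] /=; rewrite ?cmp0m ?cmpm0 ?cmp1m ?cmpm1 //.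
exact: kmapE.
Qed.

Lemma prT_nat (Z Z' : Ch) (f : hom Z Z') :
  (prT Z' : @hom Ch (trS Z') (trT Z')) \oc cf1 trS f =
  cf1 trT f \oc (prT Z : @hom Ch (trS Z) (trT Z)).
Proof.
apply: cmap_eq => -[[|n]|[|n]] /=; rewrite ?cmp0m ?cmpm0 ?cmp1m ?cmpm1 ?trUE //.
Qed.

Lemma incS_mono (Z : cpx A) n : mono (incS Z n).
Proof.
case: n => [[|n]|n]; first exact: kernel_mono (kermP _).
  exact/is_zero_mono/zobP.
by move=> T u v /=; rewrite !cmp1m.
Qed.

(** Below degree 0 the inclusion is the identity, and in degree 0 it is the kernel of [d^0], through
    which cycles lift. *)
Lemma incS_cohom (Z : cpx A) n : n <= 0 -> is_iso (cohom_map n (incS Z)).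
Proof.
move=> n0; apply: cohom_iso_mono; [| exact: incS_mono | exact: incS_mono |].
  have : n - 1 < 0 by lia.
  by case: (n - 1) => // k _; apply: epi_id.
case: n n0 => [[|n]|n] // _ T y dy; last by exists y; rewrite /= cmp1m.
exact: kernel_lift (kermP (d0 Z)) dy.
Qed.

Lemma incS_qis (Z : cpx A) : (forall n : int, 0 < n -> is_zero (cohom n Z)) ->
  qis (incS Z : @hom Ch (trS Z) Z).
Proof.
move=> Z0 n; have [n0|n0] := leP n 0; first exact: incS_cohom.
apply: is_zero_iso (Z0 n n0); apply: cohom_zero.
by case: n n0 => [[|n]|n] // _; apply: zobP.
Qed.

(** In degrees at most 0, naturality of [incS] allows cancelling it; above, both truncations are
    zero. *)
Lemma trS_qis (Z Z' : Ch) (f : hom Z Z') : qis f -> qis (cf1 trS f).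
Proof.
move=> qf n; have [n0|n0] := leP n 0.
  apply: (iso_cancel_l (incS_cohom Z' n0)).
  rewrite -[X in is_iso X](cohom_map_cmp n (incS Z' : @hom Ch (trS Z') Z') (cf1 trS f)).
  rewrite incS_nat cohom_map_cmp; apply: is_iso_cmp; first exact: qf.
  exact: incS_cohom.
by apply: is_zero_iso; apply: cohom_zero; case: n n0 => [[|n]|n] // _; apply: zobP.
Qed.

Lemma prT_epi (Z : cpx A) n : epi (prT Z n).
Proof.
case: n => [[|n]|[|n]]; [exact: epi_id | | | ].
- exact/is_zero_epi/zobP.
- exact: cokernel_epi (cokmP (d2 Z)).
- exact/is_zero_epi/zobP.
Qed.

(** The quotient map is mono in degrees at least 0, and in degree -1 it kills exactly the image of
    [d^-2]. *)
Lemma prT_cohom (Z : cpx A) n : -1 <= n -> is_iso (cohom_map n (prT Z)).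
Proof.
have m0 (k : int) : 0 <= k -> mono (prT Z k).
  case: k => [[|k]|k] // _; last exact/is_zero_mono/zobP.
  by move=> T u v /=; rewrite !cmp1m.
move=> n0; apply: cohom_iso_epi; [exact: prT_epi | exact: prT_epi | apply: m0; lia |].
move=> T x px; have [n1|n1] := leP 0 n.
  have -> : x = 0 by apply: (m0 _ n1); rewrite px cmpm0.
  by exists T, (idm T), 0; rewrite cmpm0 cmp0m; split=> //; apply: epi_id.
have e : n = Negz 0 by lia.
by move: x px; rewrite e => x px; apply/(cok_locimg (d2 Z) x).
Qed.

Lemma trT_qis (Z Z' : Ch) (f : hom Z Z') : qis f -> qis (cf1 trT f).
Proof.
move=> qf n; have [n0|n0] := leP (-1) n.
  apply: (iso_cancel_r (prT_cohom Z n0)).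
  rewrite -[X in is_iso X](cohom_map_cmp n (cf1 trT f) (prT Z : @hom Ch (trS Z) (trT Z))).
  rewrite -prT_nat cohom_map_cmp; apply: is_iso_cmp; first exact: prT_cohom.
  exact: trS_qis.
by apply: is_zero_iso; apply: cohom_zero; case: n n0 => [[|n]|[|n]] // _; apply: zobP.
Qed.

(** Below degree -1, [trS] has the cohomology of [Z], which vanishes by assumption, and the two-term
    complex is zero. *)
Lemma prT_qis (Z : cpx A) : (forall n : int, n < -1 -> is_zero (cohom n Z)) ->
  qis (prT Z : @hom Ch (trS Z) (trT Z)).
Proof.
move=> Z0 n; have [n0|n0] := leP (-1) n; first exact: prT_cohom.
apply: is_zero_iso.
  have [g [gf fg]] : is_iso (cohom_map n (incS Z)) by apply: incS_cohom; lia.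
  by rewrite /is_zero -gf (is_zero_r (cohom_map n (incS Z)) (Z0 n n0)) cmpm0.
by apply: cohom_zero; case: n n0 => [[|n]|[|n]] // _; apply: zobP.
Qed.

Lemma trT_aqis (Z Z' : Ch) (f : hom Z Z') : qis f ->
  aqis (trT_d Z) (trT_d Z') (trU f) (trV f).
Proof. by move=> /trT_qis; apply: qis_two. Qed.

End Trunc.

(** * Morphisms out of a stalk complex *)

Section Roofs.
Variable A : abelian.
Local Notation Ch := (cpx_addcat A).
Local Notation D := (derived A).

Definition dQ (X Y : Ch) (f : hom X Y) : @hom D X Y := lQ (@qis A) f.
Definition dI (X Y : Ch) (s : hom X Y) (w : qis s) : @hom D Y X :=
  @lI Ch (@qis A) X Y s w.

Lemma dQ_cmp (X Y Z : Ch) (g : hom Y Z) (f : hom X Y) : dQ (g \oc f) = dQ g \oc dQ f.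
Proof. exact: lQ_cmp. Qed.
Lemma dQI (X Y : Ch) (s : hom X Y) (w : qis s) : dQ s \oc dI w = idm (Y : D).
Proof. exact: lsI. Qed.
Lemma dIQ (X Y : Ch) (s : hom X Y) (w : qis s) : dI w \oc dQ s = idm (X : D).
Proof. exact: lIs. Qed.

Lemma dI_sq (X Y X' Y' : Ch) (s : hom X Y) (s' : hom X' Y') (c : hom X X')
    (b : hom Y Y') (w : qis s) (w' : qis s') :
  s' \oc c = b \oc s -> dQ c \oc dI w = dI w' \oc dQ b.
Proof.
move=> e; rewrite -[LHS]cmp1m -(dIQ w') -cmpA [dQ s' \oc _]cmpA -dQ_cmp e.
by rewrite dQ_cmp -[_ \oc dI w]cmpA dQI cmpm1.
Qed.

(** A chain map between the apexes, compatible with both legs, identifies two roofs. *)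
Lemma roof_eq (X Y Y' Z : Ch) (s : hom Y X) (s' : hom Y' X) (g : hom Y Z)
    (g' : hom Y' Z) (c : hom Y Y') (w : qis s) (w' : qis s') :
  s' \oc c = s -> g' \oc c = g -> dQ g \oc dI w = dQ g' \oc dI w'.
Proof.
move=> es eg; rewrite -eg dQ_cmp -cmpA (dI_sq (b := idm X) w w').
  by rewrite [dQ (idm X)](_ : _ = idm (X : D)) // cmpm1.
by rewrite cmp1m.
Qed.

Definition dT (X Y : Ch) (f : @hom D X Y) : @hom D (trT A X) (trT A Y) :=
  lmap (@trT_qis A) (f : lhom (@qis A) X Y).

(** The roof [Z <- trS Z -> trT Z]; [w] amounts to the vanishing of cohomology in positive
    degrees. *)
Definition theta (Z : Ch) (w : qis (incS Z : @hom Ch (trS A Z) Z)) :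
    @hom D Z (trT A Z) :=
  dQ (prT Z : @hom Ch (trS A Z) (trT A Z)) \oc dI w.

Lemma theta_nat (X Z : Ch) (f : @hom D X Z)
    (wX : qis (incS X : @hom Ch (trS A X) X))
    (wZ : qis (incS Z : @hom Ch (trS A Z) Z)) :
  dT f \oc theta wX = theta wZ \oc f.
Proof.
pose Sf : @hom D (trS A X) (trS A Z) := lmap (@trS_qis A) (f : lhom (@qis A) X Z).
have nT : dQ (prT Z : @hom Ch (trS A Z) (trT A Z)) \oc Sf =
    dT f \oc dQ (prT X : @hom Ch (trS A X) (trT A X)).
  exact: (lmap_nat (eta := @prT A : forall U : Ch, @hom Ch (trS A U) (trT A U))
    (@trS_qis A) (@trT_qis A) (@prT_nat A)).
have nS : dQ (incS Z : @hom Ch (trS A Z) Z) \oc Sf =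
    f \oc dQ (incS X : @hom Ch (trS A X) X).
  (* [incS] is natural towards the identity functor, so [f] is first written as its own image under
     that functor. *)
  rewrite -[f in RHS](lmap_idf (W := @qis A)).
  exact: (lmap_nat (G' := idf Ch) (eta := @incS A : forall U : Ch, @hom Ch (trS A U) U)
    (@trS_qis A) (@idfW Ch (@qis A)) (@incS_nat A)).
rewrite /theta [LHS]cmpA -nT -!cmpA; congr (_ \oc _).
rewrite -[LHS]cmp1m -(dIQ wZ) -[LHS]cmpA; congr (_ \oc _).
by rewrite cmpA nS -cmpA dQI cmpm1.
Qed.

Lemma theta_inj (X Z : Ch) (f g : @hom D X Z)
    (w : qis (incS Z : @hom Ch (trS A Z) Z)) :
  qis (prT Z : @hom Ch (trS A Z) (trT A Z)) ->
  theta w \oc f = theta w \oc g -> f = g.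
Proof.
move=> wp e; have : dI wp \oc (theta w \oc f) = dI wp \oc (theta w \oc g).
  by rewrite e.
rewrite /theta !cmpA dIQ cmp1m => {}e.
by rewrite -[f]cmp1m -[g]cmp1m -(dQI w) -!cmpA; congr (_ \oc _); exact: e.
Qed.

End Roofs.

(** * The action of zigzags on butterflies *)

Section Evaluation.
Variables (A : abelian) (X : A).
Local Notation Ch := (cpx_addcat A).
Local Notation D := (derived A).

Local Notation biso := (bmor (idm _) (idm _)).

(** The action of a formal zigzag of chain maps on butterflies: extension by
    pushout along chain maps, by pullback along formal inverses. *)
Fixpoint brel (Z Z' : Ch) (e : lexp (@qis A) Z Z') :
    bfly X (trT_d Z) -> bfly X (trT_d Z') -> Prop :=
  match e in lexp _ Z Z' return bfly X (trT_d Z) -> bfly X (trT_d Z') -> Prop with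
  | LQ _ _ f => fun B B' => bmor (trU f) (trV f) B B'
  | LI _ _ s _ => fun B B' => bmor (trU s) (trV s) B' B
  | LC _ _ _ g f => fun B B' => exists2 B1, brel f B B1 & brel g B1 B'
  end.

Lemma brel_iso (Z Z' : Ch) (e : lexp (@qis A) Z Z') B1 B2 B1' B2' :
  biso B1 B2 -> biso B1' B2' -> brel e B1 B1' -> brel e B2 B2'.
Proof.
elim: e B1 B2 B1' B2' => {Z Z'} /=.
- move=> Z Z' f B1 B2 B1' B2' /bmor_sym h k m.
  by have := bmor_cmp k (bmor_cmp m h); rewrite !cmp1m !cmpm1.
- move=> Z Z' s w B1 B2 B1' B2' k /bmor_sym h m.
  by have := bmor_cmp k (bmor_cmp m h); rewrite !cmp1m !cmpm1.
- move=> Z Z' Z'' g hg f hf B1 B2 B1' B2' h k [B m n].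
  by exists B; [apply: hf (bmor_id B) m | apply: hg k n => //; apply: bmor_id].
Qed.

(** Together with [brel_uniq], this makes the relation a function on isomorphism classes of
    butterflies. *)
Lemma brel_ex (Z Z' : Ch) (e : lexp (@qis A) Z Z') B : exists B', brel e B B'.
Proof.
elim: e B => {Z Z'} /=.
- by move=> Z Z' f B; apply: bmor_push; apply: trUV.
- by move=> Z Z' s w B; apply: bmor_pull (trT_aqis w) B; apply: trUV.
- move=> Z Z' Z'' g hg f hf B; have [B1 h1] := hf B; have [B2 h2] := hg B1.
  by exists B2, B1.
Qed.

Lemma brel_uniq (Z Z' : Ch) (e : lexp (@qis A) Z Z') B B1 B2 :
  brel e B B1 -> brel e B B2 -> biso B1 B2.
Proof.
elim: e B B1 B2 => {Z Z'} /=.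
- by move=> Z Z' f B B1 B2; apply: bmor_uniq; apply: trUV.
- by move=> Z Z' s w B B1 B2 m n; exact: (bmor_inj (trUV s) (trT_aqis w) m n).
- move=> Z Z' Z'' g hg f hf B B1 B2 [C1 m1 n1] [C2 m2 n2].
  apply: hg n2; apply: brel_iso n1; [exact: hf m1 m2 | exact: bmor_id].
Qed.

(** The action descends to the derived category. Composites of chain maps use the universal property
    of pushouts; the two inverse laws use existence and uniqueness of pushouts and pullbacks. *)
Lemma brel_eqv (Z Z' : Ch) (e e' : lexp (@qis A) Z Z') : leqv e e' ->
  forall B B', brel e B B' <-> brel e' B B'.
Proof.
elim=> {Z Z' e e'} /=.
- by [].
- by move=> Z Z' e e' _ h B B'; split=> /h.
- by move=> Z Z' e e' e'' _ h _ k B B'; split=> [/h/k|/k/h].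
- by move=> Z Z' Z'' g g' f f' _ h _ k B B'; split=> -[B1 /k m /h n]; exists B1.
- move=> Z Z' Z'' T h g f B B'; split.
    by move=> [B1 [B2 m n] p]; exists B2 => //; exists B1.
  by move=> [B1 m [B2 n p]]; exists B2 => //; exists B1.
- move=> Z Z' f B B'; rewrite trU_id trV_id; split=> [[B1 m n]|m].
    by apply: brel_iso n m; apply: bmor_id.
  by exists B' => //; apply: bmor_id.
- move=> Z Z' f B B'; rewrite trU_id trV_id; split=> [[B1 /bmor_sym m n]|m].
    by apply: brel_iso m _ n; apply: bmor_id.
  by exists B => //; apply: bmor_id.
- move=> Z Z' Z'' g f B B'; rewrite trU_cmp trV_cmp; split=> [m|[B1 m n]].
    have [B1 n] := bmor_push (trUV f) B; exists B1 => //.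
    exact: (bmor_of_push (trUV f) (trUV g) n m).
  exact: (bmor_cmp n m).
- move=> Z Z' s w B B'; rewrite trU_id trV_id; split=> [[B1 m n]|/bmor_sym m].
    exact: (bmor_inj (trUV s) (trT_aqis w) m n).
  have [B1 n] := bmor_push (trUV s) B; exists B1 => //.
  by have := bmor_cmp n m; rewrite !cmpm1.
- move=> Z Z' s w B B'; rewrite trU_id trV_id; split=> [[B1 m n]|m].
    exact: (bmor_uniq (trUV s) m n).
  have [B1 n] := bmor_pull (trUV s) (trT_aqis w) B; exists B1 => //.
  by have := bmor_cmp m n; rewrite !cmp1m.
Qed.

Definition extq_fun (Y : A) (E : ext X Y) (n : int) :
    hom (two_ob Y (emid E) n) (stalk_ob X n) :=
  match n as n0 return hom (two_ob Y (emid E) n0) (stalk_ob X n0) with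
  | Posz 0 => eprj E | _ => 0
  end.

(** The complex [Y -> E] as a resolution of [X[0]]. *)
Definition extq (Y : A) (E : ext X Y) : cmap (two (einj E)) (stalk_ob X).
Proof.
apply: (@Cmap _ (two (einj E)) (stalk_ob X) (extq_fun E)).
case=> [[|m]|[|m]] [[|n]|[|n]] /=; rewrite ?cmp0m ?cmpm0 //.
exact: (eses E).1.1.
Defined.

Lemma extq_qis (Y : A) (E : ext X Y) :
  qis (extq E : @hom Ch (two (einj E)) (stalk A X)).
Proof.
have [k c] := eses E.
have z n : n != 0 -> is_zero (stalk_ob X n).
  by move=> n0; rewrite /= (negbTE n0); apply: zobP.
case=> [[|n]|[|n]].
- apply: cohom_isoP => T x /= dx.
    move=> [T' [e [y [ee]]]]; rewrite cmp0m => /esym; rewrite -cmpA => px.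
    have [|w ew] := kernel_lift (g := x \oc e) k; first exact: px.
    by exists T', e, w.
  have [T' [e [y [ee ye]]]] := epi_lift x (cokernel_epi c).
  by exists T', e, y, 0; split; rewrite // ?cmp0m // addr0 -ye.
- by apply: is_zero_iso; apply: cohom_zero; [apply: zobP | apply: z].
- apply: cohom_isoP => T x dx.
    have -> : x = 0 by apply: (kernel_mono k); rewrite cmpm0; exact: dx.
    by exists T, (idm T), 0; rewrite cmpm0 cmp0m; split=> //; apply: epi_id.
  exists T, (idm T), 0, 0; rewrite !cmpm0 addr0; split=> //; first exact: epi_id.
  by apply: is_zero_r; apply: z.
- by apply: is_zero_iso; apply: cohom_zero; [apply: zobP | apply: z].
Qed.

Lemma bfly_sq (U V : A) (a : hom U V) (B : bfly X a) :
  bmap B \oc einj (bext B) = a \oc idm U.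
Proof. by rewrite cmpm1 bmapE. Qed.

(** The roof [X[0] <- (U -> E) -> (U -> V)] attached to a butterfly with middle object [E]. *)
Definition bphi (U V : A) (a : hom U V) (B : bfly X a) :
    @hom D (stalk A X) (two a) :=
  dQ (two_mor (bfly_sq B) : @hom Ch (two (einj (bext B))) (two a)) \oc
  dI (extq_qis (bext B)).

Lemma bphi_mor (U V U' V' : A) (a : hom U V) (a' : hom U' V') (u : hom U U')
    (v : hom V V') (e : v \oc a = a' \oc u) (B : bfly X a) (B' : bfly X a') :
  bmor u v B B' -> dQ (two_mor e : @hom Ch (two a) (two a')) \oc bphi B = bphi B'.
Proof.
move=> [h [hi hp hs]]; rewrite /bphi cmpA -dQ_cmp.
apply: (roof_eq (c := two_mor hi : @hom Ch (two _) (two _))).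
  by apply: cmap_eq => -[[|n]|[|n]] //=; rewrite ?cmp0m ?cmpm0.
by apply: cmap_eq => -[[|n]|[|n]] //=; rewrite ?cmp0m ?cmpm0 ?cmp1m ?cmpm1.
Qed.

(** Acting on butterflies is composing with the truncated zigzag: [bphi_mor] settles each generator,
    and composites follow by functoriality of [dT]. *)
Lemma brel_phi (Z Z' : Ch) (e : lexp (@qis A) Z Z') B B' : brel e B B' ->
  dT (qcls (leqv_eqv (@qis A) Z Z') e) \oc bphi B = bphi B'.
Proof.
elim: e B B' => {Z Z'}.
- move=> Z Z' f B B' h; rewrite /dT [lmap _ _](_ : _ = dQ (cf1 (trT A) f)).
    exact: bphi_mor h.
  exact: lmapQ.
- move=> Z Z' s w B B' h; rewrite /dT [lmap _ _](_ : _ = dI (trT_qis w)).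
    by rewrite -(bphi_mor (trUV s) h) [LHS]cmpA dIQ cmp1m.
  exact: lmapI.
- move=> Z Z' Z'' g hg f hf B B' [B1 m n]; rewrite -(hg _ _ n) -(hf _ _ m) cmpA.
  congr (_ \oc _); rewrite /dT -lcmpE; exact: lmap_cmp.
Qed.

Lemma dT_bphi (Z Z' : Ch) (f : @hom D Z Z') (B : bfly X (trT_d Z)) :
  exists B' : bfly X (trT_d Z'), dT f \oc bphi B = bphi B'.
Proof.
have [B' h] := brel_ex (qrep (f : lhom (@qis A) Z Z')) B.
by exists B'; rewrite -(brel_phi h) qrepK.
Qed.

Lemma brel_cls (Z Z' : Ch) (e e' : lexp (@qis A) Z Z') B B1 B2 :
  qcls (leqv_eqv (@qis A) Z Z') e = qcls (leqv_eqv (@qis A) Z Z') e' ->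
  brel e B B1 -> brel e' B B2 -> biso B1 B2.
Proof. by move=> /qclsP /brel_eqv h /h; apply: brel_uniq. Qed.

Section ToS.
Variables (Z : cpx A) (Y : A) (E : ext X Y).
Variable r : hom Y (Z (Negz 0)).
Variable s : hom (emid E) (kerob (@cd A Z (Posz 0) (Posz 1))).
Hypothesis e : s \oc einj E = zlift Z (Negz 0) \oc r.

Definition toS_fun (n : int) : hom (two_ob Y (emid E) n) (trS_ob Z n) :=
  match n as n0 return hom (two_ob Y (emid E) n0) (trS_ob Z n0) with
  | Posz 0 => s | Negz 0 => r | _ => 0
  end.

Definition toS : cmap (two (einj E)) (trS_cpx Z).
Proof.
apply: (@Cmap _ (two (einj E)) (trS_cpx Z) toS_fun).
case=> [[|m]|[|m]] [[|n]|[|n]] //=; rewrite ?cmp0m ?cmpm0 //.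
  by rewrite (@cd_shape A Z (Negz 0) (Negz 0)) ?cmp0m.
by rewrite (@cd_shape A Z (Negz 0) (Negz n.+1)) ?cmp0m.
Defined.

(** Computes [theta] on a roof whose right leg factors through [trS Z]: the map [h] of extensions is
    a map of apexes to the roof of [B]. *)
Lemma theta_toS (w : qis (incS Z : @hom Ch (trS A Z) Z)) (B : bfly X (trT_d Z))
    (h : hom (emid E) (emid (bext B))) :
  h \oc einj E = einj (bext B) \oc (cokm (@cd A Z (Negz 1) (Negz 0)) \oc r) ->
  eprj (bext B) \oc h = eprj E -> bmap B \oc h = s ->
  theta w \oc (dQ ((incS Z : @hom Ch (trS A Z) Z) \oc
    (toS : @hom Ch (two (einj E)) (trS A Z))) \oc dI (extq_qis E)) = bphi B.
Proof.
move=> hi hp hs; rewrite /theta dQ_cmp -!cmpA [dI w \oc _]cmpA dIQ cmp1m.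
rewrite cmpA -dQ_cmp; apply: (roof_eq (c := two_mor hi : @hom Ch (two _) (two _))).
  by apply: cmap_eq => -[[|n]|[|n]] //=; rewrite ?cmp0m ?cmpm0.
by apply: cmap_eq => -[[|n]|[|n]] //=; rewrite ?cmp0m ?cmpm0 ?cmp1m ?cmpm1.
Qed.

End ToS.

End Evaluation.

(** * Morphisms from [X[0]] to [Y[0]] and to [Y[1]] *)

Section Stalks.
Variable A : abelian.
Local Notation Ch := (cpx_addcat A).
Local Notation D := (derived A).
Local Notation Q := (canon A).

Lemma coker_zero (X Y : A) (f : hom X Y) : is_zero Y -> is_zero (cokob f).
Proof. by move=> Y0; apply/epi_coker_zero/is_zero_epi. Qed.

Lemma kernel_zero (X Y : A) (f : hom X Y) : is_zero X -> is_zero (kerob f).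
Proof. by move=> X0; apply/mono_kernel_zero/is_zero_mono. Qed.

Lemma stalk_zero (X : A) (n : int) : n != 0 -> is_zero (stalk_ob X n).
Proof. by move=> n0; rewrite /= (negbTE n0); apply: zobP. Qed.

Lemma stalk_incS (X : A) : qis (incS (stalk A X) : @hom Ch (trS A (stalk A X)) (stalk A X)).
Proof. by apply: incS_qis => n n0; apply/cohom_zero/stalk_zero; lia. Qed.

Lemma stalk_prT (X : A) :
  qis (prT (stalk A X) : @hom Ch (trS A (stalk A X)) (trT A (stalk A X))).
Proof. by apply: prT_qis => n n0; apply/cohom_zero/stalk_zero; lia. Qed.

Local Notation stalk1 Y := (shift A (stalk A Y)).

Lemma stalk1_incS (X : A) : qis (incS (stalk1 X) : @hom Ch (trS A (stalk1 X)) (stalk1 X)).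
Proof. by apply: incS_qis => n n0; apply/cohom_zero/(@stalk_zero X (n + 1)); lia. Qed.

Lemma stalk1_prT (X : A) :
  qis (prT (stalk1 X) : @hom Ch (trS A (stalk1 X)) (trT A (stalk1 X))).
Proof. by apply: prT_qis => n n0; apply/cohom_zero/(@stalk_zero X (n + 1)); lia. Qed.

Lemma zero_ses (U X : A) : is_zero U -> ses (0 : hom U X) (idm X).
Proof.
move=> U0; split.
  apply: mk_kernel; [exact: cmpm0 | exact: is_zero_mono |].
  by move=> T g; rewrite cmp1m => ->; exists 0; rewrite cmp0m.
apply: mk_cokernel; [exact: cmpm0 | exact: epi_id |].
by move=> T g _; exists g; rewrite cmpm1.
Qed.

Lemma stalk_lift_subproof (X : A) :
  exists s : hom X (kerob (@cd A (stalk A X) (Posz 0) (Posz 1))), kerm _ \oc s = idm X.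
Proof. by apply: kernel_lift (kermP _) _; rewrite cmp0m. Qed.
Definition stalk_lift (X : A) := sval (cid (stalk_lift_subproof X)).
Lemma stalk_liftE (X : A) :
  kerm (@cd A (stalk A X) (Posz 0) (Posz 1)) \oc stalk_lift X = idm X.
Proof. exact: svalP (cid (stalk_lift_subproof X)). Qed.

Lemma stalk_trU0 (X : A) :
  is_zero (cokob (@cd A (stalk A X) (Negz 1) (Negz 0))).
Proof. by apply: coker_zero; apply: zobP. Qed.

Definition stalk_ext (X : A) := Ext (zero_ses X (stalk_trU0 X)).

Lemma stalk_bflyE (X : A) :
  stalk_lift X \oc einj (stalk_ext X) = trT_d (stalk A X).
Proof. by rewrite [LHS]is_zero_l ?[RHS]is_zero_l //; apply: stalk_trU0. Qed.

(** The tautological butterfly, corresponding to the identity of [X[0]]: the extension of [X] by a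
    zero object. *)
Definition stalk_bfly (X : A) : bfly X (trT_d (stalk A X)) :=
  @Bfly A X _ _ _ (stalk_ext X) _ (stalk_bflyE X).

Lemma theta_stalk (X : A) : theta (stalk_incS X) = bphi (stalk_bfly X).
Proof.
have e : stalk_lift X \oc einj (stalk_ext X) =
    zlift (stalk A X) (Negz 0) \oc (0 : hom _ (stalk A X (Negz 0))).
  by rewrite cmpm0 [LHS]is_zero_l //; apply: stalk_trU0.
rewrite -(theta_toS (E := stalk_ext X) (B := stalk_bfly X) (h := idm _) e (stalk_incS X)).
(* Both legs of the roof are [extq], so the roof is the identity. *)
- rewrite [X in _ \oc (dQ X \oc _)](_ : _ = extq (stalk_ext X)).
    by rewrite dQI cmpm1.
  apply: cmap_eq => -[[|n]|[|n]] //=; rewrite ?cmp0m ?cmpm0 //.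
  exact: stalk_liftE.
- by rewrite [LHS]is_zero_l ?[RHS]is_zero_l //; apply: stalk_trU0.
- exact: cmpm1.
- exact: cmpm1.
Qed.

(** By naturality of [theta], the composite is [dT f] applied to the tautological butterfly. *)
Lemma hom_bphi (X : A) (Z : Ch) (w : qis (incS Z : @hom Ch (trS A Z) Z))
    (f : @hom D (stalk A X) Z) :
  exists B : bfly X (trT_d Z), theta w \oc f = bphi B.
Proof.
by rewrite -(theta_nat f (stalk_incS X)) theta_stalk; apply: dT_bphi.
Qed.

(** The truncation of [Y[0]] is zero in degree -1, so the extension of the butterfly has invertible
    projection, and following its inverse by [bmap] gives a map from [X] to the cycles of [Y[0]]. *)
Lemma canon_full (X Y : A) (f : @hom D (Q X) (Q Y)) :
  exists g : hom X Y, f = cf1 Q g.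
Proof.
have [B eB] := hom_bphi (stalk_incS Y) f.
have U0 := stalk_trU0 Y; have [k c] := eses (bext B).
have [r [rp pr]] : is_iso (eprj (bext B)).
  apply: mono_epi_iso (cokernel_epi c); apply: mono0 => T u pu.
  have [v <-] := kernel_lift k pu.
  by rewrite [einj _]is_zero_l ?cmp0m.
pose g : hom X Y := kerm (@cd A (stalk A Y) (Posz 0) (Posz 1)) \oc bmap B \oc r.
exists g; apply: (theta_inj (w := stalk_incS Y)); first exact: stalk_prT.
have e : bmap B \oc einj (bext B) =
    zlift (stalk A Y) (Negz 0) \oc (0 : hom _ (stalk A Y (Negz 0))).
  by rewrite cmpm0 [LHS]is_zero_l.
rewrite eB -(theta_toS (E := bext B) (h := idm _) e (stalk_incS Y)).
- rewrite [X in _ \oc (dQ X \oc _)](_ : _ = cf1 (stalk A) g \oc extq (bext B)).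
    by rewrite dQ_cmp -[_ \oc dI _]cmpA dQI cmpm1.
  apply: cmap_eq => -[[|n]|[|n]] //=; rewrite ?cmp0m ?cmpm0 //.
  by rewrite /stalk_fun /= /g -!cmpA rp cmpm1.
- by rewrite [LHS]is_zero_l ?[RHS]is_zero_l.
- exact: cmpm1.
- exact: cmpm1.
Qed.

Section Phi.
Variables X Y : A.

Definition extb_fun (E : ext X Y) (n : int) :
    hom (two_ob Y (emid E) n) (shift_ob (stalk_ob Y) n) :=
  match n as n0 return hom (two_ob Y (emid E) n0) (shift_ob (stalk_ob Y) n0) with
  | Negz 0 => idm Y | _ => 0
  end.

(** The identity of [Y] is a valid component in degree -1 because [Negz 0 + 1] reduces to 0. *)
Definition extb (E : ext X Y) : cmap (two (einj E)) (shift_ob (stalk_ob Y)).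
Proof.
apply: (@Cmap _ (two (einj E)) (shift_ob (stalk_ob Y)) (extb_fun E)).
by case=> [[|m]|[|m]] [[|n]|[|n]] /=; rewrite ?oppr0 ?cmp0m ?cmpm0.
Defined.

(** The connecting morphism of an extension, through the quasi-isomorphism from
    [Y -> E] to [X]. *)
Definition phi (E : ext X Y) : @hom D (Q X) (dshift A (Q Y)) :=
  dQ (extb E : @hom Ch (two (einj E)) (stalk1 Y)) \oc dI (extq_qis E).

(** The truncation of [Y[1]] is zero in degree 0, so a butterfly into it is merely an extension of
    [X] by its term in degree -1, which [q] identifies with [Y]. *)
Lemma phi_surj (f : @hom D (Q X) (dshift A (Q Y))) : exists E, f = phi E.
Proof.
have [B eB] := hom_bphi (stalk1_incS Y) f.
set Z : Ch := stalk1 Y in B eB.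
have V0 : is_zero (kerob (@cd A Z (Posz 0) (Posz 1))) by apply: kernel_zero; apply: zobP.
pose q : hom Y _ := cokm (@cd A Z (Negz 1) (Negz 0)).
have qi : is_iso q by apply: cokm_zero_iso; apply: zobP.
have sE : ses (einj (bext B) \oc q) (eprj (bext B)) by apply: ses_iso_l (eses _) qi.
pose E := Ext sE; exists E.
apply: (theta_inj (w := stalk1_incS Y)); first exact: stalk1_prT.
have e : bmap B \oc einj E = zlift Z (Negz 0) \oc (idm Y : hom Y (Z (Negz 0))).
  by rewrite [LHS]is_zero_r ?[RHS]is_zero_r.
rewrite eB -(theta_toS (E := E) (h := idm _) e (stalk1_incS Y)).
- congr (_ \oc (dQ _ \oc _)).
  apply: cmap_eq => -[[|n]|[|n]] //=; rewrite ?cmp0m ?cmpm0 ?cmp1m //.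
  by rewrite [LHS]is_zero_r //; apply: zobP.
- by rewrite cmp1m cmpm1.
- exact: cmpm1.
- exact: cmpm1.
Qed.

End Phi.

(** A morphism of extensions is a chain map [c] between the two resolutions, compatible with both
    legs of the roofs. *)
Lemma phi_nat (X Y X' Y' : A) (a : hom Y Y') (b : hom X X') (E : ext X Y)
    (F : ext X' Y') : emor a b E F ->
  cf1 (dshift A) (cf1 Q a) \oc phi E = phi F \oc cf1 Q b.
Proof.
move=> [h [h1 h2]]; pose c : @hom Ch (two (einj E)) (two (einj F)) := two_mor h1.
have -> : cf1 (dshift A) (cf1 Q a) = dQ (cf1 (shift A) (cf1 (stalk A) a)).
  exact: lmapQ.
rewrite /phi cmpA -dQ_cmp.
rewrite [X in dQ X \oc _](_ : _ = (extb F : @hom Ch (two _) (stalk1 Y')) \oc c).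
  rewrite dQ_cmp -!cmpA (dI_sq (b := cf1 (stalk A) b) _ (extq_qis F)) //.
  by apply: cmap_eq => -[[|n]|[|n]] //=; rewrite ?cmp0m ?cmpm0.
apply: cmap_eq => -[[|n]|[|n]] //=; rewrite ?cmp0m ?cmpm0 ?cmp1m ?cmpm1 //.
Qed.

End Stalks.

(** * Recovering an extension from its connecting morphism *)

Section PhiInj.
Variable A : abelian.
Local Notation Ch := (cpx_addcat A).
Local Notation D := (derived A).
Local Notation Q := (canon A).
Local Notation stalk1 Y := (shift A (stalk A Y)).

Section Ext.
Variables X Y : A.

(** The butterfly that the zigzag defining [phi E] makes out of the tautological
    one on [X] is [E] itself, up to the isomorphism [q]. *)
Lemma phi_brel : exists2 q : hom Y (cokob (@cd A (stalk1 Y) (Negz 1) (Negz 0))),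
    is_iso q & forall E : ext X Y, exists2 B : bfly X (trT_d (stalk1 Y)),
    brel (LC (LQ (@qis A) (extb E : @hom Ch (two (einj E)) (stalk1 Y)))
      (LI (extq_qis E))) (stalk_bfly X) B &
    exists h : hom (emid E) (emid (bext B)),
      is_iso h /\ h \oc einj E = einj (bext B) \oc q /\ eprj (bext B) \oc h = eprj E.
Proof.
set Z : Ch := stalk1 Y.
have V0 : is_zero (kerob (@cd A Z (Posz 0) (Posz 1))).
  by apply: kernel_zero; apply: zobP.
pose q : hom Y _ := cokm (@cd A Z (Negz 1) (Negz 0)).
have qi : is_iso q by apply: cokm_zero_iso; apply: zobP.
exists q => // E; have [g [gq qg]] := qi.
pose W : Ch := two (einj E).
pose q1 : hom Y _ := cokm (@cd A W (Negz 1) (Negz 0)).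
have qi1 : is_iso q1 by apply: cokm_zero_iso; apply: zobP.
have [g1 [gq1 qg1]] := qi1.
have sE : ses (einj E \oc g) (eprj E) by apply: ses_iso_l (eses E) _; exists q.
have sE1 : ses (einj E \oc g1) (eprj E) by apply: ses_iso_l (eses E) _; exists q1.
(* The complex [W] is zero in degree 1, so all of [E] consists of cycles. *)
have [|s1 es1] := kernel_lift (g := idm (emid E)) (kermP (@cd A W (Posz 0) (Posz 1))).
  exact: cmp0m.
have bE : (0 : hom (emid E) _) \oc einj (Ext sE) = trT_d Z.
  by rewrite [LHS]is_zero_r ?[RHS]is_zero_r.
have bE1 : s1 \oc einj (Ext sE1) = trT_d W.
  apply: (cokernel_epi (cokmP (@cd A W (Negz 1) (Negz 0)))).
  apply: (kernel_mono (kermP (@cd A W (Posz 0) (Posz 1)))).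
  rewrite trT_dE zliftE /= -!cmpA [kerm _ \oc _]cmpA.
  have -> : g1 \oc cokm (@cd A W (Negz 1) (Negz 0)) = idm Y by exact: gq1.
  by rewrite es1 cmp1m cmpm1.
exists (@Bfly A X _ _ _ (Ext sE) _ bE); last first.
  exists (idm (emid E)); split; first by exists (idm _); rewrite !cmp1m.
  by rewrite /= cmp1m cmpm1 -cmpA gq cmpm1.
(* The intermediate butterfly, over the apex [W]: [E] again, mapped by [eprj E] to the tautological
   butterfly and by the identity to the final one. *)
exists (@Bfly A X _ _ _ (Ext sE1) _ bE1).
  exists (eprj E); split; rewrite /=; last first.
  - apply: (kernel_mono (kermP (@cd A (stalk A X) (Posz 0) (Posz 1)))).
    rewrite [LHS]cmpA stalk_liftE cmp1m [RHS]cmpA.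
    transitivity (extq E (Posz 0) \oc kerm (@cd A W (Posz 0) (Posz 1)) \oc s1).
      by rewrite -cmpA [X in _ \oc X]es1 cmpm1.
    by congr (_ \oc _); apply: esym; apply: (trVE (extq E)).
  - exact: cmp1m.
  - by rewrite cmp0m cmpA (eses E).1.1 cmp0m.
exists (idm (emid E)); split; rewrite /=; last first.
- by rewrite [RHS]is_zero_r // cmp0m.
- exact: cmpm1.
- rewrite cmp1m -cmpA; congr (_ \oc _).
  apply: (cokernel_epi (cokmP (@cd A W (Negz 1) (Negz 0)))).
  rewrite -[RHS]cmpA; apply: (etrans gq1); apply: esym.
  by apply: (etrans (congr1 (cmp g) (trUE (extb E)))); rewrite [X in g \oc X]cmpm1.
Qed.

(** Equal morphisms act alike on the tautological butterfly by [brel_cls], and [phi_brel] identifies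
    the results with [E] and [F]. *)
Lemma phi_inj (E F : ext X Y) : phi E = phi F -> emor (idm Y) (idm X) E F.
Proof.
have [q [g [gq qg]] ex] := phi_brel.
have [B rB [h [_ [hi hp]]]] := ex E.
have [B' rB' [h' [[k [kh' h'k]] [hi' hp']]]] := ex F.
rewrite /phi => e.
have [|t [ti tp _]] := brel_cls _ rB rB'; first by rewrite -!lcmpE; exact: e.
exists (k \oc t \oc h); rewrite cmpm1 cmp1m; split.
  rewrite -!cmpA hi [t \oc _]cmpA ti cmpm1 -hi' cmpA kh' cmp1m //.
by rewrite -hp' !cmpA -[_ \oc k]cmpA h'k cmpm1 tp.
Qed.

End Ext.

Lemma phi_eq (X Y : A) (E F : ext X Y) : emor (idm Y) (idm X) E F -> phi E = phi F.
Proof. by move=> /phi_nat; rewrite !cf1_id cmp1m cmpm1. Qed.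

End PhiInj.

(** * Essential surjectivity and additivity of [X |-> X[0]] *)

Section Density.
Variable A : abelian.
Local Notation Ch := (cpx_addcat A).
Local Notation D := (derived A).

Lemma dQ_iso (X Y : Ch) (s : hom X Y) : qis s -> is_iso (dQ s).
Proof. by move=> w; exists (dI w); rewrite dIQ dQI. Qed.

Lemma dI_iso (X Y : Ch) (s : hom X Y) (w : qis s) : is_iso (dI w).
Proof. by exists (dQ s); rewrite dIQ dQI. Qed.

Lemma cfun_iso (C C' : preadd) (F : cfun C C') (X Y : C) (f : hom X Y) :
  is_iso f -> is_iso (cf1 F f).
Proof.
by move=> [g [gf fg]]; exists (cf1 F g); rewrite -!cf1_cmp gf fg !cf1_id.
Qed.

Lemma zlift_bound (Z : cpx A) :
  zlift Z (Negz 0) = bound (cshort Z (0 - 1) 0 (0 + 1)).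
Proof.
apply: (kernel_mono (kermP (@cd A Z (Posz 0) (Posz 1)))).
by rewrite zliftE; apply/esym; exact: (boundE (cshort Z (0 - 1) 0 (0 + 1))).
Qed.

Definition toH_fun (Z : cpx A) (n : int) :
    hom (trS_ob Z n) (stalk_ob (cohom 0 Z) n) :=
  match n as n0 return hom (trS_ob Z n0) (stalk_ob (cohom 0 Z) n0) with
  | Posz 0 => cokm (bound (cshort Z (0 - 1) 0 (0 + 1))) | _ => 0
  end.

Definition toH (Z : cpx A) : cmap (trS_cpx Z) (stalk_ob (cohom 0 Z)).
Proof.
apply: (@Cmap _ (trS_cpx Z) (stalk_ob (cohom 0 Z)) (toH_fun Z)).
case=> [[|m]|[|m]] [[|n]|n] /=; rewrite ?cmp0m ?cmpm0 //.
  by rewrite zlift_bound; apply: (cokmP (bound (cshort Z (0 - 1) 0 (0 + 1)))).1.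
rewrite [zlift _ _](_ : _ = 0) ?cmpm0 //.
by apply: (kernel_mono (kermP (@cd A Z (Posz 0) (Posz 1))));
  rewrite zliftE cmpm0 cd_shape //; lia.
Defined.

(** In degree 0 the map is the cokernel defining [H^0], so it kills exactly the boundaries;
    elsewhere both cohomologies vanish. *)
Lemma toH_qis (Z : cpx A) : (forall n : int, n != 0 -> is_zero (cohom n Z)) ->
  qis (toH Z : @hom Ch (trS A Z) (stalk A (cohom 0 Z))).
Proof.
move=> Z0; have cb := cokmP (bound (cshort Z (0 - 1) 0 (0 + 1))).
case=> [[|n]|n].
- apply: cohom_isoP => T x.
    move=> _ [T' [e [y [ee]]]]; rewrite cmp0m => /esym xe.
    have {}xe : cokm (bound (cshort Z (0 - 1) 0 (0 + 1))) \oc x = 0.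
      by apply: ee; rewrite cmp0m.
    by move/cok_locimg: xe; rewrite -zlift_bound.
  move=> _; have [T' [e [y [ee ye]]]] := epi_lift x (cokernel_epi cb).
  exists T', e, y, 0; split=> //; first exact: cmp0m.
  by rewrite cmpm0 addr0.
- by apply: is_zero_iso; apply: cohom_zero; [apply: zobP | apply: stalk_zero].
- apply: is_zero_iso; last by apply: cohom_zero; apply: stalk_zero.
  have [|g [gf fg]] := @incS_cohom A Z (Negz n); first by [].
  by rewrite /is_zero -gf (is_zero_r (cohom_map _ (incS Z)) (Z0 (Negz n) _)) ?cmpm0.
Qed.

(** The roof [Z <- trS Z -> H^0(Z)[0]] has two quasi-isomorphisms as legs. *)
Lemma Chat_stalk (P : A -> Prop) (Z : D) : in_Chat P Z ->
  exists2 H, P H & exists f : @hom D (canon A H) Z, is_iso f.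
Proof.
move=> [[H PH [f isof]] Z0]; exists H => //.
have wI : qis (incS Z : @hom Ch (trS A Z) Z).
  by apply: incS_qis => n n0; apply: Z0; lia.
exists (dQ (incS Z : @hom Ch (trS A Z) Z) \oc dI (toH_qis Z0) \oc cf1 (canon A) f).
apply: is_iso_cmp; last exact: cfun_iso.
by apply: is_iso_cmp; [apply: dQ_iso | apply: dI_iso].
Qed.

Lemma canonD (X Y : A) (f g : hom X Y) :
  cf1 (canon A) (f + g) = cf1 (canon A) f + cf1 (canon A) g.
Proof.
have dQD (U V : Ch) (a b : hom U V) : dQ (a + b) = dQ a + dQ b.
  (* Additivity of the action of chain maps, evaluated at the identity of [U]. *)
  have := lQD (@qis_id A) (@qis_bip A) a b (lQ (@qis A) (idm U)).
  by rewrite !lcmpm1.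
rewrite -[RHS]dQD; congr (dQ _); apply: cmap_eq => n /=.
by rewrite /stalk_fun /=; case: (n == 0) => //; rewrite addr0.
Qed.

End Density.

(** * The isomorphism on [Ext^1] *)

Section Ext1.
Variable A : abelian.
Local Notation D := (derived A).
Local Notation Q := (canon A).

Definition ext1_hom (X Y : A) (x : ext1 X Y) : @hom D (Q X) (dshift A (Q Y)) :=
  phi (qrep x).

Lemma ext1_homE (X Y : A) (E : ext X Y) : ext1_hom (ecl E) = phi E.
Proof. exact/phi_eq/ecl_rep. Qed.

Lemma ext1_hom_push (X Y Y' : A) (a : hom Y Y') (x : ext1 X Y) :
  ext1_hom (epush a x) = cf1 (dshift A) (cf1 Q a) \oc ext1_hom x.
Proof. by rewrite ext1_homE (phi_nat (emor_push a (qrep x))) cf1_id cmpm1. Qed.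

Lemma ext1_hom_pull (X X' Y : A) (b : hom X' X) (x : ext1 X Y) :
  ext1_hom (epull b x) = ext1_hom x \oc cf1 Q b.
Proof.
by rewrite ext1_homE -(phi_nat (emor_pull b (qrep x))) !cf1_id cmp1m.
Qed.

(** Two classes are pushouts of a common class [w] along maps [a] and [b], and their sum is the
    pushout along [a + b]; additivity thus follows from naturality. *)
Lemma ext1_homD (X Y : A) : {morph @ext1_hom X Y : x y / x + y}.
Proof.
move=> x y; have [T [w [a [b [-> ->]]]]] := ig_common (@epair1 A X) (@epair2 A X) x y.
have e := epushD a b w; rewrite -[X in ext1_hom X]e.
by rewrite !ext1_hom_push canonD dshift_add cmpDl.
Qed.

Lemma ext1_hom0 (X Y : A) : ext1_hom (0 : ext1 X Y) = 0.
Proof. by apply: (@addrI _ (ext1_hom (0 : ext1 X Y))); rewrite -ext1_homD !addr0. Qed.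

Lemma ext1_hom_inj (X Y : A) : injective (@ext1_hom X Y).
Proof.
elim/qind=> E; elim/qind=> F; rewrite -/(ecl E) -/(ecl F) !ext1_homE.
by move=> /phi_inj/ecl_eq.
Qed.

Lemma ext1_hom_surj (X Y : A) f : exists x, @ext1_hom X Y x = f.
Proof. by have [E ->] := phi_surj f; exists (ecl E); rewrite ext1_homE. Qed.

End Ext1.

Lemma inj_surj_bij (S T : Type) (f : S -> T) :
  injective f -> (forall y, exists x, f x = y) -> bijective f.
Proof. by move=> fi /choice [g fg]; exists g => // x; apply: fi. Qed.

(** * Trivial morphisms and stable Hom groups *)

Section Main.
Variables (A : abelian) (P : A -> Prop).
Local Notation C := (Csub P).
Local Notation C' := (Chat P).

Lemma DCD (X Y : C) (f g : hom X Y) :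
  cf1 (DC P) (f + g) = cf1 (DC P) f + cf1 (DC P) g.
Proof. exact: canonD. Qed.

Lemma DCB (X Y : C) (f g : hom X Y) :
  cf1 (DC P) (f - g) = cf1 (DC P) f - cf1 (DC P) g.
Proof. by apply: (@addIr _ (cf1 (DC P) g)); rewrite -DCD !subrK. Qed.

Lemma DC_full (X Y : C) (f : @hom C' (DC P X) (DC P Y)) :
  exists g : hom X Y, f = cf1 (DC P) g.
Proof. exact: (@canon_full A (sval X) (sval Y) f). Qed.

Lemma DC_dense (M : C') : exists (N : C) (f : @hom C' (DC P N) M), is_iso f.
Proof.
have [H PH [f isof]] := Chat_stalk (svalP M).
by exists (exist P H PH), f.
Qed.

(** One direction tests against stalk complexes only, using injectivity of [ext1_hom]. For the
    other, any test object [M] is isomorphic to a stalk complex, and [x] is transported along the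
    shifted isomorphism. *)
Lemma proj_trivial_DC (X Y : C) (f : hom X Y) :
  proj_trivial (cf1 (DC P) f) <-> proj_trivial f.
Proof.
split=> h M x.
  apply: (@ext1_hom_inj A (sval X) (sval M)).
  rewrite [LHS]ext1_hom_pull ext1_hom0; exact: (h (DC P M) (ext1_hom x)).
have [N [u [v [vu uv]]]] := DC_dense M.
pose v' := cf1 (dshift A) (v : @hom (derived A) (sval M) (canon A (sval N))).
pose u' := cf1 (dshift A) (u : @hom (derived A) (canon A (sval N)) (sval M)).
have uv' : u' \oc v' = idm _ by rewrite -cf1_cmp -cf1_id; congr (cf1 _ _).
have [y ey] := ext1_hom_surj (v' \oc (x : @hom (derived A) _ _)).
have {}h : ext1_hom y \oc cf1 (canon A) (f : @hom A (sval X) (sval Y)) = 0.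
  by rewrite -ext1_hom_pull [epull _ _](h N y) ext1_hom0.
have xE : u' \oc ext1_hom y = x by rewrite ey cmpA uv' cmp1m.
by rewrite -xE; apply: etrans (esym (cmpA _ _ _)) _; rewrite h cmpm0.
Qed.

(** As for projective triviality, with the test object in the first variable, so that the
    isomorphism acts without a shift. *)
Lemma inj_trivial_DC (X Y : C) (f : hom X Y) :
  inj_trivial (cf1 (DC P) f) <-> inj_trivial f.
Proof.
split=> h M x.
  apply: (@ext1_hom_inj A (sval M) (sval Y)).
  rewrite [LHS]ext1_hom_push ext1_hom0; exact: (h (DC P M) (ext1_hom x)).
have [N [u [v [vu uv]]]] := DC_dense M.
have [y ey] := ext1_hom_surj ((x : @hom (derived A) _ _) \oc u).
have {}h : cf1 (dshift A) (cf1 (canon A) (f : @hom A (sval X) (sval Y))) \oc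
    ext1_hom y = 0.
  by rewrite -ext1_hom_push [epush _ _](h N y) ext1_hom0.
have {}uv : (u : @hom (derived A) (canon A (sval N)) (sval M)) \oc v = idm _.
  exact: uv.
have xE : ext1_hom y \oc (v : @hom (derived A) (sval M) (canon A (sval N))) = x.
  by rewrite ey -cmpA uv cmpm1.
by rewrite -xE; apply: etrans (cmpA _ _ _) _; rewrite h cmp0m.
Qed.

Definition ustab_DC (X Y : C) (x : ustab X Y) : ustab (DC P X) (DC P Y) :=
  ucls (cf1 (DC P) (qrep x)).
Definition ostab_DC (X Y : C) (x : ostab X Y) : ostab (DC P X) (DC P Y) :=
  ocls (cf1 (DC P) (qrep x)).

Lemma ustab_DCE (X Y : C) (f : hom X Y) : ustab_DC (ucls f) = ucls (cf1 (DC P) f).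
Proof.
apply/uclsP; rewrite -DCB; apply/proj_trivial_DC.
by apply/uclsP; rewrite /ucls qrepK.
Qed.
Lemma ostab_DCE (X Y : C) (f : hom X Y) : ostab_DC (ocls f) = ocls (cf1 (DC P) f).
Proof.
apply/oclsP; rewrite -DCB; apply/inj_trivial_DC.
by apply/oclsP; rewrite /ocls qrepK.
Qed.

(** Injectivity is the reflection of projective triviality, surjectivity the fullness of [DC]. *)
Lemma ustab_DC_bij (X Y : C) : bijective (@ustab_DC X Y).
Proof.
apply: inj_surj_bij.
  elim/qind=> f; elim/qind=> g; rewrite -/(ucls f) -/(ucls g) !ustab_DCE.
  by move=> /uclsP; rewrite -DCB => /proj_trivial_DC /uclsP.
elim/qind=> f; have [g ->] := DC_full f; exists (ucls g); exact: ustab_DCE.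
Qed.
Lemma ostab_DC_bij (X Y : C) : bijective (@ostab_DC X Y).
Proof.
apply: inj_surj_bij.
  elim/qind=> f; elim/qind=> g; rewrite -/(ocls f) -/(ocls g) !ostab_DCE.
  by move=> /oclsP; rewrite -DCB => /inj_trivial_DC /oclsP.
elim/qind=> f; have [g ->] := DC_full f; exists (ocls g); exact: ostab_DCE.
Qed.

Lemma ustab_DCD (X Y : C) : {morph @ustab_DC X Y : x y / x + y}.
Proof.
elim/qind=> f; elim/qind=> g; rewrite -/(ucls f) -/(ucls g).
by rewrite -uclsD !ustab_DCE DCD uclsD.
Qed.
Lemma ostab_DCD (X Y : C) : {morph @ostab_DC X Y : x y / x + y}.
Proof.
elim/qind=> f; elim/qind=> g; rewrite -/(ocls f) -/(ocls g).
by rewrite -oclsD !ostab_DCE DCD oclsD.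
Qed.

Lemma ustab_DC_cmp (X Y Z : C) (g : hom Y Z) (x : ustab X Y) :
  ustab_DC (ucmp g x) = ucmp (cf1 (DC P) g) (ustab_DC x).
Proof.
elim/qind: x => f; rewrite -/(ucls f) ucmpE [RHS](congr1 _ (ustab_DCE f)).
by rewrite [LHS]ustab_DCE [RHS]ucmpE cf1_cmp.
Qed.
Lemma ostab_DC_cmp (X Y Z : C) (f : hom X Y) (x : ostab Y Z) :
  ostab_DC (ocmp f x) = ocmp (cf1 (DC P) f) (ostab_DC x).
Proof.
elim/qind: x => g; rewrite -/(ocls g) ocmpE [RHS](congr1 _ (ostab_DCE g)).
by rewrite [LHS]ostab_DCE [RHS]ocmpE cf1_cmp.
Qed.

End Main.

Theorem lemma2p8 (A : abelian) (C : A -> Prop) (C_ext : extension_closed C)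
    (X : Csub C) :
  (ess_equiv (DC C) (Ext1_cov X) (Ext1_cov (DC C X)) /\
   ess_equiv (op_cfun (DC C)) (Ext1_contra X) (Ext1_contra (DC C X))) /\
  (ess_equiv (DC C) (uHom_cov X) (uHom_cov (DC C X)) /\
   ess_equiv (op_cfun (DC C)) (oHom_contra X) (oHom_contra (DC C X))).
Proof.
split; split.
- exists (fun Y : Csub C => @ext1_hom A (sval X) (sval Y)); split=> [Y|Y|Y Z f x].
  + exact: ext1_homD.
  + exact: inj_surj_bij (@ext1_hom_inj _ _ _) (@ext1_hom_surj _ _ _).
  + exact: ext1_hom_push.
- exists (fun Y : Csub C => @ext1_hom A (sval Y) (sval X)); split=> [Y|Y|Y Z f x].
  + exact: ext1_homD.
  + exact: inj_surj_bij (@ext1_hom_inj _ _ _) (@ext1_hom_surj _ _ _).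
  + exact: ext1_hom_pull.
- exists (@ustab_DC A C X); split=> [Y|Y|Y Z g x].
  + exact: ustab_DCD.
  + exact: ustab_DC_bij.
  + exact: ustab_DC_cmp.
- exists (fun Y : Csub C => @ostab_DC A C Y X); split=> [Y|Y|Y Z g x].
  + exact: ostab_DCD.
  + exact: ostab_DC_bij.
  + exact: ostab_DC_cmp.
Qed.
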